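(* Let $(M,g)$ be a $pp$-wave of even dimension $n$. Then the critical $Q$-curvature $Q_n$ of $(M,g)$ vanishes.
   Context: An $n$-dimensional $pp$-wave is a Lorentzian manifold $(M,g)$ with a nowhere vanishing parallel null vector field $K$ whose curvature tensor satisfies $R_{ab}{}^{ef}R_{efcd}=0$. Locally it admits coordinates $(x^1,\dots,x^{n-2},u,r)$ with $g=\sum_{i=1}^{n-2}(\mathrm dx^i)^2+2\,\mathrm du\,(\mathrm dr+h\,\mathrm du)$, $h=h(x^i,u)$ smooth, $K=\partial_r$. Let $n=2s$ be even. The critical $Q$-curvature $Q_n$ (Branson's $Q$-curvature of order $n$ in dimension $n$) is a scalar invariant of $g$ which can be computed as follows (Graham-Juhl). Let $g_+=x^{-2}(\mathrm dx^2+g_x)$ on $M\times(0,a)$ be a Poincaré metric for $(M,[g])$ associated with $g$: $g_x$ is a one-parameter family of metrics on $M$ with $g_0=g$, even in $x$, such that $\mathrm{Ric}(g_+)+n\,g_+=O(x^{n-2})$ and the part of $x^{2-n}(\mathrm{Ric}(g_+)+n g_+)|_{x=0}$ tangential to $M$ is $g$-trace-free; it is unique up to adding terms $x^nS_x$ to $g_x$ with $S_0$ trace-free. Define functions $v^{(2k)}$ on $M$ by $$\sqrt{\tfrac{\det(g_x)}{\det(g)}}=1+v^{(2)}x^2+v^{(4)}x^4+\dots+v^{(n)}x^n+\cdots,$$ and linear differential operators $\mathcal A_{2k}$ on $M$, $1\le k\le s-1$, by the asymptotic expansion $U=f+x^2\mathcal A_2f+\dots+x^{n-2}\mathcal A_{n-2}f+O(x^n\log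 x)$ of formal solutions of $\Delta_{g_+}U=0$ with $U|_{x=0}=f$. Then $$2n\,c_{n/2}\,Q_n=n\,v^{(n)}+\sum_{k=1}^{s-1}(n-2k)\,\mathcal A_{2k}^*\,v^{(n-2k)},$$ where $*$ denotes the formal adjoint with respect to $g$ and $c_{n/2}$ is a nonzero constant depending only on $n$. *)

(* Defs.v *)
From mathcomp Require Import all_boot all_order all_algebra.
From mathcomp Require Import all_classical all_reals all_analysis.

Set Implicit Arguments.
Unset Strict Implicit.
Unset Printing Implicit Defensive.

Import Order.TTheory GRing.Theory Num.Theory.
Import numFieldNormedType.Exports.

Local Open Scope classical_set_scope.
Local Open Scope ring_scope.

Section Calculus.
Context {R : realType}.

Definition partial (m : nat) (a : 'I_m) (f : 'rV[R]_m -> R) (y : 'rV[R]_m) : R :=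
  'D_(delta_mx 0 a) f y.

Definition partials (m : nat) (l : seq 'I_m) (f : 'rV[R]_m -> R) : 'rV[R]_m -> R :=
  foldr (@partial m) f l.

(* C^oo on an open set D: a partial derivative of order k that is differentiable
   is continuous and has all the partial derivatives of order k + 1. *)
Definition smooth_on (m : nat) (D : set 'rV[R]_m) (f : 'rV[R]_m -> R) : Prop :=
  forall (l : seq 'I_m) y, D y -> differentiable (partials l f) y.

(* Iterated Lebesgue integral over R^m. *)
Fixpoint integral_rV (m : nat) : ('rV[R]_m -> R) -> R :=
  match m with
  | 0%N => fun f => f 0
  | k.+1 => fun f =>
      \int[@lebesgue_measure R]_(t in setT)
        integral_rV (fun y : 'rV[R]_k => f (row_mx (t%:M : 'rV[R]_1) y))
  end.

End Calculus.

(* Curvature in coordinates of a metric with component matrix G. *)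
Section Curvature.
Context {R : realType} {m : nat}.
Variable G : 'rV[R]_m -> 'M[R]_m.
Implicit Types (y : 'rV[R]_m) (a b c d : 'I_m).

(* Gamma^c_(ab) *)
Definition christoffel y c a b : R :=
  2^-1 * \sum_d invmx (G y) c d *
    (partial a (fun z => G z d b) y + partial b (fun z => G z d a) y
     - partial d (fun z => G z a b) y).

(* R^d_(cab), where R(e_a, e_b) e_c = R^d_(cab) e_d *)
Definition riemann y d c a b : R :=
  partial a (fun z => christoffel z d b c) y
  - partial b (fun z => christoffel z d a c) y
  + \sum_e (christoffel y d a e * christoffel y e b c
            - christoffel y d b e * christoffel y e a c).

(* R_(abcd) *)
Definition riemann_low y a b c d : R := \sum_e G y a e * riemann y e b c d.

(* R_(ab)^(cd) *)
Definition riemann_mixed y a b c d : R :=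
  \sum_e \sum_f riemann_low y a b e f * invmx (G y) e c * invmx (G y) f d.

(* The sign is such that round spheres have positive Ricci tensor. *)
Definition ricci y : 'M[R]_m := \matrix_(c, b) \sum_a riemann y a c a b.

Definition laplacian (u : 'rV[R]_m -> R) y : R :=
  \sum_a \sum_b invmx (G y) a b *
    (partial a (partial b u) y - \sum_c christoffel y c a b * partial c u y).

End Curvature.

Record manifold (R : realType) (n : nat) := Manifold {
  space :> topologicalType;
  chart_index : Type;
  dom : chart_index -> set space;
  chart : chart_index -> space -> 'rV[R]_n;
  param : chart_index -> 'rV[R]_n -> space;
  hausdorff_manifold : hausdorff_space space;
  second_countable_manifold : @second_countable space;
  dom_cover : forall p, exists i, dom i p;
  dom_open : forall i, open (dom i);
  cod_open : forall i, open (chart i @` dom i);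
  chartK : forall i p, dom i p -> param i (chart i p) = p;
  chart_continuous : forall i p, dom i p -> {for p, continuous (chart i)};
  param_continuous : forall i y, (chart i @` dom i) y ->
    {for y, continuous (param i)};
  transition_smooth : forall i j b,
    smooth_on (chart i @` (dom i `&` dom j)) (fun y => chart j (param i y) 0 b)
}.

Section Manifold.
Context {R : realType} {n : nat} {M : manifold R n}.
Local Notation index := (chart_index M).

Definition cod (i : index) : set 'rV[R]_n := chart i @` dom i.

Definition overlap (i j : index) : set 'rV[R]_n := chart i @` (dom i `&` dom j).

Definition transition (i j : index) (y : 'rV[R]_n) : 'rV[R]_n :=
  chart j (param i y).

Definition smooth_fun (f : M -> R) : Prop :=
  forall i, smooth_on (cod i) (f \o param i).

(* z = (x, y) stands for the point of (-a, a) x M of coordinates y in chart i. *)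
Definition coord_x (z : 'rV[R]_(1 + n)) : R := lsubmx z 0 0.

Definition collar (a : R) (i : index) : set 'rV[R]_(1 + n) :=
  [set z | `|coord_x z| < a /\ cod i (rsubmx z)].

Definition collar_coord (F : R -> M -> R) (i : index) (z : 'rV[R]_(1 + n)) : R :=
  F (coord_x z) (param i (rsubmx z)).

Definition smooth_collar_fun (a : R) (F : R -> M -> R) : Prop :=
  forall i, smooth_on (collar a i) (collar_coord F i).

(* Tensor fields are families of components, one for each chart, as functions of
   the coordinates; values outside of cod i are irrelevant. *)
Definition vector_field := index -> 'rV[R]_n -> 'rV[R]_n.
Definition tensor2 := index -> 'rV[R]_n -> 'M[R]_n.

(* In the library's convention, row a of the Jacobian matrix is the derivative
   along the a-th coordinate. *)
Definition is_vector_field (K : vector_field) : Prop :=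
  (forall i b, smooth_on (cod i) (fun y => K i y 0 b)) /\
  (forall i j y, overlap i j y ->
     K j (transition i j y) = K i y *m jacobian (transition i j) y).

Definition is_tensor2 (g : tensor2) : Prop :=
  (forall i a b, smooth_on (cod i) (fun y => g i y a b)) /\
  (forall i j y, overlap i j y ->
     g i y = jacobian (transition i j) y *m g j (transition i j y)
             *m (jacobian (transition i j) y)^T).

(* Signature (-, +, ..., +). *)
Definition lorentzian_form (m : nat) (G : 'M[R]_m) : Prop :=
  G^T = G /\
  exists2 B : 'M[R]_m, B \in unitmx &
    B *m G *m B^T = diag_mx (\row_k (if k == 0%N :> nat then -1 else 1)).

Definition lorentzian_metric (g : tensor2) : Prop :=
  is_tensor2 g /\ forall i y, cod i y -> lorentzian_form (g i y).

Definition nowhere_vanishing (K : vector_field) : Prop :=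
  forall i y, cod i y -> K i y != 0.

Definition null (g : tensor2) (K : vector_field) : Prop :=
  forall i y, cod i y -> K i y *m g i y *m (K i y)^T = 0.

Definition parallel (g : tensor2) (K : vector_field) : Prop :=
  forall i y, cod i y -> forall a b,
    partial a (fun z => K i z 0 b) y
    + \sum_c christoffel (g i) y b a c * K i y 0 c = 0.

Definition pp_wave (g : tensor2) : Prop :=
  [/\ lorentzian_metric g,
      exists K, [/\ is_vector_field K, nowhere_vanishing K, null g K & parallel g K]
    & forall i y, cod i y -> forall a b c d,
        \sum_e \sum_f
          riemann_mixed (g i) y a b e f * riemann_low (g i) y e f c d = 0].

(* Components of x^-2 (dx^2 + g_x). *)
Definition g_plus (gx : R -> tensor2) (i : index) (z : 'rV[R]_(1 + n))
    : 'M[R]_(1 + n) :=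
  (coord_x z ^+ 2)^-1 *:
    block_mx (1%:M : 'M[R]_1) 0 0 (gx (coord_x z) i (rsubmx z)).

Definition collar_pt (x : R) (y : 'rV[R]_n) : 'rV[R]_(1 + n) :=
  row_mx (x%:M : 'rV[R]_1) y.

(* Ric(g_+) + n g_+ *)
Definition einstein_defect (gx : R -> tensor2) (i : index) (y : 'rV[R]_n) (x : R)
    : 'M[R]_(1 + n) :=
  ricci (g_plus gx i) (collar_pt x y) + n%:R *: g_plus gx i (collar_pt x y).

(* The family is indexed by (-a, a), so that smoothness up to x = 0 and evenness
   are literal. *)
Record poincare_metric (g : tensor2) (a : R) (gx : R -> tensor2) : Prop := {
  poincare_gt0 : 0 < a;
  poincare_metric_x : forall x, `|x| < a -> lorentzian_metric (gx x);
  poincare_smooth : forall i b c, smooth_on (collar a i)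
    (fun z => gx (coord_x z) i (rsubmx z) b c);
  poincare_at0 : forall i y, cod i y -> gx 0 i y = g i y;
  poincare_even : forall x i y, `|x| < a -> cod i y -> gx (- x) i y = gx x i y;
  poincare_einstein : forall i y, cod i y ->
    einstein_defect gx i y =O_ (0^'+) (fun x : R => x ^+ (n - 2));
  poincare_trace_free : forall i y, cod i y ->
    exists2 L : 'M[R]_(1 + n),
      (x ^+ (n - 2))^-1 *: einstein_defect gx i y x @[x --> 0^'+] --> L &
      \tr (invmx (g i y) *m drsubmx L) = 0
}.

(* v j is the coefficient of x^j in the Taylor expansion at x = 0 of
   sqrt (det g_x / det g). *)
Definition volume_coefficients (g : tensor2) (gx : R -> tensor2)
    (v : nat -> M -> R) : Prop :=
  forall j i y, cod i y ->
    v j (param i y) =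
    derive1n j (fun x : R => Num.sqrt (\det (gx x i y) / \det (g i y))) 0 / j`!%:R.

Definition operator := (M -> R) -> M -> R.

Definition linear_diff_operator (P : operator) : Prop :=
  exists N : nat, forall i, exists coef : seq 'I_n -> 'rV[R]_n -> R,
    (forall l, smooth_on (cod i) (coef l)) /\
    forall f, smooth_fun f -> forall y, cod i y ->
      P f (param i y) =
      \sum_(k < N.+1) \sum_(l : k.-tuple 'I_n)
        coef l y * partials l (f \o param i) y.

(* A k is A_(2k).  A formal solution of Delta_(g_+) U = 0 has the form
   U = F + x^n log x H with F and H smooth up to x = 0, and solves the equation
   to infinite order at x = 0. *)
Definition solution_operators (a : R) (gx : R -> tensor2) (A : nat -> operator)
    : Prop :=
  (forall k, (0 < k < n./2)%N -> linear_diff_operator (A k)) /\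
  forall f, smooth_fun f ->
    exists F H : R -> M -> R,
    let U (x : R) (p : M) := F x p + x ^+ n * ln x * H x p in
    [/\ smooth_collar_fun a F /\ smooth_collar_fun a H,
        forall p, F 0 p = f p,
        forall k p, (0 < k < n)%N ->
          derive1n k (F ^~ p) 0 / k`!%:R = if odd k then 0 else A k./2 f p
      & forall i y, cod i y -> forall N : nat,
          (fun x => laplacian (g_plus gx i) (collar_coord U i) (collar_pt x y))
            =O_ (0^'+) (fun x : R => x ^+ N)].

Definition compact_support_in (D : set M) (f : M -> R) : Prop :=
  exists2 C : set M, compact C /\ C `<=` D & forall p, ~ C p -> f p = 0.

Definition integral_chart (g : tensor2) (i : index) (f : M -> R) : R :=
  integral_rV
    ((fun y => f (param i y) * Num.sqrt `|\det (g i y)|) \_ (cod i)).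

(* Differential operators being local, test functions supported in the domain of
   a chart determine the formal adjoint. *)
Definition formal_adjoint (g : tensor2) (P Padj : operator) : Prop :=
  linear_diff_operator Padj /\
  forall i f h, smooth_fun f -> smooth_fun h ->
    compact_support_in (dom i) f -> compact_support_in (dom i) h ->
    integral_chart g i (fun p => P f p * h p) =
    integral_chart g i (fun p => f p * Padj h p).

End Manifold.

(* The constant c_k of Graham and Zworski:
   (-1)^k / (2^(2k) k! (k-1)!). *)
Definition c_const (R : realType) (k : nat) : R :=
  (-1) ^+ k / (2 ^+ k.*2 * k`!%:R * (k.-1)`!%:R).

(* Q is the critical Q-curvature Q_n of g, as given by the holographic formula of
   Graham and Juhl; Astar k is the formal adjoint of A_(2k). *)
Definition critical_Q_curvature (R : realType) (n : nat) (M : manifold R n)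
    (g : @tensor2 R n M) (Q : M -> R) : Prop :=
  exists (a : R) (gx : R -> @tensor2 R n M) (v : nat -> M -> R)
    (A Astar : nat -> @operator R n M),
  [/\ poincare_metric g a gx,
      volume_coefficients g gx v,
      solution_operators a gx A,
      forall k, (0 < k < n./2)%N -> formal_adjoint g (A k) (Astar k)
    & forall p, 2 * n%:R * c_const R n./2 * Q p =
        n%:R * v n p
        + \sum_(1 <= k < n./2) (n - k.*2)%:R * Astar k (v (n - k.*2)%N) p].

(* Main.v *)
Require Import Defs.
From HB Require Import structures.
From mathcomp Require Import all_boot all_order all_algebra.
From mathcomp Require Import all_classical all_reals all_analysis.
From mathcomp Require Import perm ring lra zify.

Set Implicit Arguments.
Unset Strict Implicit.
Unset Printing Implicit Defensive.

Import Order.TTheory GRing.Theory Num.Theory.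
Import numFieldNormedType.Exports.

Local Open Scope classical_set_scope.
Local Open Scope ring_scope.

(** Only the Taylor coefficients v^(1), ..., v^(n) of the volume element matter. They
    vanish for a pp-wave; since a linear differential operator maps the zero function
    to zero, the holographic formula then reads 2 n c_(n/2) Q = 0.

    Curvature. Let K be the parallel null field and L its dual covector. The identity
    R_(ab)^(ef) R_(efcd) = 0 makes every curvature two-form R_(ab) null. Being also
    annihilated by K, such a form is divisible by L ([null_form_minkowski]), so it
    vanishes on the orthogonal of L ([wave_curvature_vanish]). With the symmetries of
    the curvature this leaves Ric(g) = rho L L ([wave_ricciE]).

    Deformations. If psi is a function with K psi = 0, then g + psi L L shares with g
    all that is needed: its inverse is g^-1 - psi K K, its Levi-Civita connection
    differs from that of g by a tensor whose contractions vanish, and its Ricci tensor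
    is still a multiple of L L ([hric_pmet_multiple]).

    Formal uniqueness. By induction on the order, the Poincare metric g_x has the form
    g + psi_x L L with K psi_x = 0 modulo x^n ([wave_modulo]). Let H be the coefficient
    of x^m in the difference, where m is even because g_x is. Multiplied by x, the
    tangential part of Ric(g_+) + n g_+ becomes smooth up to x = 0, and its coefficient
    of x^(m-1) is a multiple of L L plus (m/2) ((n - m) H + tr(H) g)
    ([einstein_exp]). If m < n, taking the trace gives tr H = 0, and then H = phi L L
    ([lead_multiple]). The coefficient of x^(m-1) of the mixed part of the Ricci tensor
    is (m/2) (K phi) L, hence K phi = 0 ([mixed_exp], [K_phi]) and psi_x + x^m phi
    continues the induction. If m = n, the trace-free normalisation still
    gives tr H = 0 ([trH_critical]).

    Volume. Consequently tr(g_x^-1 g_x') vanishes modulo x^n ([shape_trace_vanish]). By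
    Jacobi's formula the volume element q satisfies q' = tr(g_x^-1 g_x') q / 2, so its
    derivatives of order 1, ..., n vanish at x = 0 ([volume_derivatives],
    [wave_volume]).

    Everything takes place in one chart, on the cylinder (-a, a) x U over its codomain U
    ([cyl]), and expansions in x are congruences modulo powers of x ([eqv]). *)

(** * Smooth functions on an open set *)

Lemma differentiable_near (R : realType) (V W : normedModType R) (f h : V -> W) z :
  (\near z, f z = h z) -> differentiable f z -> differentiable h z.
Proof.
move=> fh df.
pose k : V -> W := h - f.
suff dk : differentiable k z.
  have -> : h = k + f by rewrite subrK.
  exact: differentiableD.
have E0 : k \o shift z = cst (k z) + (0 : V -> W) +o_ 0 id.
  apply/eqaddoP => _/posnumP[e].
  have : \forall y \near 0, f (y + z) = h (y + z).
    have := fh; rewrite (near_shift 0 z); apply: filterS => y /=.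
    by rewrite subr0.
  apply: filterS => y fhy.
  suff -> : (k \o shift z - (cst (k z) + (0 : V -> W))) y = 0.
    by rewrite normr0 mulr_ge0.
  by rewrite /k !fctE/= (nbhs_singleton fh) fhy !subrr addr0 subr0.
apply/diff_locallyP; rewrite (diff_unique _ E0); last exact: cst_continuous.
by split=> //; exact: cst_continuous.
Qed.

Section SmoothFunctions.
Context {R : realType} {m : nat}.
Local Notation E := 'rV[R]_m.
Implicit Types (f h : E -> R) (a b : 'I_m) (z : E) (l : seq 'I_m).

Variable D : set E.
Hypothesis Dop : open D.

Definition eq_on f h := forall z, D z -> f z = h z.

Lemma eq_on_near f h z : eq_on f h -> D z -> \near z, f z = h z.
Proof. by move=> fh Dz; apply: filterS (open_nbhs_nbhs (conj Dop Dz)) => y /fh. Qed.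

Lemma partial_eq_on a f h : eq_on f h -> eq_on (partial a f) (partial a h).
Proof. by move=> fh z Dz; apply/near_eq_derive/eq_on_near. Qed.

Lemma partials_eq_on l f h : eq_on f h -> eq_on (partials l f) (partials l h).
Proof. by move=> fh; elim: l => //= a l; apply: partial_eq_on. Qed.

Lemma partials_rcons l a f : partials (rcons l a) f = partials l (partial a f).
Proof. by rewrite /partials foldr_rcons. Qed.

(** Closure under a single derivative is enough, so that no Leibniz formula of higher
    order is needed. *)
Lemma smooth_coind (P : (E -> R) -> Prop) :
  (forall f, P f -> (forall z, D z -> differentiable f z) /\
     forall a, exists2 h, P h & eq_on h (partial a f)) ->
  forall f, P f -> smooth_on D f.
Proof.
move=> HP f Pf l; elim/last_ind: l f Pf => [|l a IH] f Pf z Dz.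
  by have [/(_ z Dz)] := HP f Pf.
have [_ /(_ a)[h Ph hE]] := HP f Pf.
rewrite partials_rcons.
apply: differentiable_near (IH _ Ph _ Dz).
by apply: eq_on_near => //; apply: partials_eq_on.
Qed.

Lemma smooth_diff f z : smooth_on D f -> D z -> differentiable f z.
Proof. by move=> Sf; apply: (Sf [::]). Qed.

Lemma smooth_partial a f : smooth_on D f -> smooth_on D (partial a f).
Proof. by move=> Sf l z Dz; rewrite -partials_rcons; apply: Sf. Qed.

Lemma smooth_eq_on f h : eq_on f h -> smooth_on D f -> smooth_on D h.
Proof.
move=> fh Sf l z Dz; apply: differentiable_near (Sf l z Dz).
by apply: eq_on_near => //; apply: partials_eq_on.
Qed.

End SmoothFunctions.

Section PartialRules.
Context {R : realType} {m : nat}.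
Local Notation E := 'rV[R]_m.
Implicit Types (f h : E -> R) (a b : 'I_m) (z : E).

Lemma partialE a f z : partial a f z = 'D_(delta_mx 0 a) f z.
Proof. by []. Qed.

Lemma partial_cst a (c : R) : partial a (fun _ : E => c) = fun=> 0.
Proof. by apply/funext => z; exact: derive_cst. Qed.

Lemma partialD a f h z : differentiable f z -> differentiable h z ->
  partial a (fun x => f x + h x) z = partial a f z + partial a h z.
Proof. by move=> df dh; apply: deriveD; apply: diff_derivable. Qed.

Lemma partialB a f h z : differentiable f z -> differentiable h z ->
  partial a (fun x => f x - h x) z = partial a f z - partial a h z.
Proof. by move=> df dh; apply: deriveB; apply: diff_derivable. Qed.

Lemma partialM a f h z : differentiable f z -> differentiable h z ->
  partial a (fun x => f x * h x) z = partial a f z * h z + f z * partial a h z.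
Proof.
move=> df dh; rewrite /partial [LHS]deriveM; try exact: diff_derivable.
by rewrite addrC mulrC; congr (_ + _); rewrite mulrC.
Qed.

Lemma partialZ a (c : R) f z : differentiable f z ->
  partial a (fun x => c * f x) z = c * partial a f z.
Proof. by move=> df; rewrite partialM// partial_cst mul0r add0r. Qed.

Lemma partialV a f z : differentiable f z -> f z != 0 ->
  partial a (fun x => (f x)^-1) z = - (f z)^-2 * partial a f z.
Proof. by move=> df f0; rewrite /partial [LHS]deriveV//; exact: diff_derivable. Qed.

Lemma differentiable_sumf (I : Type) (r : seq I) (P : pred I) (F : I -> E -> R) z :
  (forall i, P i -> differentiable (F i) z) ->
  differentiable (fun x => \sum_(i <- r | P i) F i x) z.
Proof.
move=> dF; have -> : (fun x => \sum_(i <- r | P i) F i x) = \sum_(i <- r | P i) F i.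
  by apply/funext => x; rewrite fct_sumE.
elim/big_rec: _ => [|i f Pi df]; first exact: differentiable_cst.
by apply: differentiableD => //; apply: dF.
Qed.

Lemma partial_sum a (I : Type) (r : seq I) (P : pred I) (F : I -> E -> R) z :
  (forall i, P i -> differentiable (F i) z) ->
  partial a (fun x => \sum_(i <- r | P i) F i x) z =
  \sum_(i <- r | P i) partial a (F i) z.
Proof.
move=> dF; elim: r => [|i r IH].
  rewrite big_nil -[RHS](congr1 (@^~ z) (partial_cst a 0)).
  by congr (partial _ _ _); apply/funext => x; rewrite big_nil.
rewrite big_cons -IH; case: ifP => Pi.
  rewrite -partialD//; [|exact: dF|exact: differentiable_sumf].
  by congr (partial _ _ _); apply/funext => x; rewrite big_cons Pi.
by congr (partial _ _ _); apply/funext => x; rewrite big_cons Pi.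
Qed.

End PartialRules.

Section SmoothClosure.
Context {R : realType} {m : nat}.
Local Notation E := 'rV[R]_m.
Variable D : set E.
Hypothesis Dop : open D.
Implicit Types (f h : E -> R).

(** Derivatives of products and inverses involve sums and further products: only the
    operations taken together form a class that is stable under derivatives. *)
Inductive smooth_closure : (E -> R) -> Prop :=
| SC_base f : smooth_on D f -> smooth_closure f
| SC_cst c : smooth_closure (fun=> c)
| SC_add f h : smooth_closure f -> smooth_closure h ->
    smooth_closure (fun z => f z + h z)
| SC_mul f h : smooth_closure f -> smooth_closure h ->
    smooth_closure (fun z => f z * h z)
| SC_inv f : smooth_closure f -> (forall z, D z -> f z != 0) ->
    smooth_closure (fun z => (f z)^-1).

Lemma smooth_closureP f : smooth_closure f -> smooth_on D f.
Proof.
apply: smooth_coind => // {}f.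
have cf0 : (fun _ : E => 0 : R) = fun=> 0 by [].
elim=> {f}[f Sf|c|f h Cf [df IHf] Ch [dh IHh]|f h Cf [df IHf] Ch [dh IHh]
          |f Cf [df IHf] f0].
- split=> [z Dz|a]; first exact: smooth_diff Dz.
  by exists (partial a f) => //; apply/SC_base/smooth_partial.
- split=> [z _|a]; first exact: differentiable_cst.
  by exists (fun=> 0); [exact: SC_cst|rewrite partial_cst].
- split=> [z Dz|a]; first by apply: differentiableD; [exact: df|exact: dh].
  have [f' Cf' Ef] := IHf a; have [h' Ch' Eh] := IHh a.
  exists (fun z => f' z + h' z); first exact: SC_add.
  by move=> z Dz; rewrite partialD ?Ef ?Eh//; [exact: df|exact: dh].
- split=> [z Dz|a]; first by apply: differentiableM; [exact: df|exact: dh].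
  have [f' Cf' Ef] := IHf a; have [h' Ch' Eh] := IHh a.
  exists (fun z => f' z * h z + f z * h' z).
    by apply: SC_add; apply: SC_mul.
  by move=> z Dz; rewrite partialM ?Ef ?Eh//; [exact: df|exact: dh].
- split=> [z Dz|a]; first by apply: differentiableV; [exact: df|exact: f0].
  have [f' Cf' Ef] := IHf a.
  exists (fun z => (-1) * ((f z)^-1 * (f z)^-1) * f' z).
    do 2![apply: SC_mul => //]; first exact: SC_cst.
    by apply: SC_mul; apply: SC_inv.
  move=> z Dz; rewrite partialV ?Ef//; [|exact: df|exact: f0].
  by rewrite mulN1r expr2 invfM.
Qed.

Lemma smooth_cst (c : R) : smooth_on D (fun=> c).
Proof. by apply: smooth_closureP; apply: SC_cst. Qed.

Lemma smoothD f h : smooth_on D f -> smooth_on D h ->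
  smooth_on D (fun z => f z + h z).
Proof. by move=> Sf Sh; apply: smooth_closureP; apply: SC_add; apply: SC_base. Qed.

Lemma smoothM f h : smooth_on D f -> smooth_on D h ->
  smooth_on D (fun z => f z * h z).
Proof. by move=> Sf Sh; apply: smooth_closureP; apply: SC_mul; apply: SC_base. Qed.

Lemma smoothV f : smooth_on D f -> (forall z, D z -> f z != 0) ->
  smooth_on D (fun z => (f z)^-1).
Proof. by move=> Sf f0; apply: smooth_closureP; apply: SC_inv => //; apply: SC_base. Qed.

Lemma smoothZ c f : smooth_on D f -> smooth_on D (fun z => c * f z).
Proof. by move=> Sf; apply: smoothM => //; apply: smooth_cst. Qed.

Lemma smoothN f : smooth_on D f -> smooth_on D (fun z => - f z).
Proof.
by move=> Sf; have := smoothZ (-1) Sf; congr smooth_on; apply/funext => z; rewrite mulN1r.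
Qed.

Lemma smoothB f h : smooth_on D f -> smooth_on D h ->
  smooth_on D (fun z => f z - h z).
Proof. by move=> Sf Sh; apply: smoothD => //; apply: smoothN. Qed.

Lemma smoothX f k : smooth_on D f -> smooth_on D (fun z => f z ^+ k).
Proof.
move=> Sf; elim: k => [|k IH]; first exact: smooth_cst.
have -> : (fun z => f z ^+ k.+1) = (fun z => f z * f z ^+ k).
  by apply/funext => z; rewrite exprS.
exact: smoothM.
Qed.

Lemma smooth_sum (I : Type) (r : seq I) (P : pred I) (F : I -> E -> R) :
  (forall i, P i -> smooth_on D (F i)) ->
  smooth_on D (fun z => \sum_(i <- r | P i) F i z).
Proof.
move=> SF; elim: r => [|i r IH].
  have -> : (fun z => \sum_(i <- [::] | P i) F i z) = fun=> 0.
    by apply/funext => z; rewrite big_nil.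
  exact: smooth_cst.
case Pi: (P i).
  have -> : (fun z => \sum_(i <- i :: r | P i) F i z) =
            (fun z => F i z + \sum_(i <- r | P i) F i z).
    by apply/funext => z; rewrite big_cons Pi.
  by apply: smoothD => //; apply: SF.
by apply: smooth_eq_on IH => // z _; rewrite big_cons Pi.
Qed.

Lemma smooth_prod (I : Type) (r : seq I) (P : pred I) (F : I -> E -> R) :
  (forall i, P i -> smooth_on D (F i)) ->
  smooth_on D (fun z => \prod_(i <- r | P i) F i z).
Proof.
move=> SF; elim: r => [|i r IH].
  have -> : (fun z => \prod_(i <- [::] | P i) F i z) = fun=> 1.
    by apply/funext => z; rewrite big_nil.
  exact: smooth_cst.
case Pi: (P i).
  have -> : (fun z => \prod_(i <- i :: r | P i) F i z) =
            (fun z => F i z * \prod_(i <- r | P i) F i z).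
    by apply/funext => z; rewrite big_cons Pi.
  by apply: smoothM => //; apply: SF.
by apply: smooth_eq_on IH => // z _; rewrite big_cons Pi.
Qed.

Lemma smooth_det k (A : E -> 'M[R]_k) : (forall i j, smooth_on D (fun z => A z i j)) ->
  smooth_on D (fun z => \det (A z)).
Proof.
move=> SA; apply: smooth_sum => s _; apply: smoothM; first exact: smooth_cst.
by apply: smooth_prod => i _.
Qed.

Lemma smooth_invmx k (A : E -> 'M[R]_k) : (forall i j, smooth_on D (fun z => A z i j)) ->
  (forall z, D z -> A z \in unitmx) ->
  forall i j, smooth_on D (fun z => invmx (A z) i j).
Proof.
move=> SA uA i j.
apply: (@smooth_eq_on _ _ _ Dop (fun z => (\det (A z))^-1 * cofactor (A z) j i)).
  by move=> z Dz; rewrite /invmx uA// !mxE.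
apply: smoothM.
  by apply: smoothV => [|z Dz]; [exact: smooth_det|rewrite -unitfE -unitmxE uA].
rewrite /cofactor; apply: smoothZ; apply: smooth_det => a b.
have -> : (fun z => row' j (col' i (A z)) a b) = (fun z => A z (lift j a) (lift i b)).
  by apply/funext => z; rewrite !mxE.
exact: SA.
Qed.

End SmoothClosure.

(** * Derivatives along lines and symmetry of second derivatives *)

(** The derivative along a direction depends on the increments along it only; this
    gives all the changes of variables by translations and linear maps. *)
Lemma eq_increment (R : realType) (U V W : normedModType R) (f : U -> W) (g : V -> W) a v b w :
  (forall h : R, f (h *: v + a) - f a = g (h *: w + b) - g b) ->
  'D_v f a = 'D_w g b /\ (derivable f a v -> derivable g b w).
Proof.
move=> fg; rewrite /derive /derivable.
suff -> : (fun h : R => h^-1 *: ((f \o shift a) (h *: v) - f a)) =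
          (fun h : R => h^-1 *: ((g \o shift b) (h *: w) - g b)) by [].
by apply/funext => h /=; rewrite fg.
Qed.

Section Lines.
Context {R : realType} {V W : normedModType R}.
Implicit Types (f : V -> W) (v w z : V).

Lemma derive_line f v z (t : R) :
  'D_1 (fun s : R => f (s *: v + z)) t = 'D_v f (t *: v + z).
Proof.
apply: (eq_increment _).1 => h.
by rewrite (_ : h *: (1 : R) = h) ?scalerDl ?addrA//; exact: mulr1.
Qed.

Lemma derivable_line f v z (t : R) :
  derivable f (t *: v + z) v -> derivable (fun s : R => f (s *: v + z)) t 1.
Proof.
apply: (eq_increment _).2 => h.
by rewrite (_ : h *: (1 : R) = h) ?scalerDl ?addrA//; exact: mulr1.
Qed.

Lemma derive_shiftE f v w z : 'D_v (fun y => f (y + w)) z = 'D_v f (z + w).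
Proof. by apply: (eq_increment _).1 => h; rewrite addrA. Qed.

End Lines.

Lemma derive_linear_comp (R : realType) (U V W : normedModType R)
  (phi : {linear U -> V}) (f : V -> W) (v z : U) :
  'D_v (f \o phi) z = 'D_(phi v) f (phi z).
Proof. by apply: (eq_increment _).1 => h /=; rewrite linearP. Qed.

Lemma differentiable_shift (R : realType) (V W : normedModType R) (f : V -> W) w z :
  differentiable f (z + w) -> differentiable (fun y => f (y + w)) z.
Proof.
by move=> df; apply: (@differentiable_comp _ _ _ _ (fun y => y + w) f).
Qed.

Section Schwarz.
Context {R : realType}.

Lemma MVT_line (V : normedModType R) (f : V -> R) (v z : V) (h : R) : 0 < h ->
  (forall t, 0 <= t <= h -> differentiable f (t *: v + z)) ->
  exists2 c, 0 < c < h & f (h *: v + z) - f z = 'D_v f (c *: v + z) * h.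
Proof.
move=> h0 df.
have dl t : 0 <= t <= h -> derivable (fun s : R => f (s *: v + z)) t 1.
  by move=> th; apply: derivable_line; apply: diff_derivable; apply: df.
have [] := @MVT R (fun s : R => f (s *: v + z)) (fun c => 'D_v f (c *: v + z)) 0 h h0.
- move=> t; rewrite in_itv/= => /andP[t0 th]; rewrite -derive_line.
  by apply: derivableP; apply: dl; rewrite !ltW.
- apply: derivable_within_continuous => t; rewrite in_itv/= => th.
  exact: dl.
move=> c; rewrite in_itv/= => ch; rewrite subr0 scale0r add0r => E.
by exists c.
Qed.

Context {m : nat}.
Variable D : set 'rV[R]_m.
Hypothesis Dop : open D.

(** The mean value theorem along a, applied to the increment along b, and then along b,
    applied to the derivative along a. *)
Lemma second_difference (f : 'rV[R]_m -> R) a b z h : smooth_on D f -> 0 < h ->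
  (forall s t, 0 <= s <= h -> 0 <= t <= h ->
     D (t *: delta_mx 0 b + (s *: delta_mx 0 a + z))) ->
  exists s t, [/\ 0 < s < h, 0 < t < h &
   f (h *: delta_mx 0 b + (h *: delta_mx 0 a + z)) - f (h *: delta_mx 0 a + z)
   - f (h *: delta_mx 0 b + z) + f z =
   partial b (partial a f) (t *: delta_mx 0 b + (s *: delta_mx 0 a + z)) * h * h].
Proof.
move=> Sf h0 HD.
set ea := delta_mx 0 a; set eb := delta_mx 0 b.
have hh : 0 <= h <= h by rewrite lexx ltW.
have zh : 0 <= (0 : R) <= h by apply/andP; split=> //; exact: ltW.
have d1 s : 0 <= s <= h -> differentiable f (s *: ea + z + h *: eb).
  by move=> sh; rewrite addrC; apply: smooth_diff Sf _; apply: HD.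
have d2 s : 0 <= s <= h -> differentiable f (s *: ea + z).
  move=> sh; apply: smooth_diff Sf _; have := HD s 0 sh zh.
  by rewrite scale0r add0r.
have [|s sh E1] := @MVT_line _ (fun y => f (y + h *: eb) - f y) ea z h h0.
  move=> s sh; apply: differentiableB; last exact: d2.
  by apply: differentiable_shift; exact: d1.
have sh' : 0 <= s <= h by case/andP: sh => *; rewrite !ltW.
have [|t th E2] := @MVT_line _ (partial a f) eb (s *: ea + z) h h0.
  by move=> t th; apply: (smooth_diff (smooth_partial _ Sf)); apply: HD.
exists s, t; split=> //.
transitivity ((f (h *: ea + z + h *: eb) - f (h *: ea + z) - (f (z + h *: eb) - f z))).
  by rewrite [h *: eb + _]addrC [h *: eb + z]addrC opprB; ring.
rewrite E1 deriveB; [|apply: diff_derivable..]; last exact: d2.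
  rewrite derive_shiftE; congr (_ * _).
  by rewrite -/(partial a f _) -/(partial a f _) [_ + h *: eb]addrC E2.
by apply: differentiable_shift; apply: d1.
Qed.

(** Both mixed derivatives are limits of the same second difference quotient. *)
Lemma partialC (f : 'rV[R]_m -> R) a b z : smooth_on D f -> D z ->
  partial a (partial b f) z = partial b (partial a f) z.
Proof.
move=> Sf Dz.
have cont c d : {for z, continuous (partial c (partial d f))}.
  apply: differentiable_continuous.
  by apply: (@smooth_diff _ _ D) => //; do 2!apply: smooth_partial.
apply/eqP; rewrite -subr_eq0 -normr_le0; apply/ler_addgt0Pr => _/posnumP[e].
rewrite add0r.
have e2 : 0 < e%:num / 2 by [].
have near_z c d : \forall y \near z,
    `|partial c (partial d f) z - partial c (partial d f) y| < e%:num / 2.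
  by have /cvgrPdist_lt := cont c d; apply.
have : \forall y \near z, [/\ D y,
    `|partial a (partial b f) z - partial a (partial b f) y| < e%:num / 2 &
    `|partial b (partial a f) z - partial b (partial a f) y| < e%:num / 2].
  by apply: filterS3 (open_nbhs_nbhs (conj Dop Dz)) (near_z a b) (near_z b a).
move=> /nbhs_normP[_/posnumP[d] Hd].
(* Two steps of length h in coordinate directions stay in the ball of radius d. *)
pose h := d%:num / 4.
have h0 : 0 < h by rewrite divr_gt0.
have nb s t c c' : 0 <= s <= h -> 0 <= t <= h ->
    `|z - (t *: delta_mx 0 c + (s *: delta_mx 0 c' + z))| < d%:num.
  move=> /andP[s0 sh] /andP[t0 th]; rewrite distrC addrA addrK.
  have nd (k : 'I_m) : `|delta_mx 0 k : 'rV[R]_m| <= 1.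
    rewrite [`|_|]mx_normrE; apply/bigmax_leP; split=> // -[i j] _ /=.
    by rewrite mxE; case: (_ && _); rewrite ?normr1 ?normr0.
  apply: (@le_lt_trans _ _ (t * 1 + s * 1)).
    apply: (le_trans (ler_normD _ _)); rewrite !normrZ !ger0_norm//.
    by apply: lerD; apply: ler_wpM2l.
  rewrite !mulr1; apply: (@le_lt_trans _ _ (h + h)); first exact: lerD.
  by rewrite /h; have : 0 < d%:num by []; move: (d%:num) => x x0; lra.
have HD c c' s t : 0 <= s <= h -> 0 <= t <= h ->
    D (t *: delta_mx 0 c + (s *: delta_mx 0 c' + z)).
  by move=> sh th; have [] := Hd _ (nb s t c c' sh th).
have [s [t [sh th E1]]] := second_difference Sf h0 (HD b a).
have [s' [t' [sh' th' E2]]] := second_difference Sf h0 (HD a b).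
have W x : 0 < x < h -> 0 <= x <= h by move=> /andP[? ?]; rewrite !ltW.
have [_ _ B1] := Hd _ (nb s t b a (W _ sh) (W _ th)).
have [_ B2 _] := Hd _ (nb s' t' a b (W _ sh') (W _ th')).
set P1 := partial b _ (t *: _ + _) in E1 B1.
set P2 := partial a _ (t' *: _ + _) in E2 B2.
have E : P1 = P2.
  apply: (mulIf (lt0r_neq0 h0)); apply: (mulIf (lt0r_neq0 h0)).
  apply: etrans (esym E1) (etrans _ E2).
  rewrite (addrCA (h *: delta_mx 0 b) (h *: delta_mx 0 a) z); ring.
rewrite -E in B2; move: B1 B2; set x := partial a _ z; set y := partial b _ z.
move=> B1 B2; have -> : x - y = (x - P1) - (y - P1) by ring.
apply: (le_trans (ler_normB _ _)).
apply: (le_trans (lerD (ltW B2) (ltW B1))).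
by rewrite -splitr.
Qed.

End Schwarz.

Section LinearReindexing.
Context {R : realType}.

Lemma linear_rV_differentiable (m : nat) (W : normedModType R)
  (phi : {linear 'rV[R]_m -> W}) z : differentiable phi z.
Proof.
have -> : (phi : _ -> _) = \sum_a (fun z : 'rV[R]_m => z 0 a *: phi (delta_mx 0 a)).
  apply/funext => y; rewrite fct_sumE {1}(row_sum_delta y) linear_sum.
  by apply: eq_bigr => a _; rewrite linearZ.
apply: differentiable_sum => a; apply: differentiableZl.
exact: differentiable_coord.
Qed.

(** A linear map that sends every coordinate direction to a coordinate direction
    or to zero turns partial derivatives into partial derivatives. *)
Lemma smooth_comp_linear m k (D : set 'rV[R]_m) (D' : set 'rV[R]_k)
    (phi : {linear 'rV[R]_m -> 'rV[R]_k}) (s : 'I_m -> option 'I_k) f :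
  open D -> (forall z, D z -> D' (phi z)) ->
  (forall a, phi (delta_mx 0 a) = if s a is Some b then delta_mx 0 b else 0) ->
  smooth_on D' f -> smooth_on D (f \o phi).
Proof.
move=> Dop DD' phis Sf.
apply: (@smooth_coind _ _ D Dop (fun u => exists2 h, smooth_on D' h & u = h \o phi));
  last by exists f.
move=> _ [h Sh ->]; split=> [z Dz|a].
  apply: differentiable_comp; first exact: linear_rV_differentiable.
  by apply: smooth_diff Sh _; exact: DD'.
exists (if s a is Some b then partial b h \o phi else fun=> 0).
  case: (s a) => [b|]; first by exists (partial b h) => //; exact: smooth_partial.
  exists (fun=> 0) => //.
  by move=> l y _; elim/last_ind: l => [|l c IH];
     [exact: differentiable_cst|rewrite partials_rcons partial_cst].
move=> z _; rewrite /partial derive_linear_comp phis.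
by case: (s a) => [b|] //; rewrite derive0.
Qed.

End LinearReindexing.

Local Opaque partial.

(** * The collar and its coordinates *)

Section Collar.
Context {R : realType} {n : nat}.
Variables (U : set 'rV[R]_n) (r : R).
Hypotheses (Uop : open U) (r_gt0 : 0 < r).
Local Notation E := 'rV[R]_(1 + n).
Implicit Types (f h : E -> R) (z : E) (y : 'rV[R]_n) (a b : 'I_n).

Definition cyl : set E := [set z | `|coord_x z| < r /\ U (rsubmx z)].

Definition d0 : (E -> R) -> E -> R := partial (lshift n ord0).
Definition dh a : (E -> R) -> E -> R := partial (rshift 1 a).

(** The projection onto the slice at 0 and the reflection across it are linear, so that
    the chain rule applies to them in the simple form of [derive_linear_comp]. *)
Definition to0 : {linear E -> E} := mulmxr (block_mx 0 0 0 1%:M).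
Definition refl : {linear E -> E} := mulmxr (block_mx (-1)%:M 0 0 1%:M).

Lemma to0E z : to0 z = collar_pt 0 (rsubmx z).
Proof.
rewrite /= -{1}[z]hsubmxK mul_row_block !mulmx0 mulmx1 addr0 add0r.
by congr row_mx; apply/matrixP => i j; rewrite !mxE mul0rn.
Qed.

Lemma reflE z : refl z = collar_pt (- coord_x z) (rsubmx z).
Proof.
rewrite /= -{1}[z]hsubmxK mul_row_block !mulmx0 mulmx1 addr0 add0r mul_mx_scalar.
congr row_mx; apply/matrixP => i j; rewrite !ord1 !mxE mulN1r.
by rewrite /coord_x mxE mulr1n.
Qed.

Lemma coord_pt x y : coord_x (collar_pt x y) = x.
Proof. by rewrite /coord_x row_mxKl mxE. Qed.

Lemma rsub_pt x y : rsubmx (collar_pt x y) = y.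
Proof. exact: row_mxKr. Qed.

Lemma collar_ptK z : collar_pt (coord_x z) (rsubmx z) = z.
Proof.
rewrite /collar_pt -[RHS]hsubmxK; congr row_mx.
by apply/matrixP => i j; rewrite !ord1 !mxE mulr1n /coord_x mxE.
Qed.

Lemma cyl_pt x y : `|x| < r -> U y -> cyl (collar_pt x y).
Proof. by rewrite /cyl /= coord_pt rsub_pt. Qed.

Lemma cyl_pt0 y : U y -> cyl (collar_pt 0 y).
Proof. by apply: cyl_pt; rewrite normr0. Qed.

Lemma cyl_to0 z : cyl z -> cyl (to0 z).
Proof. by case=> _ Uz; rewrite to0E; apply: cyl_pt0. Qed.

Lemma cyl_refl z : cyl z -> cyl (refl z).
Proof. by case=> xz Uz; rewrite reflE; apply: cyl_pt; rewrite ?normrN. Qed.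

Lemma to0_id z : coord_x z = 0 -> to0 z = z.
Proof. by move=> z0; rewrite to0E -{1}z0 collar_ptK. Qed.

Lemma coord_to0 z : coord_x (to0 z) = 0.
Proof. by rewrite to0E coord_pt. Qed.

Lemma coord_delta0 : coord_x (delta_mx 0 (lshift n ord0)) = 1 :> R.
Proof. by rewrite /coord_x !mxE !eqxx. Qed.

Lemma coord_deltah a : coord_x (delta_mx 0 (rshift 1 a)) = 0 :> R.
Proof. by rewrite /coord_x !mxE eq_lrshift andbF. Qed.

Lemma rsub_delta0 : rsubmx (delta_mx 0 (lshift n ord0) : E) = 0.
Proof. by apply/matrixP => i j; rewrite !mxE eq_rlshift andbF. Qed.

Lemma rsub_deltah a : rsubmx (delta_mx 0 (rshift 1 a) : E) = delta_mx 0 a.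
Proof. by apply/matrixP => i j; rewrite !ord1 !mxE eq_rshift. Qed.

Lemma coord_xP (c : R) v z : coord_x (c *: v + z) = c * coord_x v + coord_x z.
Proof. by rewrite /coord_x !mxE. Qed.

Lemma rsubmxP (c : R) (v z : E) : rsubmx (c *: v + z) = c *: rsubmx v + rsubmx z.
Proof. by apply/matrixP => i j; rewrite !mxE. Qed.

Lemma collar_pt_delta0 x y :
  collar_pt x y = x *: delta_mx 0 (lshift n ord0) + collar_pt 0 y.
Proof.
rewrite -[RHS]collar_ptK coord_xP rsubmxP coord_delta0 rsub_delta0 scaler0 add0r.
by rewrite coord_pt rsub_pt addr0 mulr1.
Qed.

Lemma differentiable_coord_x z : differentiable (@coord_x R n) z.
Proof.
have -> : @coord_x R n = (fun z : E => z 0 (lshift n ord0)).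
  by apply/funext => y; rewrite /coord_x mxE.
exact: differentiable_coord.
Qed.

Lemma cyl_open : open cyl.
Proof.
have -> : cyl = (fun z => `|coord_x z|) @^-1` [set x | x < r] `&` rsubmx @^-1` U.
  by [].
apply: openI.
  apply: open_comp; last exact: open_lt.
  move=> z _; apply: continuous_comp; last exact: norm_continuous.
  exact/differentiable_continuous/differentiable_coord_x.
apply: open_comp => // z _; apply: differentiable_continuous.
exact: (@linear_rV_differentiable _ _ _ rsubmx).
Qed.
Hint Resolve cyl_open : core.

Local Notation S := (smooth_on cyl).
Local Notation "f =D h" := (eq_on cyl f h) (at level 70).

Lemma derive_coord_x v z : 'D_v (@coord_x R n) z = coord_x v.
Proof.
rewrite -[RHS](derive_id (coord_x z)); apply: (eq_increment _).1 => c.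
by rewrite coord_xP.
Qed.

Lemma d0_coord_x : d0 (@coord_x R n) = fun=> 1.
Proof. by apply/funext => z; rewrite /d0 partialE derive_coord_x coord_delta0. Qed.

Lemma dh_coord_x a : dh a (@coord_x R n) = fun=> 0.
Proof. by apply/funext => z; rewrite /dh partialE derive_coord_x coord_deltah. Qed.

Lemma smooth_coord_x : S (@coord_x R n).
Proof.
apply: (@smooth_coind _ _ cyl _ (fun f => f = @coord_x R n \/ exists c, f = fun=> c));
  [done| |by left].
move=> f [->|[c ->]]; split=> [z _|a].
- exact: differentiable_coord_x.
- by exists (fun=> coord_x (delta_mx 0 a)); [right; exists (coord_x (delta_mx 0 a))|
    move=> z _; rewrite partialE derive_coord_x].
- exact: differentiable_cst.
- by exists (fun=> 0); [right; exists 0|rewrite partial_cst].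
Qed.

Lemma smooth_d0 f : S f -> S (d0 f). Proof. exact: smooth_partial. Qed.
Lemma smooth_dh a f : S f -> S (dh a f). Proof. exact: smooth_partial. Qed.

Lemma smooth_iter j f : S f -> S (iter j d0 f).
Proof. by move=> Sf; elim: j => //= j; apply: smooth_d0. Qed.

Lemma iter_eq_on j f h : f =D h -> iter j d0 f =D iter j d0 h.
Proof. by move=> fh; elim: j => //= j; apply: partial_eq_on. Qed.

Lemma d0D f h : S f -> S h -> d0 (fun z => f z + h z) =D (fun z => d0 f z + d0 h z).
Proof. by move=> Sf Sh z Dz; rewrite /d0 partialD//; exact: smooth_diff Dz. Qed.

Lemma d0M f h : S f -> S h ->
  d0 (fun z => f z * h z) =D (fun z => d0 f z * h z + f z * d0 h z).
Proof. by move=> Sf Sh z Dz; rewrite /d0 partialM//; exact: smooth_diff Dz. Qed.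

Lemma iterD j f h : S f -> S h ->
  iter j d0 (fun z => f z + h z) =D (fun z => iter j d0 f z + iter j d0 h z).
Proof.
move=> Sf Sh; elim: j => //= j IH z Dz.
apply: etrans (partial_eq_on cyl_open _ IH Dz) _.
by apply: d0D => //; exact: smooth_iter.
Qed.

Lemma iter_cst j (c : R) : iter j d0 (fun=> c) = fun=> if j == 0 then c else 0.
Proof. by elim: j => //= j ->; rewrite /d0; case: eqP; rewrite partial_cst. Qed.

Lemma iter_dh j a f : S f -> iter j d0 (dh a f) =D dh a (iter j d0 f).
Proof.
move=> Sf; elim: j => //= j IH z Dz.
apply: etrans (partial_eq_on cyl_open _ IH Dz) _.
by apply: (@partialC _ _ cyl) => //; exact: smooth_iter.
Qed.

(** * Congruence of Taylor expansions *)

(** Congruence modulo the m-th power of the transversal coordinate. Being required along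
    the whole slice, it is preserved by derivatives in the directions of the slice. *)
Definition eqv m f h := [/\ S f, S h &
  forall j z, (j < m)%N -> cyl z -> coord_x z = 0 -> iter j d0 f z = iter j d0 h z].

Lemma eqv_refl m f : S f -> eqv m f f. Proof. by []. Qed.

Lemma eqv_sym m f h : eqv m f h -> eqv m h f.
Proof. by case=> Sf Sh E; split=> // j z *; rewrite E. Qed.

Lemma eqv_trans m f h k : eqv m f h -> eqv m h k -> eqv m f k.
Proof. by move=> [Sf Sh E] [_ Sk F]; split=> // j z *; rewrite E// F. Qed.

Lemma eqv_le m p f h : (p <= m)%N -> eqv m f h -> eqv p f h.
Proof. by move=> pm [Sf Sh E]; split=> // j z jp; apply: E; exact: leq_trans pm. Qed.

Lemma eqv_eq_on m f h : S f -> f =D h -> eqv m f h.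
Proof.
move=> Sf fh; split=> //; first exact: smooth_eq_on fh Sf.
by move=> j z _ Dz _; apply: iter_eq_on.
Qed.

Lemma eqv_d0 m f h : eqv m.+1 f h -> eqv m (d0 f) (d0 h).
Proof.
case=> Sf Sh E; split; [exact: smooth_d0..|].
by move=> j z jm Dz z0; rewrite -!iterSr E.
Qed.

(** Derivatives along the slice commute with the restriction to it. *)
Lemma partial_slice a f h : (forall z, cyl z -> coord_x z = 0 -> f z = h z) ->
  forall z, cyl z -> coord_x z = 0 -> dh a f z = dh a h z.
Proof.
move=> fh z Dz z0.
have slice k : dh a k z = dh a (k \o to0) z.
  rewrite {2}/dh partialE derive_linear_comp to0_id//.
  by rewrite to0_id// coord_deltah.
rewrite slice [RHS]slice; apply: partial_eq_on Dz => // w Dw /=.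
by apply: fh; [exact: cyl_to0|exact: coord_to0].
Qed.

Lemma eqv_dh m a f h : eqv m f h -> eqv m (dh a f) (dh a h).
Proof.
case=> Sf Sh E; split; [exact: smooth_dh..|].
move=> j z jm Dz z0; rewrite !iter_dh//; apply: partial_slice => //.
by move=> w Dw w0; apply: E.
Qed.

Lemma eqvD m f f' h h' : eqv m f f' -> eqv m h h' ->
  eqv m (fun z => f z + h z) (fun z => f' z + h' z).
Proof.
move=> [Sf Sf' E] [Sh Sh' F]; split; [exact: smoothD..|].
by move=> j z jm Dz z0; rewrite !iterD// E// F.
Qed.

Lemma eqvM m f f' h h' : eqv m f f' -> eqv m h h' ->
  eqv m (fun z => f z * h z) (fun z => f' z * h' z).
Proof.
move=> E F; split; [by case: E F => ? ? _ [? ? _]; apply: smoothM..|].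
move=> j; elim: j m f f' h h' E F => [|j IH] m f f' h h' E F z jm Dz z0.
  case: E F => _ _ /(_ 0%N z jm Dz z0) /= Ef [_ _ /(_ 0%N z jm Dz z0) /= Eh].
  by rewrite Ef Eh.
case: m jm E F => // m jm E F.
have [[Sf Sf' _] [Sh Sh' _]] := (E, F).
rewrite !iterSr (iter_eq_on _ (d0M Sf Sh))// (iter_eq_on _ (d0M Sf' Sh'))//.
rewrite !iterD//; try (apply: smoothM => //; exact: smooth_d0).
congr (_ + _).
  by apply: IH (eqv_d0 E) (eqv_le _ F) _ _ Dz z0.
by apply: IH (eqv_le _ E) (eqv_d0 F) _ _ Dz z0.
Qed.

Lemma eqvZ m c f f' : eqv m f f' -> eqv m (fun z => c * f z) (fun z => c * f' z).
Proof. by move=> E; apply: eqvM => //; apply: eqv_refl; apply: smooth_cst. Qed.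

Lemma eqvB m f f' h h' : eqv m f f' -> eqv m h h' ->
  eqv m (fun z => f z - h z) (fun z => f' z - h' z).
Proof.
move=> E F; apply: eqvD => //.
have N (k : 'rV[R]_(1 + n) -> R) : (fun z => - k z) = (fun z => -1 * k z).
  by apply/funext => z; rewrite mulN1r.
by rewrite !N; apply: eqvZ.
Qed.

Lemma eqv_sum m (I : Type) (s : seq I) (F G : I -> E -> R) :
  (forall i, eqv m (F i) (G i)) ->
  eqv m (fun z => \sum_(i <- s) F i z) (fun z => \sum_(i <- s) G i z).
Proof.
move=> FG; elim: s => [|i s IH].
  have N (H : I -> E -> R) : (fun z => \sum_(i <- [::]) H i z) = fun=> 0.
    by apply/funext => z; rewrite big_nil.
  by rewrite !N; apply: eqv_refl; apply: smooth_cst.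
have C (H : I -> E -> R) : (fun z => \sum_(i <- i :: s) H i z) =
    (fun z => H i z + \sum_(i <- s) H i z).
  by apply/funext => z; rewrite big_cons.
by rewrite !C; apply: eqvD.
Qed.

Lemma eqv_x m f h : eqv m f h ->
  eqv m.+1 (fun z => coord_x z * f z) (fun z => coord_x z * h z).
Proof.
move=> E; split; [by case: E => ? ? _; apply: smoothM => //; exact: smooth_coord_x..|].
move=> j; elim: j m f h E => [|j IH] m f h E z jm Dz z0; first by rewrite /= z0 !mul0r.
have Sx := smooth_coord_x; have [Sf Sh EE] := E.
have dx k : S k -> d0 (fun z => coord_x z * k z) =D (fun z => k z + coord_x z * d0 k z).
  by move=> Sk w Dw; rewrite d0M// d0_coord_x mul1r.
rewrite !iterSr (iter_eq_on _ (dx _ Sf))// (iter_eq_on _ (dx _ Sh))//.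
rewrite !iterD//; try (apply: smoothM => //; exact: smooth_d0).
congr (_ + _); first exact: EE.
by case: m jm E {EE} => // m jm E; apply: IH (eqv_d0 E) _ _ Dz z0.
Qed.

End Collar.
Arguments cyl {R n} U r _.
Arguments eqv {R n} U r m f h.

(** * Taylor coefficients in the transversal coordinate *)

Section Jets.
Context {R : realType} {n : nat}.
Variables (U : set 'rV[R]_n) (r : R).
Hypotheses (Uop : open U) (r_gt0 : 0 < r).
Local Notation E := 'rV[R]_(1 + n).
Implicit Types (f h : E -> R) (z : E) (y : 'rV[R]_n) (a b : 'I_n).
Local Notation D := (cyl U r).
Local Notation S := (smooth_on D).
Local Notation "f =D h" := (eq_on D f h) (at level 70).
Local Notation eqv := (eqv U r).
Local Notation x_ := (@coord_x R n).
Let Dop : open D := cyl_open Uop.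
Hint Resolve Dop : core.

Lemma factr_neq0 m : m`!%:R != 0 :> R.
Proof. by rewrite pnatr_eq0 -lt0n fact_gt0. Qed.

Lemma to0_delta0 : to0 (delta_mx 0 (lshift n ord0)) = 0 :> E.
Proof.
rewrite to0E rsub_delta0 /collar_pt.
by apply/matrixP => i j; rewrite !mxE; case: (fintype.split j) => k; rewrite !mxE ?mul0rn.
Qed.

Lemma d0_to0 f : d0 (f \o to0) = fun=> 0.
Proof.
apply/funext => z.
by rewrite /d0 partialE derive_linear_comp to0_delta0 derive0.
Qed.

Lemma dh_to0 a f : dh a (f \o to0) = dh a f \o to0.
Proof.
apply/funext => z; rewrite /dh /= !partialE derive_linear_comp.
by rewrite (to0_id (coord_deltah a)).
Qed.

Lemma smooth_to0 f : S f -> S (f \o to0).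
Proof.
move=> Sf; pose s (c : 'I_(1 + n)) := if fintype.split c is inr _ then Some c else None.
apply: (@smooth_comp_linear _ _ _ D D _ s) => // [z|c].
  exact: cyl_to0.
rewrite /s; case: splitP => k ck.
  have -> : c = lshift n ord0 by apply/val_inj; rewrite /= ck ord1.
  exact: to0_delta0.
have -> : c = rshift 1 k by apply/val_inj.
by rewrite (to0_id (coord_deltah k)).
Qed.

Lemma dh_rsub a (u : 'rV[R]_n -> R) z :
  dh a (u \o rsubmx) z = partial a u (rsubmx z).
Proof. by rewrite /dh !partialE (derive_linear_comp rsubmx) /= rsub_deltah. Qed.

Lemma smooth_rsub (u : 'rV[R]_n -> R) : smooth_on U u -> S (u \o rsubmx).
Proof.
move=> Su; pose s (c : 'I_(1 + n)) := if fintype.split c is inr k then Some k else None.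
apply: (@smooth_comp_linear _ _ _ D U rsubmx s) => // [z []//|c].
rewrite /s; case: splitP => k ck.
  have -> : c = lshift n ord0 by apply/val_inj; rewrite /= ck ord1.
  exact: rsub_delta0.
have -> : c = rshift 1 k by apply/val_inj.
exact: rsub_deltah.
Qed.

Lemma d0_xn m : d0 (fun z => x_ z ^+ m) =D (fun z => m%:R * x_ z ^+ m.-1).
Proof.
have Sx : S x_ by exact: smooth_coord_x.
elim: m => [|m IH] z Dz.
  by rewrite mul0r /d0 (_ : (fun _ => _) = fun=> 1) ?partial_cst//; apply/funext.
have -> : (fun z => x_ z ^+ m.+1) = (fun z => x_ z * x_ z ^+ m).
  by apply/funext => w; rewrite exprS.
rewrite (d0M Sx (smoothX Dop m Sx))//.
rewrite IH// d0_coord_x mul1r /=; case: m {IH} => [|m] /=.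
  by rewrite mul0r mulr0 addr0 mul1r.
by rewrite exprS -[in RHS]natr1; ring.
Qed.

Lemma dh_xn a m z : D z -> dh a (fun w => x_ w ^+ m) z = 0.
Proof.
move=> Dz; have Sx : S x_ by exact: smooth_coord_x.
have dx : differentiable x_ z by exact: differentiable_coord_x.
elim: m => [|m IH]; first by rewrite /dh (_ : (fun _ => _) = fun=> 1) ?partial_cst.
have -> : (fun w => x_ w ^+ m.+1) = (fun w => x_ w * x_ w ^+ m).
  by apply/funext => w; rewrite exprS.
have dm : differentiable (fun w => x_ w ^+ m) z.
  exact: (smooth_diff (smoothX Dop m Sx) Dz).
rewrite /dh (partialM _ dx dm) -/(dh a _ z) -/(dh a _ z) IH mulr0 addr0.
by have /(congr1 (@^~ z)) -> := @dh_coord_x R n a; rewrite mul0r.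
Qed.

Lemma smooth_xn m : S (fun z => x_ z ^+ m).
Proof. by apply: smoothX => //; exact: smooth_coord_x. Qed.

Lemma d0_xn_to0 m f : S f ->
  d0 (fun z => x_ z ^+ m * f (to0 z)) =D (fun z => m%:R * x_ z ^+ m.-1 * f (to0 z)).
Proof.
move=> Sf z Dz; rewrite (d0M (smooth_xn m) (smooth_to0 Sf))// d0_xn//.
by rewrite (d0_to0 f) mulr0 addr0.
Qed.

Lemma iter_xn_to0 m j f : S f -> (j <= m)%N ->
  iter j d0 (fun z => x_ z ^+ m * f (to0 z)) =D
  (fun z => (m ^_ j)%:R * x_ z ^+ (m - j) * f (to0 z)).
Proof.
move=> Sf; elim: j => [|j IH] jm z Dz; first by rewrite ffactn0 mul1r subn0.
rewrite iterS.
apply: etrans (partial_eq_on Dop _ (IH (ltnW jm)) Dz) _.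
pose h := fun w => (m ^_ j)%:R * f w.
have -> : (fun w => (m ^_ j)%:R * x_ w ^+ (m - j) * f (to0 w)) =
          (fun w => x_ w ^+ (m - j) * h (to0 w)).
  by apply/funext => w; rewrite /h; ring.
rewrite [LHS]d0_xn_to0 //; last exact: smoothZ.
by rewrite ffactnSr natrM subnS /h; ring.
Qed.

(** A Taylor coefficient, extended to the collar so as to be constant along the
    transversal lines. *)
Definition jet m f z : R := (m`!%:R)^-1 * iter m d0 f (to0 z).

Lemma smooth_jet m f : S f -> S (jet m f).
Proof.
move=> Sf; apply: smoothZ => //; apply: (@smooth_to0 (iter m d0 f)).
exact: smooth_iter.
Qed.

Lemma jet_to0 m f z : jet m f (to0 z) = jet m f z.
Proof. by rewrite /jet (to0_id (coord_to0 z)). Qed.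

Lemma jet_eqv m p f h z : eqv m f h -> (p < m)%N -> D z -> jet p f z = jet p h z.
Proof.
move=> [_ _ E] pm Dz; congr (_ * _); apply: E => //.
  exact: cyl_to0.
exact: coord_to0.
Qed.

Lemma jet_xn m f z : S f -> D z -> jet m (fun w => x_ w ^+ m * f (to0 w)) z = f (to0 z).
Proof.
move=> Sf Dz; rewrite /jet iter_xn_to0//; last exact: cyl_to0.
rewrite ffactnn subnn expr0 mulr1 mulrA mulVf ?factr_neq0// mul1r.
by rewrite (to0_id (coord_to0 z)).
Qed.

Lemma jetD m f h z : S f -> S h -> D z ->
  jet m (fun w => f w + h w) z = jet m f z + jet m h z.
Proof.
by move=> Sf Sh Dz; rewrite /jet (iterD Uop m Sf Sh (cyl_to0 r_gt0 Dz)) mulrDr.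
Qed.

Lemma iterM_to0 m f h : S f -> S h ->
  iter m d0 (fun z => f z * h (to0 z)) =D (fun z => iter m d0 f z * h (to0 z)).
Proof.
move=> Sf Sh; elim: m => //= m IH z Dz.
apply: etrans (partial_eq_on Dop _ IH Dz) _.
apply: etrans (d0M (smooth_iter _ Sf) (smooth_to0 Sh) Dz) _.
by rewrite (d0_to0 h) mulr0 addr0.
Qed.

Lemma jetM_to0 m f h z : S f -> S h -> D z ->
  jet m (fun w => f w * h (to0 w)) z = jet m f z * h (to0 z).
Proof.
move=> Sf Sh Dz; rewrite /jet (iterM_to0 m Sf Sh (cyl_to0 r_gt0 Dz)).
by rewrite (to0_id (coord_to0 z)) mulrA.
Qed.

(** Taylor's formula at the first order that is not known to vanish. *)
Lemma eqv_jet m f : eqv m f (fun=> 0) ->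
  eqv m.+1 f (fun z => x_ z ^+ m * jet m f z).
Proof.
move=> [Sf S0 E]; have Sj := smooth_jet m Sf.
have jE : (fun z => x_ z ^+ m * jet m f z) = (fun z => x_ z ^+ m * jet m f (to0 z)).
  by apply/funext => z; rewrite jet_to0.
split=> //; first by apply: smoothM => //; exact: smooth_xn.
move=> j z; rewrite ltnS leq_eqVlt => /predU1P[->|jm] Dz z0.
  rewrite jE iter_xn_to0// ffactnn subnn expr0 mulr1 jet_to0 /jet.
  by rewrite mulrA mulfV ?factr_neq0// mul1r to0_id.
rewrite E// jE iter_xn_to0 ?(ltnW jm)// z0 expr0n subn_eq0 leqNgt jm.
by rewrite mulr0 mul0r iter_cst; case: ifP.
Qed.

Lemma eqv_xn m p f h : eqv p f h ->
  eqv (m + p) (fun z => x_ z ^+ m * f z) (fun z => x_ z ^+ m * h z).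
Proof.
move=> E; elim: m => [|m IH].
  have X k : (fun z => x_ z ^+ 0 * k z) = k by apply/funext => z; rewrite mul1r.
  by rewrite !X.
have X k : (fun z => x_ z ^+ m.+1 * k z) = (fun z => x_ z * (x_ z ^+ m * k z)).
  by apply/funext => z; rewrite exprS mulrA.
by rewrite !X; apply: eqv_x.
Qed.

Lemma eqv_xn0 m f h : S f -> S h -> eqv m (fun z => x_ z ^+ m * f z) (fun=> 0).
Proof.
move=> Sf Sh.
have := @eqv_xn m 0 f (fun=> 0); rewrite addn0 => H.
have -> : (fun _ : E => 0 : R) = (fun z => x_ z ^+ m * 0).
  by apply/funext => z; rewrite mulr0.
by apply: H; split=> //; exact: smooth_cst.
Qed.

(** Repeated use of the mean value theorem along a transversal line. *)
Lemma eqv0_small m f y : eqv m.+1 f (fun=> 0) -> U y -> forall e, 0 < e ->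
  exists2 d, 0 < d & forall x, 0 < x < d -> `|f (collar_pt x y)| <= e * x ^+ m.
Proof.
elim: m f => [|m IH] f [Sf S0 Ef] Uy e e0.
  have Dy := cyl_pt0 r_gt0 Uy.
  have := differentiable_continuous (smooth_diff Sf Dy).
  move=> /cvgrPdist_lt /(_ e e0) /nbhs_normP [d dp Hd].
  exists d => // x /andP[x0 xd]; rewrite expr0 mulr1.
  have f0 : f (collar_pt 0 y) = 0 := Ef 0%N _ isT Dy (coord_pt _ _).
  have := Hd (collar_pt x y); rewrite /= f0 sub0r normrN => H.
  apply/ltW/H; rewrite (collar_pt_delta0 x) opprD addrCA subrr addr0 normrN normrZ.
  apply: le_lt_trans xd; rewrite -[leRHS]mulr1 gtr0_norm//.
  apply: ler_wpM2l; first exact: ltW.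
  rewrite [`|_|]mx_normrE; apply/bigmax_leP; split=> // ij _.
  by rewrite mxE; case: (_ && _); rewrite ?normr1 ?normr0.
have E1 : eqv m.+1 (d0 f) (fun=> 0).
  rewrite -(partial_cst (lshift n ord0) (0 : R)).
  by apply: eqv_d0.
have [d dp Hd] := IH _ E1 Uy e e0.
exists (Order.min d r); first by rewrite lt_min dp.
move=> x /andP[x0]; rewrite lt_min => /andP[xd xr].
have [t /andP[t0 tx]|c /andP[c0 cx]] :=
  @MVT_line _ _ f (delta_mx 0 (lshift n ord0)) (collar_pt 0 y) x x0.
  rewrite -collar_pt_delta0; apply: smooth_diff Sf _; apply: cyl_pt => //.
  by rewrite ger0_norm//; apply: le_lt_trans xr.
have f0 : f (collar_pt 0 y) = 0 := Ef 0%N _ isT (cyl_pt0 r_gt0 Uy) (coord_pt _ _).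
rewrite -partialE -!collar_pt_delta0 f0 subr0 => ->; rewrite normrM (gtr0_norm x0) exprSr mulrA.
apply: ler_wpM2r; first exact: ltW.
apply: (le_trans (Hd c _)); first by rewrite c0 (lt_trans cx).
apply: ler_wpM2l; first exact: ltW.
by apply: lerXn2r; rewrite ?nnegrE; apply: ltW.
Qed.

Lemma eqv0_quotient m f y : eqv m f (fun=> 0) -> U y -> forall e, 0 < e ->
  exists2 d, 0 < d & forall x, 0 < x < d ->
    `|jet m f (collar_pt 0 y) - (x ^+ m)^-1 * f (collar_pt x y)| <= e.
Proof.
move=> Ef Uy e e0.
have Ej := eqv_jet Ef; have [Sf Sj _] := Ej.
have E1 : eqv m.+1 (fun z => x_ z ^+ m * jet m f z - f z) (fun=> 0).
  have -> : (fun _ : E => 0 : R) = (fun z => f z - f z).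
    by apply/funext => z; rewrite subrr.
  apply: eqvB => //; exact: eqv_sym.
have [d dp Hd] := eqv0_small E1 Uy e0.
exists d => // x /[dup] /andP[x0 _] /Hd.
rewrite coord_pt -(jet_to0 _ _ (collar_pt x y)) to0E rsub_pt.
set c := jet _ _ _; set v := f _.
have xm : 0 < x ^+ m by rewrite exprn_gt0.
rewrite -ler_pdivrMr//; congr (_ <= _).
rewrite -{2}(gtr0_norm xm) -normf_div; congr (`|_|).
by field; rewrite gt_eqF.
Qed.

(** A bound by the N-th power kills the coefficients one after the other, each being the
    limit of the quotients by a lower power. *)
Lemma eqv0_bigO N f : S f ->
  (forall y, U y -> exists C d, 0 < d /\
     forall x, 0 < x < d -> `|f (collar_pt x y)| <= C * x ^+ N) ->
  eqv N f (fun=> 0).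
Proof.
move=> Sf HO.
suff: forall m, (m <= N)%N -> eqv m f (fun=> 0) by apply.
elim=> [|m IH] mN; first by split=> //; exact: smooth_cst.
have Em := IH (ltnW mN); have Ej := eqv_jet Em.
suff j0 y : U y -> jet m f (collar_pt 0 y) = 0.
  have [_ Sj _] := Ej.
  apply: eqv_trans Ej (eqv_eq_on _ _ _ _) => // z [_ Uz].
  by rewrite -jet_to0 to0E j0// mulr0.
move=> Uy; apply/eqP; rewrite -normr_le0; apply/ler_addgt0Pr => e e0; rewrite add0r.
have e2 : 0 < e / 2 by rewrite divr_gt0.
have [d dp Hd] := eqv0_quotient Em Uy e2.
have [C [d' [d'0 Hd']]] := HO y Uy.
have C0 : 0 < `|C| + 1 by rewrite ltr_wpDl.
(* This abscissa lies in both ranges, is at most 1 and makes C x at most e / 2. *)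
pose x := Order.min (Order.min (d / 2) (d' / 2)) (Order.min 1 (e / 2 / (`|C| + 1))).
have x0 : 0 < x.
  have := divr_gt0 e2 C0; have : 0 < d / 2 by rewrite divr_gt0.
  have : 0 < d' / 2 by rewrite divr_gt0.
  by rewrite !lt_min ltr01 => -> -> ->.
have xd : x < d.
  by apply: (@le_lt_trans _ _ (d / 2)); [rewrite !ge_min lexx|rewrite gtr_pMr// invf_lt1// ltr1n].
have xd' : x < d'.
  by apply: (@le_lt_trans _ _ (d' / 2));
    [rewrite !ge_min lexx !orbT|rewrite gtr_pMr// invf_lt1// ltr1n].
have x1 : x <= 1 by rewrite !ge_min lexx !orbT.
have xC : x * (`|C| + 1) <= e / 2.
  by rewrite -ler_pdivlMr//; rewrite !ge_min lexx !orbT.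
have {}Hd := Hd x; have {}Hd' := Hd' x.
rewrite x0 xd /= in Hd; rewrite x0 xd' /= in Hd'.
have {}Hd := Hd isT; have {}Hd' := Hd' isT.
move: Hd Hd'; set c := jet _ _ _; set v := f _ => Hd Hd'.
clearbody x.
have xm : 0 < x ^+ m by rewrite exprn_gt0.
have B : `|(x ^+ m)^-1 * v| <= e / 2.
  rewrite normrM gtr0_norm ?invr_gt0// mulrC ler_pdivrMr//.
  apply: (le_trans Hd').
  rewrite -(subnK mN) exprD exprS.
  apply: (@le_trans _ _ (`|C| * (x * x ^+ m))).
    apply: (@le_trans _ _ (`|C| * (x ^+ (N - m.+1) * (x * x ^+ m)))).
      by apply: ler_wpM2r; [rewrite !mulr_ge0 ?exprn_ge0 ?ltW|exact: ler_norm].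
    apply: ler_wpM2l => //; rewrite -[leRHS]mul1r; apply: ler_wpM2r.
      by rewrite mulr_ge0 ?exprn_ge0 ?ltW.
    by apply: exprn_ile1 => //; exact: ltW.
  rewrite mulrA; apply: ler_wpM2r; first exact: ltW.
  by apply: le_trans xC; rewrite mulrC ler_pM2l// lerDl.
have -> : c = (c - (x ^+ m)^-1 * v) + (x ^+ m)^-1 * v by rewrite subrK.
apply: (le_trans (ler_normD _ _)); apply: (le_trans (lerD Hd B)).
by rewrite -splitr.
Qed.

Lemma refl_delta0 : refl (delta_mx 0 (lshift n ord0)) = - delta_mx 0 (lshift n ord0) :> E.
Proof.
rewrite reflE -[RHS]collar_ptK coord_delta0 rsub_delta0; congr collar_pt.
  by rewrite /coord_x !mxE !eqxx.
by apply/matrixP => i j; rewrite !mxE eq_rlshift andbF oppr0.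
Qed.

Lemma iter_refl j f : S f -> (forall z, D z -> f (refl z) = f z) ->
  forall z, D z -> iter j d0 f (refl z) = (-1) ^+ j * iter j d0 f z.
Proof.
move=> Sf fE; elim: j => [|j IH] z Dz; first by rewrite mul1r; exact: fE.
have Sj := smooth_iter j Sf.
have := partial_eq_on Dop (lshift n ord0) IH Dz.
rewrite partialZ; last exact: (smooth_diff Sj).
rewrite [LHS]partialE (derive_linear_comp refl) refl_delta0.
have dj : differentiable (iter j d0 f) (refl z).
  by apply: smooth_diff Sj _; exact: cyl_refl.
rewrite deriveE// linearN -deriveE// -partialE => H.
by rewrite iterS -[LHS]opprK [X in - X]H exprS mulN1r mulNr.
Qed.

(** The odd coefficients of an even function vanish. *)
Lemma eqv_even m f : (forall z, D z -> f (refl z) = f z) -> odd m ->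
  eqv m f (fun=> 0) -> eqv m.+1 f (fun=> 0).
Proof.
move=> fE om Em; have [Sf S0 _] := Em; have [_ _ Ej] := eqv_jet Em.
split=> // j z; rewrite ltnS leq_eqVlt => /predU1P[->|jm] Dz z0; last first.
  by case: Em => _ _; apply.
have := iter_refl m Sf fE Dz.
rewrite reflE z0 oppr0 -{1}z0 collar_ptK -signr_odd om expr1 mulN1r => H.
rewrite iter_cst; transitivity (0 : R); last by case: ifP.
by move: H; move: (iter m d0 f z) => t tN; lra.
Qed.

End Jets.

(** * Connection and curvature of the slices *)

(** Levi-Civita symbols of the metrics on the slices: the transversal coordinate is a
    parameter. *)
HB.lock Definition hchr (R : realType) (n : nat) (G : 'rV[R]_(1 + n) -> 'M[R]_n)
    (z : 'rV[R]_(1 + n)) (c a b : 'I_n) : R :=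
  2^-1 * \sum_d invmx (G z) c d *
    (dh a (fun w => G w d b) z + dh b (fun w => G w d a) z
     - dh d (fun w => G w a b) z).

(** Christoffel symbols of the first kind. *)
HB.lock Definition chr1 (R : realType) (n : nat) (G : 'rV[R]_(1 + n) -> 'M[R]_n)
    (z : 'rV[R]_(1 + n)) (a b c : 'I_n) : R :=
  2^-1 * (dh b (fun w => G w a c) z + dh c (fun w => G w a b) z
          - dh a (fun w => G w b c) z).

HB.lock Definition curv (R : realType) (n : nat)
    (C : 'rV[R]_(1 + n) -> 'I_n -> 'I_n -> 'I_n -> R)
    (z : 'rV[R]_(1 + n)) (d c a b : 'I_n) : R :=
  dh a (fun w => C w d b c) z - dh b (fun w => C w d a c) z
  + \sum_e (C z d a e * C z e b c - C z d b e * C z e a c).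

HB.lock Definition Klow (R : realType) (n : nat) (G : 'rV[R]_(1 + n) -> 'M[R]_n)
    (K : 'rV[R]_(1 + n) -> 'I_n -> R) (z : 'rV[R]_(1 + n)) (a : 'I_n) : R :=
  \sum_b G z a b * K z b.

Lemma KlowE (R : realType) (n : nat) (G : 'rV[R]_(1 + n) -> 'M[R]_n) K z a :
  \sum_b G z a b * K z b = Klow G K z a.
Proof. by rewrite Klow.unlock. Qed.

(** For identities that hold for arbitrary values of the derivatives and sums in them. *)
Ltac generalize_atoms := repeat match goal with
  | |- context [dh ?a ?f ?z] => generalize (dh a f z); intro
  | |- context [bigop ?x ?s ?F] => generalize (bigop x s F); intro
  end.

Section Connection.
Context {R : realType} {n : nat}.
Local Notation E := 'rV[R]_(1 + n).
Implicit Types (z w : E) (a b c d e f : 'I_n).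

Definition hric (C : E -> 'I_n -> 'I_n -> 'I_n -> R) z c b : R :=
  \sum_a curv C z a c a b.

Definition rlow (G : E -> 'M[R]_n) z a b c d : R :=
  \sum_e G z a e * curv (hchr G) z e b c d.

Variables (U : set 'rV[R]_n) (r : R).
Hypotheses (Uop : open U) (r_gt0 : 0 < r).
Local Notation D := (cyl U r).
Local Notation S := (smooth_on D).
Let Dop : open D := cyl_open Uop.

Variable G : E -> 'M[R]_n.
Hypothesis SG : forall a b, S (fun z => G z a b).
Hypothesis symG : forall z, D z -> (G z)^T = G z.
Hypothesis uG : forall z, D z -> G z \in unitmx.
Local Notation Gam := (hchr G).

Lemma G_sym z a b : D z -> G z a b = G z b a.
Proof. by move=> Dz; rewrite -{1}(symG Dz) mxE. Qed.

Lemma Ginv_sym z a b : D z -> invmx (G z) a b = invmx (G z) b a.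
Proof. by move=> Dz; rewrite -{1}(symG Dz) -trmx_inv mxE. Qed.

Lemma sum_GGinv z a b : D z -> \sum_c G z a c * invmx (G z) c b = (a == b)%:R.
Proof. by move=> Dz; have /matrixP/(_ a b) := mulmxV (uG Dz); rewrite !mxE. Qed.

Lemma sum_GinvG z a b : D z -> \sum_c invmx (G z) a c * G z c b = (a == b)%:R.
Proof. by move=> Dz; have /matrixP/(_ a b) := mulVmx (uG Dz); rewrite !mxE. Qed.

Lemma sum_delta (F : 'I_n -> R) a : \sum_b (a == b)%:R * F b = F a.
Proof.
rewrite (bigD1 a)//= eqxx mul1r big1 ?addr0// => b /negPf.
by rewrite eq_sym => ->; rewrite mul0r.
Qed.

Lemma smooth_Ginv a b : S (fun z => invmx (G z) a b).
Proof. exact: smooth_invmx. Qed.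

Lemma smooth_chr c a b : S (fun z => Gam z c a b).
Proof.
rewrite hchr.unlock.
apply: smoothZ => //; apply: smooth_sum => // d _; apply: smoothM => //.
  exact: smooth_Ginv.
by apply: smoothB => //; [apply: smoothD => //|]; apply: smooth_dh.
Qed.

Lemma dG_sym z a b c : D z -> dh c (fun w => G w a b) z = dh c (fun w => G w b a) z.
Proof. by move=> Dz; apply: partial_eq_on Dz => // w Dw; exact: G_sym. Qed.

Lemma chr_sym z c a b : D z -> Gam z c a b = Gam z c b a.
Proof.
move=> Dz; rewrite hchr.unlock; congr (_ * _); apply: eq_bigr => d _; congr (_ * _).
by rewrite [dh b _ z + _]addrC (dG_sym a b d Dz).
Qed.

Local Notation chr1 := (chr1 G).

Lemma sum_G_chr z a b c : D z -> \sum_e G z a e * Gam z e b c = chr1 z a b c.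
Proof.
move=> Dz; rewrite hchr.unlock chr1.unlock.
under eq_bigr => e _.
  rewrite mulrCA mulr_sumr; under eq_bigr => d _ do rewrite mulrA; over.
rewrite -mulr_sumr exchange_big /=; congr (_ * _).
under eq_bigr => d _ do rewrite -mulr_suml sum_GGinv//.
by rewrite sum_delta.
Qed.

Lemma dG_chr1 z a b c : D z ->
  dh c (fun w => G w a b) z = chr1 z a c b + chr1 z b c a.
Proof.
by move=> Dz; rewrite chr1.unlock (dG_sym b a c Dz) (dG_sym c b a Dz) (dG_sym c a b Dz); field.
Qed.

Let dif (h : E -> R) z : S h -> D z -> differentiable h z := @smooth_diff _ _ D h z.

Lemma sum_G_dchr z a b c d : D z ->
  \sum_e G z a e * dh c (fun w => Gam w e d b) z =
  dh c (fun w => chr1 w a d b) z - \sum_e dh c (fun w => G w a e) z * Gam z e d b.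
Proof.
move=> Dz.
have Ed : eq_on D (fun w => \sum_e G w a e * Gam w e d b) (fun w => chr1 w a d b).
  by move=> w Dw; exact: sum_G_chr.
rewrite -[dh c (fun w => chr1 w a d b) z](partial_eq_on Dop _ Ed Dz).
rewrite partial_sum => [|e _]; last first.
  by apply: differentiableM; [exact: dif|exact: dif (smooth_chr _ _ _) Dz].
rewrite -sumrB; apply: eq_bigr => e _; rewrite partialM.
- by rewrite -/(dh c _ _) -/(dh c _ _) addrC addKr.
- exact: dif.
- exact: dif (smooth_chr _ _ _) Dz.
Qed.

Definition chr2 z a b c d : R := \sum_e chr1 z e a b * Gam z e c d.

Lemma chr2_sym z a b c d : D z -> chr2 z a b c d = chr2 z c d a b.
Proof.
move=> Dz; rewrite /chr2.
under eq_bigr => e _ do rewrite -(sum_G_chr _ _ _ Dz) mulr_suml.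
rewrite exchange_big /=; apply: eq_bigr => e _.
rewrite -(sum_G_chr _ _ _ Dz) mulr_suml; apply: eq_bigr => f _.
by rewrite (G_sym _ _ Dz); ring.
Qed.

Lemma chr1_sym z a b c : D z -> chr1 z a b c = chr1 z a c b.
Proof.
by move=> Dz; rewrite chr1.unlock (dG_sym b c a Dz) [dh b _ z + _]addrC.
Qed.

Lemma chr2_syml z a b c d : D z -> chr2 z a b c d = chr2 z b a c d.
Proof. by move=> Dz; apply: eq_bigr => e _; rewrite (chr1_sym e a b Dz). Qed.

Lemma chr2_symr z a b c d : D z -> chr2 z a b c d = chr2 z a b d c.
Proof. by move=> Dz; apply: eq_bigr => e _; rewrite (chr_sym e c d Dz). Qed.

Local Notation ddG c d a b z := (dh c (dh d (fun w => G w a b)) z).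

Lemma dchr1 z a b c d : D z ->
  dh d (fun w => chr1 w a b c) z =
  2^-1 * (ddG d b a c z + ddG d c a b z - ddG d a b c z).
Proof.
move=> Dz; have df p q s : differentiable (dh p (fun w => G w q s)) z.
  by apply: dif Dz; exact: smooth_dh.
rewrite chr1.unlock [LHS]partialZ; last by apply: differentiableB => //; exact: differentiableD.
by rewrite partialB//; [rewrite partialD|exact: differentiableD].
Qed.

Lemma ddG_sym z a b c d : D z -> ddG c d a b z = ddG c d b a z.
Proof. by move=> Dz; apply: partial_eq_on Dz => // w Dw; exact: dG_sym. Qed.

Lemma ddGC z a b c d : D z -> ddG c d a b z = ddG d c a b z.
Proof. by move=> Dz; apply: (partialC Dop _ _ (SG a b) Dz). Qed.

(** Writing the connection terms with symbols of the first kind makes all the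
    symmetries of the curvature tensor visible. *)
Lemma rlowE z a b c d : D z -> rlow G z a b c d =
  2^-1 * (ddG c b a d z - ddG c a b d z - ddG d b a c z + ddG d a b c z)
  - chr2 z c a d b + chr2 z d a c b.
Proof.
move=> Dz.
have Q p q : \sum_e \sum_f G z a e * (Gam z e p f * Gam z f q b - Gam z e q f * Gam z f p b)
   = \sum_f chr1 z a p f * Gam z f q b - \sum_f chr1 z a q f * Gam z f p b.
  rewrite exchange_big -sumrB; apply: eq_bigr => f _.
  under eq_bigr => e _ do rewrite mulrBr !mulrA.
  by rewrite sumrB -!mulr_suml; congr (_ * _ - _ * _); exact: sum_G_chr.
have P p q : \sum_e dh p (fun w => G w a e) z * Gam z e q b =
   \sum_e chr1 z a p e * Gam z e q b + chr2 z p a q b.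
  by rewrite -big_split; apply: eq_bigr => e _; rewrite dG_chr1// mulrDl.
transitivity ((dh c (fun w => chr1 w a d b) z - \sum_e dh c (fun w => G w a e) z * Gam z e d b)
   - (dh d (fun w => chr1 w a c b) z - \sum_e dh d (fun w => G w a e) z * Gam z e c b)
   + (\sum_f chr1 z a c f * Gam z f d b - \sum_f chr1 z a d f * Gam z f c b)).
  rewrite /rlow curv.unlock; under eq_bigr => e _ do rewrite mulrDr mulrBr mulr_sumr.
  rewrite big_split sumrB.
  congr (_ - _ + _); [exact: sum_G_dchr|exact: sum_G_dchr|exact: Q].
rewrite !P !dchr1// (ddGC a b d c Dz) (ddG_sym b d c a Dz) (ddG_sym b c d a Dz).
by generalize_atoms; ring.
Qed.

Lemma rlow_anti z a b c d : D z -> rlow G z b a c d = - rlow G z a b c d.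
Proof.
move=> Dz; rewrite !rlowE// (chr2_sym c b d a Dz) (chr2_sym d b c a Dz).
by rewrite (chr2_syml d a c b Dz) (chr2_syml c a d b Dz) (chr2_symr a d c b Dz)
   (chr2_symr a c d b Dz) (chr2_syml a d b c Dz) (chr2_syml a c b d Dz) /chr2; generalize_atoms; ring.
Qed.

Lemma rlow_pair z a b c d : D z -> rlow G z c d a b = rlow G z a b c d.
Proof.
move=> Dz; rewrite !rlowE//.
have F p q s t : ddG p q s t z = ddG q p t s z.
  by rewrite (ddGC s t p q Dz) (ddG_sym s t q p Dz).
rewrite (F a d c b) (F a c d b) (F b d c a) (F b c d a).
rewrite (chr2_syml a c b d Dz) (chr2_symr c a b d Dz).
by rewrite (chr2_sym b c a d Dz) (chr2_syml a d b c Dz) (chr2_symr d a b c Dz) /chr2; generalize_atoms; ring.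
Qed.

Lemma smooth_hric c b : S (fun z => hric Gam z c b).
Proof.
apply: (smooth_sum Dop) => a _; rewrite curv.unlock; apply: (smoothD Dop).
  by apply: (smoothB Dop); apply: (smooth_dh _ (smooth_chr _ _ _)).
apply: (smooth_sum Dop) => e _.
by apply: (smoothB Dop); apply: (smoothM Dop); exact: smooth_chr.
Qed.

(** * Parallel vector fields *)

Variable K : E -> 'I_n -> R.
Hypothesis SK : forall a, S (fun z => K z a).
Hypothesis dK : forall z a b, D z ->
  dh a (fun w => K w b) z = - \sum_c Gam z b a c * K z c.

Local Notation Klow := (Klow G K).

Lemma smooth_Klow a : S (fun z => Klow z a).
Proof. by rewrite Klow.unlock; apply: smooth_sum => // b _; apply: smoothM. Qed.

(** The dual covector of a parallel field is parallel. *)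
Lemma dKlow z a b : D z ->
  dh a (fun w => Klow w b) z = \sum_e Gam z e a b * Klow z e.
Proof.
move=> Dz; rewrite Klow.unlock [LHS]partial_sum => [|c _]; last first.
  by apply: differentiableM; apply: dif.
have T c : partial (rshift 1 a) (fun w => G w b c * K w c) z =
    (chr1 z b a c + chr1 z c a b) * K z c - \sum_e G z b c * Gam z c a e * K z e.
  rewrite partialM; [|exact: dif..].
  rewrite -/(dh a _) -/(dh a _) dG_chr1// dK// mulrN mulr_sumr.
  by congr (_ - _); apply: eq_bigr => e _; rewrite mulrA.
rewrite (eq_bigr _ (fun c _ => T c)) sumrB exchange_big/=.
under [X in _ - X]eq_bigr => e _ do rewrite -mulr_suml sum_G_chr//.
rewrite -sumrB.
under [RHS]eq_bigr => e _ do rewrite mulr_sumr.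
rewrite exchange_big/=; apply: eq_bigr => c _.
under [RHS]eq_bigr => e _ do rewrite mulrA.
rewrite -mulr_suml mulrDl [X in X - _]addrC addrK; congr (_ * _).
by rewrite -sum_G_chr//; apply: eq_bigr => e _; rewrite (G_sym _ _ Dz) mulrC.
Qed.

(** The integrability condition of the parallel transport equation, from the symmetry of
    the second derivatives of K. *)
Lemma curv_K z e c d : D z -> \sum_b curv Gam z e b c d * K z b = 0.
Proof.
move=> Dz.
have ddK p q : dh p (dh q (fun w => K w e)) z =
   - \sum_b (dh p (fun w => Gam w e q b) z * K z b)
   + \sum_b (\sum_f Gam z e q f * Gam z f p b) * K z b.
  have Ed : eq_on D (dh q (fun w => K w e)) (fun w => (-1) * \sum_c Gam w e q c * K w c).
    by move=> w Dw; rewrite dK// mulN1r.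
  rewrite [LHS](partial_eq_on Dop _ Ed Dz).
  have Df i : differentiable (fun w => Gam w e q i * K w i) z.
    by apply: differentiableM; [exact: dif (smooth_chr _ _ _) Dz|exact: dif].
  rewrite partialZ; last exact: differentiable_sumf.
  rewrite partial_sum// mulN1r.
  rewrite (eq_bigr (fun b => dh p (fun w => Gam w e q b) z * K z b -
      \sum_c Gam z e q b * Gam z b p c * K z c)); last first.
    move=> b _; rewrite partialM; [|exact: dif (smooth_chr _ _ _) Dz|exact: dif].
    rewrite -/(dh p _) -/(dh p _) dK// mulrN mulr_sumr.
    by congr (_ - _); apply: eq_bigr => i _; rewrite mulrA.
  rewrite sumrB opprB addrC exchange_big/=; congr (_ + _).
  by apply: eq_bigr => b _; rewrite mulr_suml.
have := partialC Dop (rshift 1 c) (rshift 1 d) (SK e) Dz.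
rewrite -/(dh c _) -/(dh d _) -/(dh c _) -/(dh d _) !ddK => H.
rewrite curv.unlock; under eq_bigr => b _ do rewrite sumrB !mulrDl !mulNr.
rewrite !big_split/= !sumrN; move: H.
set A := \sum_b _; set B := \sum_b _; set A' := \sum_b _; set B' := \sum_b _.
by move=> H; lra.
Qed.

Lemma rlow_K2 z a c d : D z -> \sum_b rlow G z a b c d * K z b = 0.
Proof.
move=> Dz; rewrite /rlow; under eq_bigr => b _ do rewrite mulr_suml.
rewrite exchange_big/= big1// => e _.
under eq_bigr => b _ do rewrite -mulrA.
by rewrite -mulr_sumr curv_K// mulr0.
Qed.

End Connection.

(** * Linear algebra of null vectors *)

Section WaveAlgebra.
Context {R : realType} {n : nat}.
Implicit Types (a b c d e f i j : 'I_n).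

(** The Euclidean dual, which depends smoothly on L wherever L does not vanish. *)
Definition dual_vector (L : 'I_n -> R) a : R := L a / \sum_c L c ^+ 2.

Lemma sum_sqr_neq0 (L : 'I_n -> R) a : L a != 0 -> \sum_c L c ^+ 2 != 0.
Proof.
move=> La; rewrite gt_eqF// (bigD1 a)//= ltr_pwDl ?exprn_even_gt0//.
by apply: sumr_ge0 => i _; exact: sqr_ge0.
Qed.

Lemma sum_dual (L : 'I_n -> R) a : L a != 0 -> \sum_c L c * dual_vector L c = 1.
Proof.
move=> /sum_sqr_neq0 L0; rewrite /dual_vector; under eq_bigr => c _ do rewrite mulrA -expr2.
by rewrite -mulr_suml divff.
Qed.

(** N spans a complement of the kernel of L. *)
Lemma covector_on_kernel (L N v : 'I_n -> R) a : \sum_c L c * N c = 1 ->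
  (forall X, \sum_c L c * X c = 0 -> \sum_c v c * X c = 0) ->
  v a = L a * \sum_c v c * N c.
Proof.
move=> LN H; pose X c : R := (a == c)%:R - L a * N c.
have S (u : 'I_n -> R) : \sum_c u c * X c = u a - L a * \sum_c u c * N c.
  rewrite mulr_sumr -(sum_delta u a) -sumrB; apply: eq_bigr => c _.
  by rewrite /X; ring.
by apply/eqP; rewrite -subr_eq0 -S H// S LN mulr1 subrr.
Qed.

(** Divisibility of w by the dual covector L of K, with the row of w at the time index
    as the other factor. The Euclidean sum of the squares of the entries of the
    difference of both sides vanishes: it expands into terms that cancel because K and
    w are null and K annihilates w. *)
Lemma null_form_minkowski (eta K : 'I_n -> R) (w : 'I_n -> 'I_n -> R) o :
  (forall i, eta i = if i == o then -1 else 1) ->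
  (forall i j, w i j = - w j i) ->
  (forall j, \sum_i K i * w i j = 0) ->
  \sum_i eta i * K i ^+ 2 = 0 ->
  \sum_i \sum_j eta i * eta j * w i j ^+ 2 = 0 ->
  forall i j, K o * w i j = eta j * K j * w o i - eta i * K i * w o j.
Proof.
move=> etaE wN Kw K0 W0 i j.
have woo : w o o = 0 by have := wN o o; lra.
have split_o (F : 'I_n -> R) : \sum_k eta k * F k = \sum_k F k - F o *+ 2.
  rewrite (bigD1 o)//= [in RHS](bigD1 o)//= etaE eqxx.
  rewrite (eq_bigr F); last by move=> k /negPf ko; rewrite etaE ko mul1r.
  by ring.
pose L k := eta k * K k; pose e k := w o k.
have eta2 k : eta k * eta k = 1 by rewrite etaE; case: ifP => _; ring.
have LL : \sum_k L k ^+ 2 = 2 * K o ^+ 2.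
  rewrite (eq_bigr (fun k => K k ^+ 2)).
    by move: K0; rewrite split_o; move: (\sum_k _) => s; lra.
  by move=> k _; rewrite /L exprMn expr2 eta2 mul1r.
have Le : \sum_k L k * e k = 0.
  rewrite /L; under eq_bigr => k _ do rewrite -mulrA.
  rewrite split_o /e woo mulr0 mul0rn subr0.
  transitivity (- \sum_k K k * w k o); last by rewrite Kw oppr0.
  by rewrite -sumrN; apply: eq_bigr => k _; rewrite wN mulrN.
have Lw q : \sum_k L k * w k q = - (2 * K o) * e q.
  rewrite /L; under eq_bigr => k _ do rewrite -mulrA.
  by rewrite split_o Kw /e; ring.
have WW : \sum_k \sum_q w k q ^+ 2 = 4 * \sum_q e q ^+ 2.
  move: W0; under eq_bigr => k _.
    under eq_bigr => q _ do rewrite -mulrA.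
    by rewrite -mulr_sumr split_o; over.
  rewrite split_o sumrB woo expr0n mul0rn subr0.
  have -> : \sum_k w k o ^+ 2 *+ 2 = 2 * \sum_k e k ^+ 2.
    by rewrite mulr_sumr; apply: eq_bigr => k _; rewrite wN sqrrN /e; ring.
  by rewrite /e => H; apply/eqP; rewrite -subr_eq0 -[X in _ == X]H; apply/eqP; ring.
pose t k q := K o * w k q + L k * e q - L q * e k.
have sum2 (f g : 'I_n -> R) : \sum_k \sum_q f k * g q = (\sum_k f k) * (\sum_q g q).
  by rewrite big_distrlr.
have T0 : \sum_k \sum_q t k q ^+ 2 = 0.
  have tE k q : t k q ^+ 2 = K o ^+ 2 * w k q ^+ 2 + L k ^+ 2 * e q ^+ 2
      + e k ^+ 2 * L q ^+ 2 - 2 * ((L k * e k) * (L q * e q))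
      + 2 * K o * (L k * w k q * e q) + 2 * K o * (L q * w q k * e k).
    by rewrite /t [w q k]wN; ring.
  under eq_bigr => k _ do under eq_bigr => q _ do rewrite tE.
  under eq_bigr => k _ do rewrite !big_split/= sumrN -!mulr_sumr.
  rewrite !big_split/= sumrN -!mulr_sumr -!mulr_suml WW LL Le mul0r mulr0.
  have -> : \sum_k \sum_q L k * w k q * e q = - (2 * K o) * \sum_q e q ^+ 2.
    rewrite exchange_big mulr_sumr; apply: eq_bigr => q _.
    by rewrite -mulr_suml Lw; ring.
  have -> : \sum_k \sum_q L q * w q k * e k = - (2 * K o) * \sum_q e q ^+ 2.
    by rewrite mulr_sumr; apply: eq_bigr => q _; rewrite -mulr_suml Lw; ring.
  by move: (\sum_q _) => s; ring.
suff : t i j = 0 by rewrite /t /L /e; lra.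
have s0 k : 0 <= \sum_q t k q ^+ 2 by apply: sumr_ge0 => q _; exact: sqr_ge0.
have ti : \sum_q t i q ^+ 2 = 0 by exact: (psumr_eq0P (fun k _ => s0 k) T0 (i := i)).
apply/eqP; rewrite -sqrf_eq0; apply/eqP.
exact: (psumr_eq0P (fun q _ => sqr_ge0 (t i q)) ti (i := j)).
Qed.

Lemma null_neq0_minkowski (eta K : 'I_n -> R) o :
  (forall i, eta i = if i == o then -1 else 1) ->
  \sum_i eta i * K i ^+ 2 = 0 -> (exists i, K i != 0) -> K o != 0.
Proof.
move=> etaE K0 [i Ki]; apply/eqP => Ko.
have : \sum_k K k ^+ 2 != 0 := sum_sqr_neq0 Ki.
apply/negP/negPn/eqP; rewrite -[RHS]K0; apply: eq_bigr => k _.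
by rewrite etaE; case: eqP => [->|_]; rewrite ?mul1r// Ko expr0n mulr0.
Qed.

(** In an orthonormal frame w is divisible by the dual covector of K, which vanishes on
    the orthogonal of K. *)
Lemma null_form_vanish (G w : 'M[R]_n) (K X Y : 'rV[R]_n) :
  lorentzian_form G -> K != 0 -> K *m G *m K^T = 0 -> w^T = - w -> K *m w = 0 ->
  \tr (invmx G *m w *m invmx G *m w^T) = 0 ->
  K *m G *m X^T = 0 -> K *m G *m Y^T = 0 -> X *m w *m Y^T = 0.
Proof.
case=> symG [B uB BG] K0 KK wN Kw W0 KX KY.
set eta := diag_mx _ in BG.
have [i Ki] : exists i, K 0 i != 0.
  apply/existsP; apply: contra_neqT K0 => /existsPn K0; apply/rowP => i.
  by rewrite mxE; apply/eqP; have := K0 i; rewrite negbK.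
have n0 : (0 < n)%N by apply: leq_ltn_trans (ltn_ord i).
pose o : 'I_n := Ordinal n0.
pose et k : R := if k == o then -1 else 1.
have etE k : et k = if k == 0%N :> nat then -1 else 1 by rewrite /et -(inj_eq val_inj).
have eta2 : eta *m eta = 1%:M.
  apply/matrixP => p q; rewrite mul_diag_mx !mxE.
  case: (eqVneq p q) => [->|_]; rewrite ?mulr0// !mulr1n.
  by case: ifP => _; rewrite ?mulrNN mulr1.
pose P := invmx B.
have GE : G = P *m eta *m P^T.
  by rewrite /P -BG trmx_inv !mulmxA mulVmx// mul1mx mulmxK// unitmx_tr.
have PB : P *m B = 1%:M by rewrite mulVmx.
have BP : B *m P = 1%:M by rewrite mulmxV.
have PBt : P^T *m B^T = 1%:M by rewrite -trmx_mul BP trmx1.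
have BPt : B^T *m P^T = 1%:M by rewrite -trmx_mul PB trmx1.
have GV : invmx G = B^T *m eta *m B.
  have GI : B^T *m eta *m B *m G = 1%:M.
    rewrite GE !mulmxA -(mulmxA _ B P) BP mulmx1 -(mulmxA _ eta eta) eta2 mulmx1.
    by rewrite BPt.
  have uG : G \in unitmx by have [] := mulmx1_unit GI.
  by rewrite -[LHS]mul1mx -GI mulmxK.
pose wp := B *m w *m B^T; pose Kp := K *m P; pose Xp := X *m P; pose Yp := Y *m P.
have form (V W : 'rV[R]_n) : V *m G *m W^T = (V *m P) *m eta *m (W *m P)^T.
  by rewrite GE trmx_mul !mulmxA.
have formE (V W : 'rV[R]_n) : (V *m eta *m W^T) 0 0 = \sum_k et k * V 0 k * W 0 k.
  rewrite mxE; apply: eq_bigr => k _.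
  by rewrite etE mul_mx_diag !mxE [_ * V 0 k]mulrC.
have wpE V W : V *m w *m W^T = (V *m P) *m wp *m (W *m P)^T :> 'M[R]_1.
  rewrite trmx_mul /wp !mulmxA -(mulmxA _ P B) PB mulmx1.
  by rewrite -(mulmxA _ B^T P^T) BPt mulmx1.
have wpN p q : wp p q = - wp q p.
  have : (wp)^T = - wp by rewrite /wp !trmx_mul trmxK wN mulNmx mulmxN mulmxA.
  by move=> /matrixP/(_ q p); rewrite !mxE.
have K'wp q : \sum_p Kp 0 p * wp p q = 0.
  have : Kp *m wp = 0.
    by rewrite /Kp /wp !mulmxA -(mulmxA _ P B) PB mulmx1 Kw mul0mx.
  by move=> /matrixP/(_ 0 q); rewrite !mxE.
have KpKp : \sum_p et p * Kp 0 p ^+ 2 = 0.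
  have := congr1 (fun M : 'M[R]_1 => M 0 0) KK; rewrite form formE [RHS]mxE => E0.
  rewrite -[RHS]E0.
  by apply: eq_bigr => p _; rewrite expr2 mulrA.
have Wp0 : \sum_p \sum_q et p * et q * wp p q ^+ 2 = 0.
  rewrite -[RHS]W0 GV.
  have -> : \tr (B^T *m eta *m B *m w *m (B^T *m eta *m B) *m w^T) =
            \tr ((eta *m wp) *m (eta *m (wp)^T)).
    rewrite -!mulmxA mxtrace_mulC /wp !trmx_mul trmxK; congr (\tr _).
    by rewrite !mulmxA.
  rewrite /mxtrace; apply: eq_bigr => p _; rewrite [RHS]mxE; apply: eq_bigr => q _.
  have dE (M : 'M[R]_n) s t : (eta *m M) s t = et s * M s t.
    by rewrite mul_diag_mx mxE mxE etE.
  by rewrite !dE [(wp)^T _ _]mxE; ring.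
have etP p : et p = if p == o then -1 else 1 by [].
have Kpo : Kp 0 o != 0.
  apply: (null_neq0_minkowski etP KpKp).
  have : Kp != 0.
    by apply: contra_neq K0 => Kz; rewrite -[K]mulmx1 -PB mulmxA -/Kp Kz mul0mx.
  move=> Kz; apply/existsP; apply: contra_neqT Kz => /existsPn H; apply/rowP => p.
  by rewrite [RHS]mxE; apply/eqP; have := H p; rewrite negbK.
have wE := null_form_minkowski etP wpN K'wp KpKp Wp0.
have orth (V : 'rV[R]_n) : K *m G *m V^T = 0 -> \sum_k et k * Kp 0 k * (V *m P) 0 k = 0.
  move=> KV; have := congr1 (fun M : 'M[R]_1 => M 0 0) KV.
  by rewrite form formE [RHS]mxE.
apply/matrixP => p q; rewrite !ord1 wpE -/Xp -/Yp [LHS]mxE [RHS]mxE.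
apply: (mulfI Kpo); rewrite mulr0 mulr_sumr.
have term t : Kp 0 o * ((Xp *m wp) 0 t * Yp^T t 0) =
    (\sum_s Xp 0 s * wp o s) * (et t * Kp 0 t * Yp 0 t).
  rewrite [(Xp *m wp) _ _]mxE [Yp^T _ _]mxE mulrA mulr_sumr.
  have inner s : Kp 0 o * (Xp 0 s * wp s t) =
      (Xp 0 s * wp o s) * (et t * Kp 0 t) - (et s * Kp 0 s * Xp 0 s) * wp o t.
    by rewrite mulrCA wE; ring.
  rewrite (eq_bigr _ (fun s _ => inner s)) sumrB -!mulr_suml (orth X KX).
  by rewrite mul0r subr0 !mulrA.
rewrite (eq_bigr _ (fun t _ => term t)) -mulr_sumr.
by rewrite (orth Y KY) mulr0.
Qed.

End WaveAlgebra.

(** * The Ricci tensor of a wave at a point *)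

Section WaveRicci.
Context {R : realType} {n : nat}.
Variables (G : 'M[R]_n) (K : 'I_n -> R) (T : 'I_n -> 'I_n -> 'I_n -> 'I_n -> R).
Implicit Types (a b c d e f i j : 'I_n).
Hypothesis lorG : lorentzian_form G.
Hypothesis K_neq0 : exists a, K a != 0.

Let L a := \sum_b G a b * K b.
Let Kr : 'rV[R]_n := \row_a K a.

Lemma lorentzian_unit : G \in unitmx.
Proof.
case: lorG => symG [B uB BG].
suff : B *m G *m B^T \in unitmx by rewrite !unitmx_mul => /andP[/andP[]].
rewrite BG unitmxE det_diag unitfE; apply/prodf_neq0 => i _.
by rewrite !mxE; case: ifP => _; rewrite ?oppr_eq0 oner_neq0.
Qed.

Lemma lowered_form (X : 'rV[R]_n) : (Kr *m G *m X^T) 0 0 = \sum_a L a * X 0 a.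
Proof.
rewrite mxE; apply: eq_bigr => a _; rewrite !mxE /L; congr (_ * _).
apply: eq_bigr => b _; rewrite mxE mulrC; congr (_ * _).
by have [/matrixP/(_ a b) + _] := lorG; rewrite mxE => ->.
Qed.

Lemma lowered_neq0 : exists a, L a != 0.
Proof.
have [b Kb] := K_neq0; apply/existsP; apply: contra_neqT Kb => /existsPn H.
have KG : Kr *m G = 0.
  apply/rowP => a; rewrite [RHS]mxE.
  transitivity ((Kr *m G *m (delta_mx 0 a : 'rV[R]_n)^T) 0 0).
    by rewrite trmx_delta -colE [RHS]mxE.
  rewrite lowered_form; apply: big1 => i _.
  by have := H i; rewrite negbK => /eqP ->; rewrite mul0r.
have : Kr = 0 by rewrite -[Kr](mulmxK lorentzian_unit) KG mul0mx.
by move=> /rowP/(_ b); rewrite !mxE.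
Qed.

Hypothesis K_null : \sum_a L a * K a = 0.
Hypothesis T_anti : forall a b c d, T b a c d = - T a b c d.
Hypothesis T_pair : forall a b c d, T c d a b = T a b c d.
Hypothesis T_K : forall a c d, \sum_b T a b c d * K b = 0.
Hypothesis T_sqr : forall a b, \sum_e \sum_f
  (\sum_p \sum_q T a b p q * invmx G p e * invmx G q f) * T e f a b = 0.

Let Ginv_symm e f : invmx G e f = invmx G f e.
Proof.
have [/(congr1 invmx) + _] := lorG.
by rewrite -trmx_inv => /matrixP/(_ e f) <-; rewrite mxE.
Qed.

(** The curvature two-forms are null by the quadratic identity and annihilated by K. *)
Lemma wave_curvature_vanish a b (X Y : 'I_n -> R) :
  \sum_c L c * X c = 0 -> \sum_c L c * Y c = 0 ->
  \sum_e \sum_f X e * T a b e f * Y f = 0.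
Proof.
move=> LX LY; pose W : 'M[R]_n := \matrix_(e, f) T a b e f.
pose Xr : 'rV[R]_n := \row_e X e; pose Yr : 'rV[R]_n := \row_e Y e.
have ker (Z : 'I_n -> R) : \sum_c L c * Z c = 0 -> Kr *m G *m (\row_e Z e)^T = 0.
  move=> LZ; apply/matrixP => i j; rewrite !ord1 lowered_form [RHS]mxE -[RHS]LZ.
  by apply: eq_bigr => c _; rewrite mxE.
have : Xr *m W *m Yr^T = 0.
  apply: (null_form_vanish lorG (K := Kr)); [| | | | |exact: ker|exact: ker].
  - have [i Ki] := K_neq0; apply: contra_neq Ki => /rowP/(_ i).
    by rewrite !mxE.
  - exact: ker.
  - by apply/matrixP => e f; rewrite !mxE -T_pair T_anti T_pair.
  - apply/rowP => f; rewrite [LHS]mxE [RHS]mxE.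
    transitivity (- \sum_e T f e a b * K e); last by rewrite T_K oppr0.
    by rewrite -sumrN; apply: eq_bigr => e _; rewrite !mxE -T_pair T_anti mulrN mulrC.
  - rewrite -[RHS](T_sqr a b).
    rewrite /mxtrace; apply: eq_bigr => e _; rewrite [LHS]mxE; apply: eq_bigr => f _.
    rewrite [X in X * _]mxE [W^T f e]mxE [W e f]mxE -T_pair; congr (_ * _).
    rewrite [RHS]exchange_big; apply: eq_bigr => q _; rewrite [X in X * _]mxE mulr_suml.
    by apply: eq_bigr => p _; rewrite [W p q]mxE (Ginv_symm e p); ring.
move=> /matrixP/(_ 0 0); rewrite !mxE => H.
rewrite exchange_big -[RHS]H; apply: eq_bigr => f _.
rewrite !mxE mulr_suml; apply: eq_bigr => e _.
by rewrite !mxE.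
Qed.

Definition wave_ricci c b : R := \sum_a \sum_e invmx G a e * T e c a b.

Lemma wave_ricci_sym c b : wave_ricci c b = wave_ricci b c.
Proof.
rewrite /wave_ricci exchange_big; apply: eq_bigr => e _; apply: eq_bigr => a _.
by rewrite -T_pair Ginv_symm.
Qed.

Let raise a : \sum_e invmx G a e * L e = K a.
Proof.
rewrite /L; under eq_bigr => e _.
  rewrite mulr_sumr; under eq_bigr => b _ do rewrite mulrA; over.
rewrite exchange_big /= -[RHS](sum_delta K); apply: eq_bigr => b _.
rewrite -mulr_suml; congr (_ * _).
by have /matrixP/(_ a b) := mulVmx lorentzian_unit; rewrite !mxE.
Qed.

(** For X orthogonal to L, the first index of T(., X, ., .) is carried by a factor L by
    the preceding vanishing; contracting it produces K, which annihilates T. *)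
Lemma wave_ricci_orth b (X : 'I_n -> R) : \sum_c L c * X c = 0 ->
  \sum_c wave_ricci c b * X c = 0.
Proof.
move=> LX; have [i Li] := lowered_neq0; have LN := sum_dual Li.
set N := dual_vector L in LN.
pose S e a := \sum_c T e c a b * X c.
have SE e a : S e a = L e * \sum_f S f a * N f.
  rewrite (covector_on_kernel (v := S^~ a) e LN) => [//|Y LY].
  transitivity (- \sum_e \sum_f X e * T a b e f * Y f); last first.
    by rewrite (wave_curvature_vanish a b LX LY) oppr0.
  rewrite exchange_big -sumrN; apply: eq_bigr => f _.
  rewrite /S mulr_suml -sumrN; apply: eq_bigr => c _.
  by rewrite -[T a b c f]T_pair (T_anti f c); ring.
transitivity (\sum_a \sum_e invmx G a e * S e a).
  rewrite /wave_ricci; under eq_bigr => c _ do rewrite mulr_suml.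
  rewrite exchange_big; apply: eq_bigr => a _.
  under eq_bigr => c _ do rewrite mulr_suml.
  rewrite exchange_big; apply: eq_bigr => e _.
  by rewrite /S mulr_sumr; apply: eq_bigr => c _; rewrite mulrA.
transitivity (\sum_a K a * \sum_f S f a * N f).
  apply: eq_bigr => a _; rewrite -raise mulr_suml; apply: eq_bigr => e _.
  by rewrite SE mulrA.
under eq_bigr => a _ do rewrite mulr_sumr.
rewrite exchange_big; apply: big1 => f _.
transitivity ((\sum_c (\sum_a T f c a b * K a) * X c) * N f).
  rewrite mulr_suml; under [RHS]eq_bigr => c _ do rewrite !mulr_suml.
  rewrite [RHS]exchange_big; apply: eq_bigr => a _ /=.
  rewrite /S mulrA mulr_sumr mulr_suml; apply: eq_bigr => c _; ring.
rewrite big1 ?mul0r// => c _.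
transitivity (- (\sum_a T b a f c * K a) * X c); last by rewrite T_K oppr0 mul0r.
congr (_ * _); rewrite -sumrN; apply: eq_bigr => a _.
by rewrite (T_pair a b f c) (T_anti b a); ring.
Qed.

(** A symmetric form that vanishes as soon as one argument is in the kernel of L is a
    multiple of L L. *)
Lemma wave_ricciE c b : let N := dual_vector L in
  wave_ricci c b = (\sum_i \sum_j wave_ricci i j * N i * N j) * L c * L b.
Proof.
move=> N; have [i Li] := lowered_neq0; have LN : \sum_c L c * N c = 1 := sum_dual Li.
have E d e : wave_ricci d e = L d * \sum_f wave_ricci f e * N f.
  exact: (covector_on_kernel (v := wave_ricci^~ e) d LN (wave_ricci_orth e)).
rewrite E [RHS]mulrAC [RHS]mulrC; congr (_ * _).
rewrite exchange_big mulr_suml; apply: eq_bigr => f _.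
by rewrite wave_ricci_sym E -mulr_suml; ring.
Qed.

End WaveRicci.

(** * Adding a multiple of the squared null covector *)

(** The difference of the Levi-Civita connections of g + psi L L and g, where p is the
    differential of psi and q its gradient. *)
HB.lock Definition pert (R : realType) (n : nat) (K L p q : 'rV[R]_(1 + n) -> 'I_n -> R)
    (z : 'rV[R]_(1 + n)) (c a b : 'I_n) : R :=
  2^-1 * (K z c * (p z a * L z b + p z b * L z a) - q z c * (L z a * L z b)).

Lemma pertE (R : realType) (n : nat) (K L p q : 'rV[R]_(1 + n) -> 'I_n -> R) z c a b :
  pert K L p q z c a b =
  2^-1 * (K z c * (p z a * L z b + p z b * L z a) - q z c * (L z a * L z b)).
Proof. by rewrite pert.unlock. Qed.

Lemma sum_combination (R : realType) (n : nat) (F0 F1 F2 F3 F4 F5 F6 : 'I_n -> R) :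
  \sum_e (F0 e + (F1 e + F2 e + F3 e - F4 e - F5 e - F6 e)) =
  \sum_e F0 e + (\sum_e F1 e + \sum_e F2 e + \sum_e F3 e
                 - \sum_e F4 e - \sum_e F5 e - \sum_e F6 e).
Proof. by rewrite big_split /= !sumrB !big_split. Qed.

Section Perturbation.
Context {R : realType} {n : nat}.
Local Notation E := 'rV[R]_(1 + n).
Implicit Types (z w : E) (a b c d e f : 'I_n).
Variables (U : set 'rV[R]_n) (r : R).
Hypotheses (Uop : open U) (r_gt0 : 0 < r).
Local Notation D := (cyl U r).
Local Notation S := (smooth_on D).
Let Dop : open D := cyl_open Uop.

Variable G : E -> 'M[R]_n.
Hypothesis SG : forall a b, S (fun z => G z a b).
Hypothesis symG : forall z, D z -> (G z)^T = G z.
Hypothesis uG : forall z, D z -> G z \in unitmx.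
Variable K : E -> 'I_n -> R.
Hypothesis SK : forall a, S (fun z => K z a).
Hypothesis dK : forall z a b, D z ->
  dh a (fun w => K w b) z = - \sum_c hchr G z b a c * K z c.
Local Notation L := (Klow G K).
Hypothesis LK : forall z, D z -> \sum_a L z a * K z a = 0.
Variable psi : E -> R.
Hypothesis Spsi : S psi.
Hypothesis Kpsi : forall z, D z -> \sum_a K z a * dh a psi z = 0.

Definition pmet z : 'M[R]_n := \matrix_(a, b) (G z a b + psi z * L z a * L z b).

Let p z a := dh a psi z.
Let q z c := \sum_d invmx (G z) c d * p z d.
Local Notation C := (pert K L p q).
Local Notation Gam := (hchr G).

Let dif (h : E -> R) z : S h -> D z -> differentiable h z := @smooth_diff _ _ D h z.
Let SL a : S (fun z => L z a). Proof. exact: smooth_Klow. Qed.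
Let Sp a : S (fun z => p z a). Proof. exact: smooth_dh. Qed.
Let Sq c : S (fun z => q z c).
Proof. by apply: smooth_sum => // d _; apply: smoothM => //; exact: smooth_Ginv. Qed.

Lemma raise_L z c : D z -> \sum_d invmx (G z) c d * L z d = K z c.
Proof.
move=> Dz; under eq_bigr => d _.
  rewrite -KlowE mulr_sumr; under eq_bigr => b _ do rewrite mulrA; over.
rewrite exchange_big -[RHS](sum_delta (K z)); apply: eq_bigr => b _.
by rewrite -mulr_suml (sum_GinvG uG).
Qed.

Lemma sum_qL z : D z -> \sum_c q z c * L z c = 0.
Proof.
move=> Dz; rewrite -[RHS](Kpsi Dz) /q.
under eq_bigr => c _ do rewrite mulr_suml.
rewrite exchange_big; apply: eq_bigr => d _; rewrite -raise_L// mulr_suml.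
by apply: eq_bigr => c _; rewrite (Ginv_sym symG c d Dz) /p; ring.
Qed.

(** L being null, the expansion of the inverse in powers of psi stops at first order. *)
Lemma pmet_unit z : D z -> pmet z \in unitmx /\
  forall a b, invmx (pmet z) a b = invmx (G z) a b - psi z * K z a * K z b.
Proof.
move=> Dz; pose V : 'M[R]_n := \matrix_(a, b) (invmx (G z) a b - psi z * K z a * K z b).
have PV : pmet z *m V = 1%:M.
  apply/matrixP => a b; rewrite [LHS]mxE [RHS]mxE.
  transitivity (\sum_j G z a j * invmx (G z) j b - psi z * K z b * (\sum_j G z a j * K z j)
     + psi z * L z a * (\sum_j invmx (G z) b j * L z j)
     - psi z * psi z * L z a * K z b * (\sum_j L z j * K z j)).
    rewrite !mulr_sumr -!sumrN -!big_split; apply: eq_bigr => j _ /=.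
    by rewrite [pmet z a j]mxE [V j b]mxE (Ginv_sym symG b j Dz); ring.
  by rewrite KlowE (sum_GGinv uG)// raise_L// LK//; generalize_atoms; ring.
have [uP _] := mulmx1_unit PV; split=> // a b.
by rewrite -[invmx (pmet z)]mulmx1 -PV mulKmx// [LHS]mxE.
Qed.

Lemma smooth_pmet a b : S (fun z => pmet z a b).
Proof.
have -> : (fun z => pmet z a b) = (fun z => G z a b + psi z * L z a * L z b).
  by apply/funext => z; rewrite mxE.
by apply: smoothD => //; do 2?apply: smoothM => //.
Qed.

Lemma dL_sym z a b : D z -> dh a (fun w => L w b) z = dh b (fun w => L w a) z.
Proof.
move=> Dz; rewrite !(dKlow Uop SG symG uG SK dK)//; apply: eq_bigr => e _.
by rewrite (chr_sym Uop symG e a b Dz).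
Qed.

Lemma d_psiLL z a b c : D z -> dh c (fun w => psi w * L w a * L w b) z =
  p z c * L z a * L z b + psi z * (dh c (fun w => L w a) z * L z b
    + L z a * dh c (fun w => L w b) z).
Proof.
move=> Dz; rewrite /dh.
have dp : differentiable psi z by exact: dif.
have dL e : differentiable (fun w => L w e) z by exact: dif.
have dpL : differentiable (fun w => psi w * L w a) z := differentiableM dp (dL a).
rewrite (partialM _ dpL (dL b)) (partialM _ dp (dL a)).
rewrite /p /dh; set x := partial _ psi z; set y := partial _ _ z; set t := partial _ _ z.
by move: x y t => x y t; ring.
Qed.

(** Since L is parallel and K psi = 0, the correction of the inverse metric only meets the
    derivatives of the old metric, where it cancels the terms without derivatives of psi. *)
Lemma hchr_pmet z c a b : D z -> hchr pmet z c a b = Gam z c a b + C z c a b.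
Proof.
move=> Dz; have [_ VE] := pmet_unit Dz.
have dP i j k : dh k (fun w => pmet w i j) z = dh k (fun w => G w i j) z +
    (p z k * L z i * L z j + psi z * (dh k (fun w => L w i) z * L z j
    + L z i * dh k (fun w => L w j) z)).
  rewrite -d_psiLL//.
  have -> : (fun w => pmet w i j) = (fun w => G w i j + psi w * L w i * L w j).
    by apply/funext => w; rewrite mxE.
  rewrite /dh partialD//; first exact: dif.
  by apply: dif => //; do 2?apply: smoothM => //.
pose M := dh a (fun w => L w b) z.
pose P d := p z a * L z b * L z d + p z b * L z a * L z d - L z a * L z b * p z d
            + 2 * psi z * M * L z d.
pose Q d := dh a (fun w => G w d b) z + dh b (fun w => G w d a) z - dh d (fun w => G w a b) z.
have QP d : dh a (fun w => pmet w d b) z + dh b (fun w => pmet w d a) z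
    - dh d (fun w => pmet w a b) z = Q d + P d.
  rewrite !dP (dL_sym d a Dz) (dL_sym d b Dz) (dL_sym b a Dz) /Q /P /M.
  move: (psi z) (p z a) (p z b) (p z d) (L z a) (L z b) (L z d) => x pa pb pd la lb ld.
  by generalize_atoms; ring.
have Q1 d : Q d = 2 * chr1 G z d a b.
  by rewrite chr1.unlock mulrA mulfV ?mul1r// pnatr_eq0.
have KQ : \sum_d K z d * Q d = 2 * M.
  rewrite /M (dKlow Uop SG symG uG SK dK)// mulr_sumr.
  under eq_bigr => d _ do rewrite Q1 -(sum_G_chr uG d a b Dz) !mulr_sumr.
  rewrite exchange_big; apply: eq_bigr => e _.
  rewrite -KlowE !mulr_sumr; apply: eq_bigr => d _.
  by rewrite (G_sym symG e d Dz); ring.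
have sumP (v : 'I_n -> R) : \sum_d v d * P d =
    (p z a * L z b + p z b * L z a + 2 * psi z * M) * (\sum_d v d * L z d)
    - L z a * L z b * (\sum_d v d * p z d).
  rewrite !mulr_sumr -sumrB; apply: eq_bigr => d _; rewrite /P; ring.
have KP : \sum_d K z d * P d = 0.
  rewrite sumP (Kpsi Dz) mulr0 subr0 -[RHS](mulr0 (p z a * L z b + p z b * L z a + 2 * psi z * M)).
  by congr (_ * _); rewrite -[RHS](LK Dz); apply: eq_bigr => d _; rewrite mulrC.
have VP : \sum_d invmx (G z) c d * P d =
    (p z a * L z b + p z b * L z a + 2 * psi z * M) * K z c - L z a * L z b * q z c.
  by rewrite sumP raise_L.
rewrite pert.unlock hchr.unlock -mulrDr; congr (_ * _).
transitivity (\sum_d invmx (G z) c d * Q d + \sum_d invmx (G z) c d * P d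
   - psi z * K z c * (\sum_d K z d * Q d + \sum_d K z d * P d)).
  rewrite -!big_split mulr_sumr -sumrB; apply: eq_bigr => d _.
  by rewrite QP VE /=; ring.
rewrite KQ KP VP -addrA; congr (_ + _).
by move: (M) => m; ring.
Qed.

Lemma sum_LC z a b : D z -> \sum_e L z e * C z e a b = 0.
Proof.
move=> Dz; transitivity (2^-1 * ((p z a * L z b + p z b * L z a) * (\sum_e L z e * K z e)
    - L z a * L z b * (\sum_e q z e * L z e))).
  rewrite mulrBr !mulr_sumr -sumrB; apply: eq_bigr => e _.
  by rewrite pertE; ring.
by rewrite (LK Dz) (sum_qL Dz) !mulr0 subrr mulr0.
Qed.

Lemma sum_KC z c b : D z -> \sum_a K z a * C z c a b = 0.
Proof.
move=> Dz; transitivity (2^-1 * (K z c * L z b * (\sum_a K z a * p z a)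
    + (K z c * p z b - q z c * L z b) * (\sum_a L z a * K z a))).
  rewrite mulrDr !mulr_sumr -big_split; apply: eq_bigr => a _ /=.
  by rewrite pertE; ring.
by rewrite (LK Dz) (Kpsi Dz) !mulr0 addr0 mulr0.
Qed.

Lemma trace_C z b : D z -> \sum_a C z a a b = 0.
Proof.
move=> Dz; transitivity (2^-1 * (L z b * (\sum_a K z a * p z a)
    + p z b * (\sum_a L z a * K z a) - L z b * (\sum_a q z a * L z a))).
  rewrite mulrBr mulrDr !mulr_sumr -big_split -sumrB; apply: eq_bigr => a _ /=.
  by rewrite pertE; ring.
by rewrite (LK Dz) (Kpsi Dz) (sum_qL Dz) !mulr0 addr0 subrr mulr0.
Qed.

(** The contractions of the difference tensor vanish because L and the differential of psi
    annihilate K and the gradient of psi is orthogonal to K; hence so does this one. *)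
Lemma sum_CC z b c : D z -> \sum_a \sum_e C z a b e * C z e a c = 0.
Proof.
move=> Dz.
transitivity (\sum_a (2^-1 * (K z a * p z b - q z a * L z b) * (\sum_e L z e * C z e a c))
   + \sum_e (2^-1 * L z b * p z e * (\sum_a K z a * C z e a c))).
  rewrite [X in _ + X](eq_bigr (fun e => \sum_a 2^-1 * L z b * p z e * (K z a * C z e a c)));
    last by move=> e _; rewrite mulr_sumr.
  rewrite [X in _ + X]exchange_big -big_split; apply: eq_bigr => a _ /=.
  rewrite mulr_sumr -big_split; apply: eq_bigr => e _ /=.
  rewrite (pertE K L p q z a b e); move: (C z e a c) => t; ring.
rewrite big1 => [|a _]; last by rewrite sum_LC// mulr0.
by rewrite add0r big1// => e _; rewrite sum_KC// mulr0.
Qed.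

Lemma smooth_C c a b : S (fun z => C z c a b).
Proof.
rewrite pert.unlock; apply: smoothZ => //; apply: smoothB => //.
  by apply: smoothM => //; apply: smoothD => //; apply: smoothM.
by apply: smoothM => //; apply: smoothM.
Qed.

(** The divergence of the gradient of psi. *)
Let box z : R := \sum_a dh a (fun w => q w a) z + \sum_a \sum_e Gam z a a e * q z e.

Lemma d_C z a b c d : D z -> dh d (fun w => C w c a b) z =
  2^-1 * (dh d (fun w => K w c) z * (p z a * L z b + p z b * L z a)
   + K z c * (dh d (fun w => p w a) z * L z b + p z a * dh d (fun w => L w b) z
              + (dh d (fun w => p w b) z * L z a + p z b * dh d (fun w => L w a) z))
   - (dh d (fun w => q w c) z * (L z a * L z b) + q z c *
      (dh d (fun w => L w a) z * L z b + L z a * dh d (fun w => L w b) z))).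
Proof.
move=> Dz.
have dpL i j : differentiable (fun w => p w i * L w j) z.
  by apply: dif => //; apply: smoothM.
have dLL i j : differentiable (fun w => L w i * L w j) z.
  by apply: dif => //; apply: smoothM.
have dK' i : differentiable (fun w => K w i) z by exact: dif.
have dp i : differentiable (fun w => p w i) z by exact: dif.
have dq i : differentiable (fun w => q w i) z by exact: dif.
have dL i : differentiable (fun w => L w i) z by exact: dif.
have dpLL : differentiable (fun w => p w a * L w b + p w b * L w a) z.
  exact: differentiableD (dpL a b) (dpL b a).
have d1 : differentiable (fun w => K w c * (p w a * L w b + p w b * L w a)) z.
  exact: differentiableM (dK' c) dpLL.
have d2 : differentiable (fun w => q w c * (L w a * L w b)) z.
  exact: differentiableM (dq c) (dLL a b).
rewrite pert.unlock /dh.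
rewrite (partialZ _ _ (differentiableB d1 d2)) (partialB _ d1 d2).
rewrite (partialM _ (dK' c) dpLL) (partialD _ (dpL a b) (dpL b a)).
rewrite (partialM _ (dp a) (dL b)) (partialM _ (dp b) (dL a)).
by rewrite (partialM _ (dq c) (dLL a b)) (partialM _ (dL a) (dL b)).
Qed.

(** The terms that are quadratic in the difference tensor drop out; in its divergence, K
    being parallel, only the Laplacian of psi remains. *)
Lemma hric_pmet z c b : D z -> hric (hchr pmet) z c b =
  hric Gam z c b - 2^-1 * box z * L z b * L z c.
Proof.
move=> Dz.
pose k := - \sum_a \sum_e Gam z a a e * K z e.
pose M i j := dh i (fun w => L w j) z.
have ME i j : M i j = \sum_e Gam z e i j * L z e by apply: (dKlow Uop SG symG uG SK dK).
have Ms i j : M i j = M j i by apply: dL_sym.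
pose u i := \sum_a K z a * dh a (fun w => p w i) z.
pose m i := \sum_a K z a * M a i.
pose h i := \sum_a q z a * M a i.
have uE i : u i = \sum_a p z a * \sum_e Gam z a i e * K z e.
  have Zero : eq_on D (fun w => \sum_a K w a * p w a) (fun=> 0) by exact: Kpsi.
  have := partial_eq_on Dop (rshift 1 i) Zero Dz.
  have dK' a : differentiable (fun w => K w a) z by exact: dif.
  have dp a : differentiable (fun w => p w a) z by exact: dif (Sp a) Dz.
  have term a : partial (rshift 1 i) (fun w => K w a * p w a) z =
      K z a * dh a (fun w => p w i) z - p z a * \sum_e Gam z a i e * K z e.
    rewrite (partialM _ (dK' a) (dp a)) (dK i a Dz : partial _ _ z = _).
    rewrite (partialC Dop (rshift 1 i) (rshift 1 a) Spsi Dz : partial _ (p^~ a) z = _).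
    by rewrite mulNr addrC mulrC [X in _ - X]mulrC [X in X - _]mulrC.
  rewrite partial_cst partial_sum => [|a _]; last exact: differentiableM (dK' a) (dp a).
  by rewrite (eq_bigr _ (fun a _ => term a)) sumrB => /eqP; rewrite subr_eq0 => /eqP.
have SE (c0 : R) (F : 'I_n -> R) : \sum_a c0 * F a = c0 * \sum_a F a by rewrite mulr_sumr.
have A : \sum_a dh a (fun w => C w a b c) z = 2^-1 *
    (- (- k) * (p z b * L z c + p z c * L z b)
     + (u b * L z c + p z b * m c + (u c * L z b + p z c * m b))
     - ((\sum_a dh a (fun w => q w a) z) * (L z b * L z c)
        + (h b * L z c + L z b * h c))).
  have -> : - (- k) = \sum_a dh a (fun w => K w a) z.
    by rewrite opprK /k -sumrN; apply: eq_bigr => a _; rewrite dK.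
  rewrite (eq_bigr _ (fun a _ => d_C b c a a Dz)) -mulr_sumr; congr (_ * _).
  rewrite (eq_bigr (fun a => (p z b * L z c + p z c * L z b) * dh a (fun w => K w a) z
    + L z c * (K z a * dh a (fun w => p w b) z) + p z b * (K z a * M a c)
    + L z b * (K z a * dh a (fun w => p w c) z) + p z c * (K z a * M a b)
    + (- (L z b * L z c)) * dh a (fun w => q w a) z
    + (- L z c) * (q z a * M a b) + (- L z b) * (q z a * M a c))); last first.
    move=> a _; rewrite /M; generalize_atoms.
    by move: (p z b) (p z c) (L z b) (L z c) (K z a) (q z a) => *; ring.
  transitivity ((p z b * L z c + p z c * L z b) * \sum_a dh a (fun w => K w a) z
    + L z c * u b + p z b * m c + L z b * u c + p z c * m b
    + (- (L z b * L z c)) * \sum_a dh a (fun w => q w a) z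
    + (- L z c) * h b + (- L z b) * h c).
    by do 7![rewrite big_split; congr (_ + _); last exact: SE]; exact: SE.
  move: (u b) (u c) (m b) (m c) (h b) (h c) => *; generalize_atoms.
  by move: (p z b) (p z c) (L z b) (L z c) => *; ring.
have B : \sum_a \sum_e Gam z a a e * C z e b c = 2^-1 *
    (- k * (p z b * L z c + p z c * L z b)
     - (\sum_a \sum_e Gam z a a e * q z e) * (L z b * L z c)).
  rewrite /k opprK mulrBr; rewrite !mulr_suml !mulr_sumr -sumrB.
  apply: eq_bigr => a _; rewrite !mulr_suml !mulr_sumr -sumrB.
  by apply: eq_bigr => e _; rewrite pertE; move: (Gam z a a e) => t; ring.
have Cc : \sum_a \sum_e Gam z a b e * C z e a c = 2^-1 *
    (L z c * u b + p z c * m b - L z c * h b).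
  have -> : m b = \sum_a \sum_e Gam z a b e * K z e * L z a.
    rewrite /m exchange_big; apply: eq_bigr => a _; rewrite Ms ME mulr_sumr.
    by apply: eq_bigr => e _; ring.
  have -> : h b = \sum_a \sum_e Gam z a b e * q z e * L z a.
    rewrite /h exchange_big; apply: eq_bigr => a _; rewrite Ms ME mulr_sumr.
    by apply: eq_bigr => e _; ring.
  rewrite uE mulrBr mulrDr !mulr_sumr -big_split -sumrB; apply: eq_bigr => a _ /=.
  rewrite !mulr_sumr -big_split -sumrB; apply: eq_bigr => e _ /=.
  by rewrite pertE; move: (Gam z a b e) => t; ring.
have Dd : \sum_a \sum_e C z a b e * Gam z e a c = 2^-1 *
    (p z b * m c + L z b * u c - L z b * h c).
  have -> : u c = \sum_a \sum_e K z a * p z e * Gam z e a c.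
    rewrite uE exchange_big; apply: eq_bigr => e _; rewrite mulr_sumr.
    by apply: eq_bigr => a _; rewrite (chr_sym Uop symG e a c Dz); ring.
  rewrite /m /h mulrBr mulrDr !mulr_sumr -big_split -sumrB; apply: eq_bigr => a _ /=.
  rewrite !ME !mulr_sumr -big_split -sumrB; apply: eq_bigr => e _ /=.
  by rewrite pertE; move: (Gam z e a c) => t; ring.
have dif_Gam i j l : differentiable (fun w => Gam w i j l) z.
  by apply: dif => //; exact: smooth_chr.
have dif_C i j l : differentiable (fun w => C w i j l) z.
  by apply: dif => //; exact: smooth_C.
have dGC i j l f : dh f (fun w => hchr pmet w i j l) z =
    dh f (fun w => Gam w i j l) z + dh f (fun w => C w i j l) z.
  have EQ : eq_on D (fun w => hchr pmet w i j l) (fun w => Gam w i j l + C w i j l).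
    by move=> w Dw; exact: hchr_pmet.
  rewrite /dh (partial_eq_on Dop _ EQ Dz).
  exact: partialD.
have trace0 : \sum_a dh b (fun w => C w a a c) z = 0.
  have Zero : eq_on D (fun w => \sum_a C w a a c) (fun=> 0).
    by move=> w Dw; exact: trace_C.
  rewrite -[RHS](congr1 (@^~ z) (partial_cst (rshift 1 b) 0)).
  by rewrite -(partial_eq_on Dop _ Zero Dz) partial_sum.
have trC0 : \sum_a \sum_e C z a a e * Gam z e b c = 0.
  rewrite exchange_big; apply: big1 => e _.
  by rewrite -mulr_suml trace_C// mul0r.
have CC0 : \sum_a \sum_e C z a a e * C z e b c = 0.
  rewrite exchange_big; apply: big1 => e _.
  by rewrite -mulr_suml trace_C// mul0r.
have CC := sum_CC b c Dz.
pose X1 a := \sum_e Gam z a a e * C z e b c.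
pose X2 a := \sum_e C z a a e * Gam z e b c.
pose X3 a := \sum_e C z a a e * C z e b c.
pose X4 a := \sum_e Gam z a b e * C z e a c.
pose X5 a := \sum_e C z a b e * Gam z e a c.
pose X6 a := \sum_e C z a b e * C z e a c.
have perE a : curv (hchr pmet) z a c a b = curv Gam z a c a b
    + (dh a (fun w => C w a b c) z - dh b (fun w => C w a a c) z
       + (X1 a + X2 a + X3 a - X4 a - X5 a - X6 a)).
  rewrite curv.unlock !dGC.
  have -> : \sum_e (hchr pmet z a a e * hchr pmet z e b c -
      hchr pmet z a b e * hchr pmet z e a c) =
    \sum_e (Gam z a a e * Gam z e b c - Gam z a b e * Gam z e a c) +
      (X1 a + X2 a + X3 a - X4 a - X5 a - X6 a).
    rewrite -sum_combination; apply: eq_bigr => e _.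
    by rewrite !hchr_pmet//; ring.
  move: (X1 a + _ + _ - _ - _ - _) => x; generalize_atoms; ring.
transitivity (\sum_a curv Gam z a c a b
   + (\sum_a dh a (fun w => C w a b c) z - \sum_a dh b (fun w => C w a a c) z
   + (\sum_a X1 a + \sum_a X2 a + \sum_a X3 a - \sum_a X4 a - \sum_a X5 a - \sum_a X6 a))).
  rewrite /hric (eq_bigr _ (fun a _ => perE a)).
  by move: X1 X2 X3 X4 X5 X6 {perE} => *; rewrite big_split/= big_split/= sumrB
     !sumrB !big_split.
rewrite A /X1 B /X2 trC0 /X3 CC0 /X4 Cc /X5 Dd /X6 CC trace0 /box; congr (_ + _).
move: (u b) (u c) (m b) (m c) (h b) (h c) (k) => *; generalize_atoms.
by move: (p z b) (p z c) (L z b) (L z c) => *; ring.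
Qed.

Lemma hchr_pmet_trace z e : D z ->
  \sum_a hchr pmet z a a e = \sum_a Gam z a a e.
Proof.
move=> Dz; rewrite (eq_bigr _ (fun a _ => hchr_pmet a a e Dz)) big_split /=.
by rewrite trace_C// addr0.
Qed.

Lemma hchr_pmet_low z b e : D z ->
  \sum_a L z a * hchr pmet z a b e = \sum_a L z a * Gam z a b e.
Proof.
move=> Dz; rewrite (eq_bigr (fun a => L z a * Gam z a b e + L z a * C z a b e)).
  by rewrite big_split /= sum_LC// addr0.
by move=> a _; rewrite hchr_pmet// mulrDr.
Qed.

Lemma hric_pmet_multiple : exists2 sigma, S sigma & forall z c b, D z ->
  hric (hchr pmet) z c b = hric Gam z c b + sigma z * L z c * L z b.
Proof.
exists (fun z => - 2^-1 * box z); last first.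
  by move=> z c b Dz; rewrite hric_pmet//; move: (box z) (hric _ _ _ _) => *; ring.
apply: smoothZ => //; apply: smoothD => //; apply: smooth_sum => // a _.
  exact: smooth_dh.
by apply: smooth_sum => // e _; apply: smoothM => //; exact: smooth_chr.
Qed.

End Perturbation.

(** * Ricci tensor of a block connection *)

Section BlockRicci.
Context {R : realType} {n : nat}.
Local Notation E := 'rV[R]_(1 + n).
Implicit Types (z w : E) (a b c d e f : 'I_n).
Variable D : set E.
Hypothesis Dop : open D.
Local Notation o := (lshift n (ord0 : 'I_1)).
Local Notation h := (rshift 1).

(** The curvature of a connection on the collar itself. *)
Definition mcurv (H : 'rV[R]_(1 + n) -> 'I_(1 + n) -> 'I_(1 + n) -> 'I_(1 + n) -> R) z
    (d c a b : 'I_(1 + n)) : R :=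
  partial a (fun w => H w d b c) z - partial b (fun w => H w d a c) z
  + \sum_(e < 1 + n) (H z d a e * H z e b c - H z d b e * H z e a c).

(** The shape of the Levi-Civita connection of a multiple u(x) (dx^2 + g_x): Gam is the
    connection of the slices, P and A are a second fundamental form and shape operator. *)
Variables (H : E -> 'I_(1 + n) -> 'I_(1 + n) -> 'I_(1 + n) -> R).
Variables (y : E -> R) (P A : E -> 'I_n -> 'I_n -> R).
Variable Gam : 'rV[R]_(1 + n) -> 'I_n -> 'I_n -> 'I_n -> R.
Hypothesis Hooo : forall z, D z -> H z o o o = y z.
Hypothesis Hooh : forall z a, D z -> H z o o (h a) = 0.
Hypothesis Hoho : forall z a, D z -> H z o (h a) o = 0.
Hypothesis Hohh : forall z a b, D z -> H z o (h a) (h b) = P z a b.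
Hypothesis Hhoo : forall z c, D z -> H z (h c) o o = 0.
Hypothesis Hhoh : forall z c b, D z -> H z (h c) o (h b) = A z c b.
Hypothesis Hhho : forall z c b, D z -> H z (h c) (h b) o = A z c b.
Hypothesis Hhhh : forall z c a b, D z -> H z (h c) (h a) (h b) = Gam z c a b.

Let peq k (u v : E -> R) z : (forall w, D w -> u w = v w) -> D z ->
  partial k u z = partial k v z := fun uv Dz => @partial_eq_on _ _ _ Dop k u v uv z Dz.

Lemma block_ricci_tangent z c b : D z ->
  \sum_a mcurv H z a (h c) a (h b) =
  hric Gam z c b + d0 (fun w => P w b c) z + y z * P z b c + (\sum_a A z a a) * P z b c
  - \sum_e P z b e * A z e c - \sum_a A z a b * P z a c.
Proof.
move=> Dz; rewrite big_split_ord big_ord1 /=.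
have -> : mcurv H z o (h c) o (h b) =
    d0 (fun w => P w b c) z + y z * P z b c - \sum_e P z b e * A z e c.
  rewrite /mcurv (peq o (v := fun w => P w b c))//; last by move=> w Dw; exact: Hohh.
  rewrite (peq (h b) (v := fun=> 0))//; last by move=> w Dw; exact: Hooh.
  rewrite partial_cst subr0 -addrA; congr (_ + _).
  rewrite big_split_ord big_ord1 /= Hooo// Hohh// Hoho// mul0r subr0; congr (_ + _).
  rewrite -sumrN; apply: eq_bigr => e _.
  by rewrite Hooh// Hohh// Hhoh// mul0r sub0r.
have -> : \sum_a mcurv H z (h a) (h c) (h a) (h b) =
    \sum_a (curv Gam z a c a b + (A z a a * P z b c - A z a b * P z a c)); last first.
  rewrite big_split sumrB -mulr_suml /hric /=.
  have aux (t q s1 s2 s3 s4 : R) : t + q - s3 + (s1 + (s2 - s4)) = s1 + t + q + s2 - s3 - s4.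
    by ring.
  exact: aux.
apply: eq_bigr => a _; rewrite /mcurv curv.unlock.
rewrite (peq (h a) (v := fun w => Gam w a b c))//; last by move=> w Dw; exact: Hhhh.
rewrite (peq (h b) (v := fun w => Gam w a a c))//; last by move=> w Dw; exact: Hhhh.
rewrite big_split_ord big_ord1 /= Hhho// Hohh// Hhho// Hohh//.
rewrite [X in _ + X]addrC addrA; congr (_ + _ + _).
by apply: eq_bigr => e _; rewrite !Hhhh.
Qed.

Lemma block_ricci_mixed z b : (forall w, D w -> dh b y w = 0) -> D z ->
  \sum_a mcurv H z a o a (h b) =
  \sum_a (dh a (fun w => A w a b) z - dh b (fun w => A w a a) z
    + \sum_e (Gam z a a e * A z e b - Gam z a b e * A z e a)).
Proof.
move=> dy Dz; rewrite big_split_ord big_ord1 /=.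
have -> : mcurv H z o o o (h b) = 0.
  rewrite /mcurv (peq o (v := fun=> 0))//; last by move=> w Dw; exact: Hoho.
  rewrite (peq (h b) (v := y))//.
  rewrite partial_cst -/(dh b y z) dy// subrr add0r.
  rewrite big_split_ord big_ord1 /= Hoho// Hooo// mulr0 mul0r subrr add0r.
  by apply: big1 => e _; rewrite Hooh// Hhoo// mul0r mulr0 subrr.
rewrite add0r; apply: eq_bigr => a _; rewrite /mcurv.
rewrite (peq (h a) (v := fun w => A w a b))//; last by move=> w Dw; exact: Hhho.
rewrite (peq (h b) (v := fun w => A w a a))//; last by move=> w Dw; exact: Hhho.
congr (_ + _); rewrite big_split_ord big_ord1 /= Hoho// Hoho// !mulr0 subrr add0r.
by apply: eq_bigr => e _; rewrite !Hhhh// !Hhho.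
Qed.

End BlockRicci.

(** * Ricci tensor of the cone metric *)

(** The endomorphism g_x^-1 g_x'. *)
HB.lock Definition shape (R : realType) (n : nat) (G : 'rV[R]_(1 + n) -> 'M[R]_n)
    (z : 'rV[R]_(1 + n)) (c b : 'I_n) : R :=
  \sum_d invmx (G z) c d * d0 (fun w => G w d b) z.

Section ConeMetric.
Context {R : realType} {n : nat}.
Local Notation E := 'rV[R]_(1 + n).
Implicit Types (z w : E) (a b c d e f : 'I_n).
Variables (U : set 'rV[R]_n) (r : R).
Hypotheses (Uop : open U) (r_gt0 : 0 < r).
Local Notation D := (cyl U r).
Local Notation S := (smooth_on D).
Local Notation x_ := (@coord_x R n).
Local Notation o := (lshift n (ord0 : 'I_1)).
Local Notation h := (rshift 1).
Let Dop : open D := cyl_open Uop.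

Variable G : E -> 'M[R]_n.
Hypothesis SG : forall a b, S (fun z => G z a b).
Hypothesis symG : forall z, D z -> (G z)^T = G z.
Hypothesis uG : forall z, D z -> G z \in unitmx.

Definition cone z : 'M[R]_(1 + n) :=
  (coord_x z ^+ 2)^-1 *: block_mx (1%:M : 'M[R]_1) 0 0 (G z).

Definition posD : set E := [set z | D z /\ 0 < coord_x z].

Lemma posD_open : open posD.
Proof.
have -> : posD = D `&` x_ @^-1` [set t | 0 < t] by [].
apply: openI => //; apply: open_comp; last exact: open_gt.
move=> z _; exact/differentiable_continuous/differentiable_coord_x.
Qed.

Let H := christoffel cone.
Let P z a b : R := (x_ z)^-1 * G z a b - 2^-1 * d0 (fun w => G w a b) z.
Local Notation B := (shape G).
Let A z c b : R := 2^-1 * B z c b - (x_ z)^-1 * (c == b)%:R.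

Let coneoo z : cone z o o = (x_ z ^+ 2)^-1.
Proof. by rewrite mxE block_mxEul mxE eqxx mulr1. Qed.
Let coneoh z a : cone z o (h a) = 0.
Proof. by rewrite mxE block_mxEur mxE mulr0. Qed.
Let coneho z a : cone z (h a) o = 0.
Proof. by rewrite mxE block_mxEdl mxE mulr0. Qed.
Let conehh z a b : cone z (h a) (h b) = (x_ z ^+ 2)^-1 * G z a b.
Proof. by rewrite mxE block_mxEdr. Qed.

Let coneV z : posD z ->
  invmx (cone z) = (x_ z ^+ 2) *: block_mx (1%:M : 'M[R]_1) 0 0 (invmx (G z)).
Proof.
move=> [Dz x0]; set V := RHS.
have PV : cone z *m V = 1%:M.
  rewrite /V -scalemxAr -scalemxAl scalerA mulfV ?scale1r; last first.
    by rewrite expf_neq0// gt_eqF.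
  rewrite mulmx_block !mulmx0 !mul0mx !mulmx1 !addr0 add0r mulmxV ?uG//.
  by rewrite -scalar_mx_block.
have [uP _] := mulmx1_unit PV.
by rewrite -[invmx (cone z)]mulmx1 -PV mulKmx.
Qed.

Let Voo z : posD z -> invmx (cone z) o o = x_ z ^+ 2.
Proof. by move=> /coneV ->; rewrite mxE block_mxEul mxE eqxx mulr1. Qed.
Let Voh z a : posD z -> invmx (cone z) o (h a) = 0.
Proof. by move=> /coneV ->; rewrite mxE block_mxEur mxE mulr0. Qed.
Let Vho z a : posD z -> invmx (cone z) (h a) o = 0.
Proof. by move=> /coneV ->; rewrite mxE block_mxEdl mxE mulr0. Qed.
Let Vhh z a b : posD z -> invmx (cone z) (h a) (h b) = x_ z ^+ 2 * invmx (G z) a b.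
Proof. by move=> /coneV ->; rewrite mxE block_mxEdr. Qed.

Let dif (k : E -> R) z : S k -> D z -> differentiable k z := @smooth_diff _ _ D k z.
Let Sx : S x_. Proof. exact: smooth_coord_x. Qed.

Let dx2 k z : D z -> partial k (fun w => x_ w ^+ 2) z = 2 * x_ z * partial k x_ z.
Proof.
move=> Dz; have dx : differentiable x_ z by exact: dif.
have -> : (fun w => x_ w ^+ 2) = (fun w => x_ w * x_ w).
  by apply/funext => w; rewrite expr2.
by rewrite (partialM _ dx dx); ring.
Qed.

Let dxV2 k z : posD z ->
  partial k (fun w => (x_ w ^+ 2)^-1) z = - 2 * (x_ z)^-3 * partial k x_ z.
Proof.
move=> [Dz x0]; have x2 : x_ z ^+ 2 != 0 by rewrite expf_neq0// gt_eqF.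
have d2 : differentiable (fun w => x_ w ^+ 2) z by apply: dif => //; exact: smooth_xn.
rewrite (partialV _ d2 x2) dx2//; move: (partial k x_ z) => t.
by field; rewrite gt_eqF.
Qed.

Let dxV k z : posD z ->
  partial k (fun w => (x_ w)^-1) z = - (x_ z)^-2 * partial k x_ z.
Proof.
move=> [Dz x0]; have xn0 : x_ z != 0 by rewrite gt_eqF.
have dx : differentiable x_ z by exact: dif.
by rewrite (partialV _ dx xn0).
Qed.

Let pox z : partial o x_ z = 1.
Proof. by have /(congr1 (@^~ z)) := @d0_coord_x R n. Qed.
Let phx a z : partial (h a) x_ z = 0.
Proof. by have /(congr1 (@^~ z)) := @dh_coord_x R n a. Qed.

Let dif_xV2 z : posD z -> differentiable (fun w => (x_ w ^+ 2)^-1) z.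
Proof.
move=> [Dz x0]; apply: differentiableV; first by apply: dif => //; exact: smooth_xn.
by rewrite expf_neq0// gt_eqF.
Qed.

Let dconehh k z a b : posD z -> partial k (fun w => cone w (h a) (h b)) z =
  - 2 * (x_ z)^-3 * partial k x_ z * G z a b
  + (x_ z ^+ 2)^-1 * partial k (fun w => G w a b) z.
Proof.
move=> pz; have [Dz x0] := pz.
have -> : (fun w => cone w (h a) (h b)) = (fun w => (x_ w ^+ 2)^-1 * G w a b).
  by apply/funext => w; rewrite conehh.
by rewrite (partialM _ (dif_xV2 pz) (dif (SG a b) Dz)) dxV2.
Qed.

Let dconeoo k z : posD z ->
  partial k (fun w => cone w o o) z = - 2 * (x_ z)^-3 * partial k x_ z.
Proof.
move=> pz; have -> : (fun w => cone w o o) = (fun w => (x_ w ^+ 2)^-1).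
  by apply/funext => w; rewrite coneoo.
exact: dxV2.
Qed.

Let dconeoh k z a : partial k (fun w => cone w o (h a)) z = 0.
Proof.
have -> : (fun w => cone w o (h a)) = (fun=> 0) by apply/funext => w; rewrite coneoh.
by rewrite partial_cst.
Qed.

Let dconeho k z a : partial k (fun w => cone w (h a) o) z = 0.
Proof.
have -> : (fun w => cone w (h a) o) = (fun=> 0) by apply/funext => w; rewrite coneho.
by rewrite partial_cst.
Qed.

Let chro z (a b : 'I_(1 + n)) : posD z -> H z o a b = 2^-1 * (x_ z ^+ 2 *
  (partial a (fun w => cone w o b) z + partial b (fun w => cone w o a) z
   - partial o (fun w => cone w a b) z)).
Proof.
move=> pz; rewrite /H /christoffel big_split_ord big_ord1 /= Voo// big1 ?addr0//.
by move=> d _; rewrite Voh// mul0r.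
Qed.

Let chrh z c (a b : 'I_(1 + n)) : posD z -> H z (h c) a b = 2^-1 * \sum_d
  x_ z ^+ 2 * invmx (G z) c d *
  (partial a (fun w => cone w (h d) b) z + partial b (fun w => cone w (h d) a) z
   - partial (h d) (fun w => cone w a b) z).
Proof.
move=> pz; rewrite /H /christoffel big_split_ord big_ord1 /= Vho// mul0r add0r.
by congr (_ * _); apply: eq_bigr => d _; rewrite Vhh.
Qed.

Let Hooo z : posD z -> H z o o o = - (x_ z)^-1.
Proof.
move=> pz; rewrite chro// !dconeoo// pox.
by case: pz => _ x0; field; rewrite gt_eqF.
Qed.

Let Hooh z a : posD z -> H z o o (h a) = 0.
Proof. by move=> pz; rewrite chro// !dconeoh dconeoo// phx; ring. Qed.

Let Hoho z a : posD z -> H z o (h a) o = 0.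
Proof. by move=> pz; rewrite chro// !dconeoh !dconeho dconeoo// phx; ring. Qed.

Let Hohh z a b : posD z -> H z o (h a) (h b) = P z a b.
Proof.
move=> pz; rewrite chro// !dconeoh dconehh// pox /P /d0.
by case: pz => _ x0; move: (partial _ _ _) => t; field; rewrite gt_eqF.
Qed.

Let Hhoo z c : posD z -> H z (h c) o o = 0.
Proof.
move=> pz; rewrite chrh// big1 ?mulr0// => d _.
by rewrite !dconeho dconeoo// phx; ring.
Qed.

Let Hhoh z c b : posD z -> H z (h c) o (h b) = A z c b.
Proof.
move=> pz; have [Dz x0] := pz; rewrite chrh// /A -(sum_GinvG uG c b Dz).
rewrite shape.unlock !mulr_sumr -sumrB; apply: eq_bigr => d _.
rewrite dconehh// dconeho dconeoh pox /d0; move: (partial _ _ _) => t.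
by field; rewrite gt_eqF.
Qed.

Let Hhho z c b : posD z -> H z (h c) (h b) o = A z c b.
Proof.
move=> pz; rewrite -Hhoh// !chrh//; congr (_ * _); apply: eq_bigr => d _.
by rewrite dconeoh !dconeho add0r addr0.
Qed.

Let Hhhh z c a b : posD z -> H z (h c) (h a) (h b) = hchr G z c a b.
Proof.
move=> pz; have [Dz x0] := pz; rewrite chrh// hchr.unlock; congr (_ * _).
apply: eq_bigr => d _; rewrite !dconehh// !phx /dh.
move: (partial _ _ _) (partial _ _ _) (partial _ _ _) => s t v.
by field; rewrite gt_eqF.
Qed.

Let ricciE z (c b : 'I_(1 + n)) : ricci cone z c b = \sum_a mcurv H z a c a b.
Proof. by rewrite mxE. Qed.

Local Notation tau z := (\sum_a B z a a).
Local Notation G' z a b := (d0 (fun w => G w a b) z).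

Lemma smooth_shape a b : S (fun z => B z a b).
Proof.
rewrite shape.unlock; apply: smooth_sum => // d _.
by apply: smoothM => //; [exact: smooth_Ginv|exact: smooth_d0].
Qed.

(** Codazzi's equation. The part of A in 1/x is a multiple of the identity, whose
    covariant derivative vanishes. *)
Lemma cone_ricci_mixed z b : posD z ->
  ricci cone z o (h b) = 2^-1 * \sum_a (dh a (fun w => B w a b) z - dh b (fun w => B w a a) z
    + \sum_e (hchr G z a a e * B z e b - hchr G z a b e * B z e a)).
Proof.
move=> pz; have [Dz x0] := pz.
have dA k i j : dh k (fun w => A w i j) z = 2^-1 * dh k (fun w => B w i j) z.
  have dB : differentiable (fun w => B w i j) z by exact: dif (smooth_shape i j) Dz.
  have dV : differentiable (fun w => (x_ w)^-1) z.
    by apply: differentiableV; [exact: dif|rewrite gt_eqF].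
  have dc : differentiable (fun _ : E => (i == j)%:R : R) z by exact: differentiable_cst.
  have d1 : differentiable (fun w => 2^-1 * B w i j) z.
    by apply: dif => //; apply: smoothZ => //; exact: smooth_shape.
  have d2 : differentiable (fun w => (x_ w)^-1 * (i == j)%:R) z.
    exact: differentiableM dV dc.
  rewrite /dh (partialB _ d1 d2) (partialZ _ _ dB) (partialM _ dV dc).
  by rewrite partial_cst dxV// phx mulr0 mul0r mulr0 addr0 subr0.
rewrite ricciE (block_ricci_mixed posD_open Hooo Hooh Hoho Hhoo Hhho Hhhh _ pz); last first.
  move=> w pw; rewrite /dh.
  have -> : (fun w => - (x_ w)^-1) = (fun w => -1 * (x_ w)^-1).
    by apply/funext => v; rewrite mulN1r.
  rewrite partialZ ?dxV// ?phx ?mulr0//.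
  by case: pw => Dw w0; apply: differentiableV; [exact: dif|rewrite gt_eqF].
pose T a := 2^-1 * dh a (fun w => B w a b) z - 2^-1 * dh b (fun w => B w a a) z.
pose X a := \sum_e (hchr G z a a e * A z e b - hchr G z a b e * A z e a).
pose Y a := 2^-1 * \sum_e (hchr G z a a e * B z e b - hchr G z a b e * B z e a).
transitivity (\sum_a T a + \sum_a X a).
  by rewrite -big_split; apply: eq_bigr => a _; rewrite !dA.
transitivity (\sum_a T a + \sum_a Y a); last first.
  by rewrite -big_split mulr_sumr; apply: eq_bigr => a _; rewrite mulrDr mulrBr.
congr (_ + _); rewrite /X /Y {T X Y}.
transitivity (\sum_a \sum_e 2^-1 * (hchr G z a a e * B z e b - hchr G z a b e * B z e a)
  - (x_ z)^-1 * (\sum_a \sum_e hchr G z a a e * (e == b)%:R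
                 - \sum_a \sum_e hchr G z a b e * (e == a)%:R)).
  rewrite -sumrB mulr_sumr -sumrB; apply: eq_bigr => a _.
  rewrite -sumrB mulr_sumr -sumrB; apply: eq_bigr => e _.
  by rewrite /A; move: (hchr G z a a e) (hchr G z a b e) => s t; ring.
have -> : \sum_a \sum_e hchr G z a a e * (e == b)%:R = \sum_a hchr G z a a b.
  apply: eq_bigr => a _; rewrite -(sum_delta (hchr G z a a)).
  by apply: eq_bigr => e _; rewrite mulrC eq_sym.
have -> : \sum_a \sum_e hchr G z a b e * (e == a)%:R = \sum_a hchr G z a a b.
  apply: eq_bigr => a _; rewrite (chr_sym Uop symG a a b Dz) -(sum_delta (hchr G z a b)).
  by apply: eq_bigr => e _; rewrite mulrC eq_sym.
rewrite subrr mulr0 subr0; apply: eq_bigr => a _; by rewrite mulr_sumr.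
Qed.

(** The tangential Einstein equation, multiplied by the defining function so as to
    become smooth up to the boundary. *)
Definition einstein_op z c b : R :=
  x_ z * hric (hchr G) z c b - 2^-1 * (x_ z * d0 (d0 (fun w => G w c b)) z)
  + (n%:R - 1) / 2 * G' z c b + 2^-1 * (tau z * G z c b)
  - 4^-1 * (x_ z * (tau z * G' z c b))
  + 2^-1 * (x_ z * \sum_e \sum_f G' z c e * invmx (G z) e f * G' z f b).

Let G'_sym z a b : D z -> G' z a b = G' z b a.
Proof.
have E : eq_on D (fun w => G w a b) (fun w => G w b a).
  by move=> w Dw; exact: (G_sym symG a b Dw).
exact: (partial_eq_on Dop _ E).
Qed.

(** The double poles cancel against n times the metric; the factor x removes the simple
    ones. *)
Lemma cone_ricci_tangent z c b : posD z ->
  x_ z * (ricci cone z (h c) (h b) + n%:R * cone z (h c) (h b)) = einstein_op z c b.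
Proof.
move=> pz; have [Dz x0] := pz; have xn0 : x_ z != 0 by rewrite gt_eqF.
rewrite ricciE (block_ricci_tangent posD_open Hooo Hooh Hoho Hohh Hhoh Hhho Hhhh)//.
have dP : d0 (fun w => P w b c) z = - (x_ z)^-2 * G z b c + (x_ z)^-1 * G' z b c
    - 2^-1 * d0 (d0 (fun w => G w b c)) z.
  have dV : differentiable (fun w => (x_ w)^-1) z.
    by apply: differentiableV => //; exact: dif.
  have dG : differentiable (fun w => G w b c) z by exact: dif.
  have dG' : differentiable (d0 (fun w => G w b c)) z.
    by apply: dif => //; exact: smooth_d0.
  have d1 : differentiable (fun w => (x_ w)^-1 * G w b c) z.
    exact: differentiableM dV dG.
  have d2 : differentiable (fun w => 2^-1 * d0 (fun w => G w b c) w) z.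
    by apply: dif => //; apply: smoothZ => //; exact: smooth_d0.
  rewrite /P {1}/d0 (partialB _ d1 d2) (partialZ _ _ dG') (partialM _ dV dG).
  by rewrite dxV// pox mulr1.
have trA : \sum_a A z a a = 2^-1 * tau z - (x_ z)^-1 * n%:R.
  rewrite /A sumrB -mulr_sumr -mulr_sumr; congr (_ - _ * _).
  rewrite (eq_bigr (fun=> 1)) => [|a _]; last by rewrite eqxx.
  by rewrite sumr_const card_ord.
have GB a e : D z -> \sum_d G z a d * B z d e = G' z a e.
  move=> _; rewrite shape.unlock; under eq_bigr => d _ do rewrite mulr_sumr.
  rewrite exchange_big -[RHS](sum_delta (fun d => G' z d e)); apply: eq_bigr => d _.
  by rewrite -(sum_GGinv uG a d Dz) mulr_suml; apply: eq_bigr => f _; rewrite mulrA.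
pose q i j := \sum_e \sum_f G' z i e * invmx (G z) e f * G' z f j.
have qE i j : \sum_e G' z i e * B z e j = q i j.
  by apply: eq_bigr => e _; rewrite shape.unlock mulr_sumr; apply: eq_bigr => f _; rewrite mulrA.
have q_sym i j : q i j = q j i.
  rewrite /q exchange_big; apply: eq_bigr => e _; apply: eq_bigr => f _.
  by rewrite (G'_sym i f Dz) (G'_sym e j Dz) (Ginv_sym symG f e Dz); ring.
have PA i j : \sum_e P z i e * A z e j =
    (x_ z)^-1 * G' z i j - (x_ z)^-2 * G z i j - 4^-1 * q i j.
  transitivity ((x_ z)^-1 * 2^-1 * (\sum_e G z i e * B z e j)
     - 4^-1 * (\sum_e G' z i e * B z e j)
     - (x_ z)^-2 * (\sum_e (j == e)%:R * G z i e)
     + (x_ z)^-1 * 2^-1 * (\sum_e (j == e)%:R * G' z i e)).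
    rewrite !mulr_sumr -!sumrB -big_split; apply: eq_bigr => e _ /=.
    rewrite /P /A [e == j]eq_sym; move: (G' z i e) (B z e j) ((j == e)%:R) => s t v.
    by field.
  rewrite GB// qE !sum_delta; move: (G' z i j) (q i j) => s t.
  by field.
have -> : \sum_a A z a b * P z a c = \sum_a P z c a * A z a b.
  apply: eq_bigr => a _; rewrite mulrC; congr (_ * _).
  by rewrite /P (G_sym symG a c Dz) (G'_sym a c Dz).
rewrite !PA dP trA /P (q_sym b c) (G'_sym b c Dz) (G_sym symG b c Dz) conehh.
have -> : d0 (d0 (fun w => G w b c)) z = d0 (d0 (fun w => G w c b)) z.
  have E : eq_on D (d0 (fun w => G w b c)) (d0 (fun w => G w c b)).
    by move=> w Dw; exact: G'_sym.
  exact: (partial_eq_on Dop _ E Dz).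
rewrite /einstein_op -/(q c b).
move: (q c b) (tau z) (hric _ z c b) (d0 (d0 _) z) (G' z c b) (G z c b) => s t u v w k.
by field.
Qed.

End ConeMetric.

(** * Expansions of connection and curvature *)

Section Static.
Context {R : realType} {n : nat}.
Local Notation E := 'rV[R]_(1 + n).
Implicit Types (z w : E) (f k : E -> R) (a b c d e : 'I_n).
Variables (U : set 'rV[R]_n) (r : R).
Hypotheses (Uop : open U) (r_gt0 : 0 < r).
Local Notation D := (cyl U r).
Local Notation S := (smooth_on D).
Local Notation eqv := (eqv U r).
Local Notation x_ := (@coord_x R n).
Let Dop : open D := cyl_open Uop.

Definition static f := forall z, f (to0 z) = f z.

Lemma staticE f : static f -> f = f \o to0.
Proof. by move=> st; apply/funext => z /=; rewrite st. Qed.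

Lemma static_to0 f : static (f \o to0).
Proof. by move=> z; exact: (congr1 f (to0_id (coord_to0 z))). Qed.

Lemma static_jet m f : static (jet m f).
Proof. by move=> z; exact: jet_to0. Qed.

Lemma staticM f k : static f -> static k -> static (fun z => f z * k z).
Proof. by move=> sf sk z; rewrite sf sk. Qed.

Lemma static_dh a f : static f -> static (dh a f).
Proof. by move=> /staticE ->; rewrite dh_to0; exact: static_to0. Qed.

Lemma d0_static f : static f -> d0 f = fun=> 0.
Proof. by move=> /staticE ->; exact: d0_to0. Qed.

Lemma d0M_static f k z : S f -> S k -> static k -> D z ->
  d0 (fun w => f w * k w) z = d0 f z * k z.
Proof. by move=> Sf Sk sk Dz; rewrite (d0M Sf Sk Dz) (d0_static sk) mulr0 addr0. Qed.

Lemma d0_xn_static m k z : S k -> static k -> D z ->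
  d0 (fun w => x_ w ^+ m * k w) z = m%:R * x_ z ^+ m.-1 * k z.
Proof.
move=> Sk sk Dz; rewrite (d0M (smooth_xn Uop m) Sk Dz) (d0_static sk).
by rewrite (d0_xn Uop m Dz) mulr0 addr0.
Qed.

Lemma jetM_static m f k z : S f -> S k -> static k -> D z ->
  jet m (fun w => f w * k w) z = jet m f z * k z.
Proof.
move=> Sf Sk sk Dz; have := jetM_to0 Uop r_gt0 m Sf Sk Dz; rewrite sk => <-.
by congr jet; apply/funext => w; rewrite sk.
Qed.

Lemma jet_xn_static m k z : S k -> static k -> D z ->
  jet m (fun w => x_ w ^+ m * k w) z = k z.
Proof.
move=> Sk sk Dz; rewrite -[RHS]sk -(jet_xn Uop r_gt0 m Sk Dz).
by congr jet; apply/funext => w; rewrite sk.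
Qed.

Lemma eqv_sub m f k : eqv m f k -> eqv m (fun z => f z - k z) (fun=> 0).
Proof.
move=> E1; have [Sf Sk _] := E1.
apply: eqv_trans (eqvB Uop E1 (eqv_refl m Sk)) _.
apply: eqv_eq_on => //; last by move=> z _; rewrite subrr.
exact: smoothB.
Qed.

Lemma eqv_addr m f k v : S k -> eqv m (fun z => f z - k z) v ->
  eqv m f (fun z => k z + v z).
Proof.
move=> Sk E1; have := eqvD Uop (eqv_refl m Sk) E1.
by have -> : (fun z => k z + (f z - k z)) = f
  by apply/funext => z; rewrite addrC subrK.
Qed.

Lemma eqv_of_sub m f k : S k -> eqv m (fun z => f z - k z) (fun=> 0) -> eqv m f k.
Proof.
move=> Sk /(eqv_addr Sk).
by have -> : (fun z => k z + 0) = k by apply/funext => z; rewrite addr0.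
Qed.

Lemma eqv_even_step m f k : odd m ->
  (forall z, D z -> f (refl z) = f z) -> (forall z, D z -> k (refl z) = k z) ->
  eqv m f k -> eqv m.+1 f k.
Proof.
move=> om ef ek E1; have [_ Sk _] := E1.
apply: (eqv_of_sub Sk); apply: (eqv_even Uop r_gt0) om (eqv_sub E1).
by move=> z Dz; rewrite ef// ek.
Qed.

(** X^-1 - Y^-1 = X^-1 (Y - X) Y^-1. *)
Lemma eqv_invmx q m (X Y : E -> 'M[R]_q) :
  (forall i j, eqv m (fun z => X z i j) (fun z => Y z i j)) ->
  (forall z, D z -> X z \in unitmx) -> (forall z, D z -> Y z \in unitmx) ->
  forall i j, eqv m (fun z => invmx (X z) i j) (fun z => invmx (Y z) i j).
Proof.
move=> XY uX uY i j.
have SX (a b : 'I_q) : S (fun z => X z a b) by have [] := XY a b.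
have SY (a b : 'I_q) : S (fun z => Y z a b) by have [] := XY a b.
have SiX := smooth_invmx Dop SX uX; have SiY := smooth_invmx Dop SY uY.
pose T (Z : E -> 'M[R]_q) z := \sum_(b < q) (\sum_(a < q) invmx (X z) i a * Z z a b) * invmx (Y z) b j.
have TE (Z : E -> 'M[R]_q) z : T Z z = (invmx (X z) *m Z z *m invmx (Y z)) i j.
  by rewrite mxE; apply: eq_bigr => b _; rewrite mxE.
have ST (Z : E -> 'M[R]_q) : (forall a b : 'I_q, S (fun z => Z z a b)) -> S (T Z).
  move=> SZ; apply: smooth_sum => // b _; apply: smoothM => //.
  by apply: smooth_sum => // a _; apply: smoothM.
apply: (@eqv_trans _ _ _ _ _ _ (T Y)).
  by apply: eqv_eq_on => // z Dz; rewrite TE mulmxK// uY.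
apply: (@eqv_trans _ _ _ _ _ _ (T X)).
  apply: eqv_sum => // b; apply: eqvM => //.
  apply: eqv_sum => // a; apply: eqvM => //; exact: eqv_sym.
by apply: eqv_eq_on; [|exact: ST|move=> z Dz; rewrite TE mulVmx ?uX// mul1mx].
Qed.

Lemma eqv_hchr m (X Y : E -> 'M[R]_n) :
  (forall i j, eqv m (fun z => X z i j) (fun z => Y z i j)) ->
  (forall z, D z -> X z \in unitmx) -> (forall z, D z -> Y z \in unitmx) ->
  forall c a b, eqv m (fun z => hchr X z c a b) (fun z => hchr Y z c a b).
Proof.
move=> XY uX uY c a b; rewrite hchr.unlock; apply: eqvZ => //.
apply: eqv_sum => // d; apply: eqvM => //; first exact: eqv_invmx.
by apply: eqvB => //; [apply: eqvD => //|]; apply: eqv_dh.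
Qed.

Lemma eqv_hric m (X Y : E -> 'I_n -> 'I_n -> 'I_n -> R) :
  (forall c a b, eqv m (fun z => X z c a b) (fun z => Y z c a b)) ->
  forall c b, eqv m (fun z => hric X z c b) (fun z => hric Y z c b).
Proof.
move=> XY c b; apply: eqv_sum => // a; rewrite curv.unlock; apply: eqvD => //.
  by apply: eqvB => //; apply: eqv_dh.
by apply: eqv_sum => // e; apply: eqvB => //; apply: eqvM.
Qed.

End Static.

(** * The first undetermined coefficient *)

(** Twice the mixed component of the Ricci tensor of the cone metric. *)
Definition mixed_op (R : realType) (n : nat) (G : 'rV[R]_(1 + n) -> 'M[R]_n)
    (z : 'rV[R]_(1 + n)) (b : 'I_n) : R :=
  \sum_a (dh a (fun w => shape G w a b) z - dh b (fun w => shape G w a a) z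
    + \sum_e (hchr G z a a e * shape G z e b - hchr G z a b e * shape G z e a)).

Section Expansion.
Context {R : realType} {n : nat}.
Local Notation E := 'rV[R]_(1 + n).
Implicit Types (z w : E) (f k : E -> R) (a b c d e : 'I_n).
Variables (U : set 'rV[R]_n) (r : R).
Hypotheses (Uop : open U) (r_gt0 : 0 < r).
Local Notation D := (cyl U r).
Local Notation S := (smooth_on D).
Local Notation eqv := (eqv U r).
Local Notation x_ := (@coord_x R n).
Let Dop : open D := cyl_open Uop.

Variable G : E -> 'M[R]_n.
Hypothesis SG : forall a b, S (fun z => G z a b).
Hypothesis symG : forall z, D z -> (G z)^T = G z.
Hypothesis uG : forall z, D z -> G z \in unitmx.

Let g z := G (to0 z).
Variable K : E -> 'I_n -> R.
Hypothesis SK : forall a, S (fun z => K z a).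
Hypothesis stK : forall a, static (fun z => K z a).
Hypothesis dK : forall z a b, D z ->
  dh a (fun w => K w b) z = - \sum_c hchr g z b a c * K z c.
Local Notation L := (Klow g K).
Hypothesis LK : forall z, D z -> \sum_a L z a * K z a = 0.
Variable rho : E -> R.
Hypothesis Srho : S rho.
Hypothesis ric_g : forall z c b, D z -> hric (hchr g) z c b = rho z * L z c * L z b.

Lemma Sg a b : S (fun z => g z a b).
Proof. exact: (smooth_to0 Uop r_gt0 (SG a b)). Qed.

Lemma symg z : D z -> (g z)^T = g z.
Proof. by move=> Dz; apply: symG; exact: cyl_to0. Qed.

Lemma ug z : D z -> g z \in unitmx.
Proof. by move=> Dz; apply: uG; exact: cyl_to0. Qed.

Lemma stg a b : static (fun z => g z a b).
Proof. exact: (static_to0 (fun z => G z a b)). Qed.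

Lemma g_to0 z : g (to0 z) = g z.
Proof. exact: (congr1 G (to0_id (coord_to0 z))). Qed.

Lemma SL a : S (fun z => L z a).
Proof. exact: (smooth_Klow Uop Sg SK). Qed.

Lemma stL a : static (fun z => L z a).
Proof.
move=> z; rewrite -!KlowE g_to0; apply: eq_bigr => b _.
by rewrite (stK b z).
Qed.

Local Notation LL a b := (fun z => L z a * L z b).

Lemma SLL a b : S (LL a b).
Proof. by apply: (smoothM Dop); exact: SL. Qed.

Lemma stLL a b : static (LL a b).
Proof. exact: (staticM (stL a) (stL b)). Qed.

Lemma Sginv a b : S (fun z => invmx (g z) a b).
Proof. exact: (smooth_invmx Dop Sg ug). Qed.

Variables (psi : E -> R) (p : nat).
Hypothesis Spsi : S psi.
Hypothesis psi1 : eqv 1 psi (fun=> 0).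
Hypothesis Kpsi : forall z, D z -> \sum_a K z a * dh a psi z = 0.
Local Notation Gt := (pmet g K psi).
Hypothesis Gm : forall a b, eqv p.+2 (fun z => G z a b) (fun z => Gt z a b).

(** The first coefficient in which the family of metrics may fail to be a wave. *)
Definition lead a b : E -> R := jet p.+2 (fun w => G w a b - Gt w a b).
Local Notation H := lead.
Local Notation m := (p.+2%:R : R).

Let SGt a b : S (fun z => Gt z a b).
Proof. exact: (smooth_pmet Uop Sg SK Spsi). Qed.

Lemma SH a b : S (H a b).
Proof. by apply: (smooth_jet Uop r_gt0); exact: (smoothB Dop (SG a b) (SGt a b)). Qed.

Lemma stH a b : static (H a b).
Proof. exact: static_jet. Qed.

Let GtE a b : (fun z => Gt z a b) = (fun z => g z a b + psi z * (L z a * L z b)).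
Proof. by apply/funext => z; rewrite mxE mulrA. Qed.

Lemma G_exp a b : eqv p.+3 (fun z => G z a b)
  (fun z => Gt z a b + x_ z ^+ p.+2 * H a b z).
Proof. exact: (eqv_addr Uop (SGt a b) (eqv_jet Uop r_gt0 (eqv_sub Uop (Gm a b)))). Qed.

Let T a b z := d0 psi z * (L z a * L z b) + x_ z ^+ p.+1 * (m * H a b z).

Let SmH a b : S (fun z => m * H a b z).
Proof. exact: (smoothZ Dop m (SH a b)). Qed.
Let stmH a b : static (fun z => m * H a b z).
Proof. by move=> z; rewrite stH. Qed.

Lemma dG_exp a b : eqv p.+2 (d0 (fun z => G z a b)) (T a b).
Proof.
apply: eqv_trans (eqv_d0 (G_exp a b)) _.
have Sx : S (fun z => x_ z ^+ p.+2 * H a b z).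
  exact: (smoothM Dop (smooth_xn Uop p.+2) (SH a b)).
have SpL : S (fun z => psi z * (L z a * L z b)) by exact: (smoothM Dop Spsi (SLL a b)).
apply: (eqv_eq_on Uop).
  exact: (smooth_d0 (smoothD Dop (SGt a b) Sx)).
move=> z Dz; rewrite (d0D (SGt a b) Sx Dz) GtE (d0D (Sg a b) SpL Dz).
rewrite (d0_static (stg a b)) (d0M_static Spsi (SLL a b) (stLL a b) Dz).
by rewrite (d0_xn_static Uop p.+2 (SH a b) (stH a b) Dz) /T add0r; ring.
Qed.

Lemma xddG_exp a b : eqv p.+2 (fun z => x_ z * d0 (d0 (fun z => G z a b)) z)
  (fun z => x_ z * d0 (d0 psi) z * (L z a * L z b)
            + x_ z ^+ p.+1 * (m * (m - 1) * H a b z)).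
Proof.
apply: eqv_trans (eqv_x Uop (eqv_d0 (dG_exp a b))) _.
have S1 : S (fun z => d0 psi z * (L z a * L z b)).
  exact: (smoothM Dop (smooth_d0 Spsi) (SLL a b)).
have S2 : S (fun z => x_ z ^+ p.+1 * (m * H a b z)).
  exact: (smoothM Dop (smooth_xn Uop p.+1) (SmH a b)).
apply: (eqv_eq_on Uop).
  apply: (smoothM Dop (smooth_coord_x Uop)).
  exact: (smooth_d0 (smoothD Dop S1 S2)).
move=> z Dz; rewrite (d0D S1 S2 Dz).
rewrite (d0M_static (smooth_d0 Spsi) (SLL a b) (stLL a b) Dz).
rewrite (d0_xn_static Uop p.+1 (SmH a b) (stmH a b) Dz) /= exprS.
have -> : m - 1 = p.+1%:R by rewrite -[p.+2]addn1 natrD addrK.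
by move: (d0 (d0 psi) z) (H a b z) (x_ z) (_ ^+ p) (p.+2%:R : R) (p.+1%:R : R) => *; ring.
Qed.

Lemma uGt z : D z -> Gt z \in unitmx.
Proof. by move=> Dz; have [] := pmet_unit symg ug LK psi Dz. Qed.

Lemma Ginv_exp a b : eqv p.+2 (fun z => invmx (G z) a b)
  (fun z => invmx (g z) a b - psi z * K z a * K z b).
Proof.
apply: eqv_trans (eqv_invmx Uop Gm uG uGt a b) _.
apply: (eqv_eq_on Uop); first exact: (smooth_invmx Dop SGt uGt).
by move=> z Dz; have [_ ->] := pmet_unit symg ug LK psi Dz.
Qed.

Definition trH z : R := \sum_a \sum_d invmx (g z) a d * H d a z.

Lemma StrH : S trH.
Proof.
apply: (smooth_sum Dop) => a _; apply: (smooth_sum Dop) => d _.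
exact: (smoothM Dop (Sginv a d) (SH d a)).
Qed.

Lemma sttrH : static trH.
Proof.
move=> z; apply: eq_bigr => a _; apply: eq_bigr => d _.
by rewrite g_to0 stH.
Qed.

Local Notation tau := (fun z => \sum_a shape G z a a).

(** The wave part is trace-free as K and L are orthogonal; the product of psi with the new
    coefficient is of higher order as psi vanishes on the slice. *)
Lemma tau_exp : eqv p.+2 tau (fun z => x_ z ^+ p.+1 * (m * trH z)).
Proof.
pose Y z := m * \sum_a \sum_d K z a * K z d * H d a z.
have SY : S Y.
  apply: (smoothZ Dop); apply: (smooth_sum Dop) => a _; apply: (smooth_sum Dop) => d _.
  exact: (smoothM Dop (smoothM Dop (SK a) (SK d)) (SH d a)).
have E1 : eqv p.+2 tau (fun z => \sum_a \sum_d
    (invmx (g z) a d - psi z * K z a * K z d) * T d a z).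
  rewrite shape.unlock; apply: (eqv_sum Uop) => a; apply: (eqv_sum Uop) => d.
  exact: (eqvM Uop (Ginv_exp a d) (dG_exp d a)).
have [_ SE1 _] := E1; apply: (eqv_trans E1).
have E2 : eqv p.+2 (fun z => x_ z ^+ p.+1 * (psi z * Y z)) (fun=> 0).
  have := eqv_xn Uop p.+1 (eqvM Uop psi1 (eqv_refl 1 SY)); rewrite addn1 => E2.
  apply: (eqv_trans E2); apply: (eqv_eq_on Uop); first by case: E2.
  by move=> z _; rewrite mul0r mulr0.
have E3 := eqvB Uop (eqv_refl p.+2 (smoothM Dop (smooth_xn Uop p.+1)
  (smoothZ Dop m StrH))) E2.
have [S3 S4 _] := E3.
apply: (@eqv_trans _ _ _ _ _ _ (fun z => x_ z ^+ p.+1 * (m * trH z) -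
    x_ z ^+ p.+1 * (psi z * Y z))); last first.
  apply: (eqv_trans E3); apply: (eqv_eq_on Uop) => // z _.
  by rewrite subr0.
apply: (eqv_eq_on Uop) => // z Dz.
have KL : \sum_a K z a * L z a = 0.
  by rewrite -[RHS](LK Dz); apply: eq_bigr => a _; rewrite mulrC.
have termE a : \sum_d (invmx (g z) a d - psi z * K z a * K z d) * T d a z =
    d0 psi z * (K z a * L z a)
    + x_ z ^+ p.+1 * m * (\sum_d invmx (g z) a d * H d a z)
    - x_ z ^+ p.+1 * psi z * m * (\sum_d K z a * K z d * H d a z).
  transitivity (d0 psi z * L z a * (\sum_d invmx (g z) a d * L z d)
      - psi z * K z a * d0 psi z * L z a * (\sum_d L z d * K z d)
      + x_ z ^+ p.+1 * m * (\sum_d invmx (g z) a d * H d a z)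
      - x_ z ^+ p.+1 * psi z * m * (\sum_d K z a * K z d * H d a z)).
    rewrite !mulr_sumr -!sumrN -!big_split; apply: eq_bigr => d _ /=.
    by rewrite /T; move: (H d a z) (d0 psi z) (invmx _ a d) (p.+2%:R : R) (_ ^+ _) => *; ring.
  by rewrite (raise_L ug K a Dz) (LK Dz) mulr0 subr0 mulrAC -[d0 psi z * _ * _]mulrA.
rewrite (eq_bigr _ (fun a _ => termE a)) sumrB big_split /=.
rewrite -!mulr_sumr KL mulr0 add0r /trH /Y.
by move: (p.+2%:R : R) (\sum_a _) (\sum_a _) (_ ^+ _) => *; ring.
Qed.

Lemma eqv_mul0 q f k : S k -> eqv q f (fun=> 0) -> eqv q (fun z => f z * k z) (fun=> 0).
Proof.
move=> Sk Ef; have E1 := eqvM Uop Ef (eqv_refl q Sk); apply: (eqv_trans E1).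
by apply: (eqv_eq_on Uop); [case: E1|move=> z _; rewrite mul0r].
Qed.

Lemma eqv_x0 q f : eqv q f (fun=> 0) -> eqv q.+1 (fun z => x_ z * f z) (fun=> 0).
Proof.
move=> Ef; have E1 := eqv_x Uop Ef; apply: (eqv_trans E1).
by apply: (eqv_eq_on Uop); [case: E1|move=> z _; rewrite mulr0].
Qed.

Lemma smooth_xk k q : S k -> S (fun z => x_ z ^+ q * k z).
Proof. by move=> Sk; exact: (smoothM Dop (smooth_xn Uop q) Sk). Qed.

Lemma eqv_xk0 k q : S k -> eqv q (fun z => x_ z ^+ q * k z) (fun=> 0).
Proof. by move=> Sk; exact: (eqv_xn0 Uop q Sk Sk). Qed.

Lemma xtaudG_exp c b :
  eqv p.+2 (fun z => x_ z * ((\sum_a shape G z a a) * d0 (fun w => G w c b) z)) (fun=> 0).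
Proof.
apply: eqv_x0; apply: eqv_mul0; first exact: (smooth_d0 (SG c b)).
apply: (eqv_trans (eqv_le (leqnSn _) tau_exp)).
exact: (eqv_xk0 _ (smoothZ Dop m StrH)).
Qed.

Lemma tauG_exp c b : eqv p.+2 (fun z => (\sum_a shape G z a a) * G z c b)
  (fun z => x_ z ^+ p.+1 * (m * trH z * g z c b)).
Proof.
apply: (eqv_trans (eqvM Uop tau_exp (eqv_refl _ (SG c b)))).
have Gg : eqv 1 (fun z => G z c b) (fun z => g z c b).
  split; [exact: SG|exact: Sg|move=> j z].
  by rewrite ltnS leqn0 => /eqP -> Dz z0; rewrite /= /g (to0_id z0).
have E1 := eqv_xn Uop p.+1 (eqvM Uop (eqv_refl 1 (smoothZ Dop m StrH)) Gg).
rewrite addn1 in E1.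
apply: eqv_trans E1; apply: (eqv_eq_on Uop); last by move=> z _; rewrite -[LHS]mulrA.
exact: (smoothM Dop (smooth_xk _ (smoothZ Dop m StrH)) (SG c b)).
Qed.

(** The square of L L is zero. *)
Lemma xquad_exp c b : eqv p.+2 (fun z => x_ z * \sum_e \sum_i
    d0 (fun w => G w c e) z * invmx (G z) e i * d0 (fun w => G w i b) z) (fun=> 0).
Proof.
apply: eqv_x0.
pose V e i z := invmx (g z) e i - psi z * K z e * K z i.
have E1 a d : eqv p.+1 (d0 (fun w => G w a d)) (fun z => d0 psi z * (L z a * L z d)).
  apply: (eqv_trans (eqv_le (leqnSn _) (dG_exp a d))).
  have S1 : S (fun z => d0 psi z * (L z a * L z d)).
    exact: (smoothM Dop (smooth_d0 Spsi) (SLL a d)).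
  have E2 := eqvD Uop (eqv_refl p.+1 S1) (eqv_xk0 p.+1 (SmH a d)).
  apply: (eqv_trans E2); apply: (eqv_eq_on Uop); first by case: E2.
  by move=> z _; rewrite addr0.
have E2 : eqv p.+1 (fun z => \sum_e \sum_i
    d0 (fun w => G w c e) z * invmx (G z) e i * d0 (fun w => G w i b) z)
   (fun z => \sum_e \sum_i (d0 psi z * (L z c * L z e)) * V e i z *
                           (d0 psi z * (L z i * L z b))).
  apply: (eqv_sum Uop) => e; apply: (eqv_sum Uop) => i.
  exact: (eqvM Uop (eqvM Uop (E1 c e) (eqv_le (leqnSn _) (Ginv_exp e i))) (E1 i b)).
apply: (eqv_trans E2); apply: (eqv_eq_on Uop); first by case: E2.
move=> z Dz.
have termE e : \sum_i (d0 psi z * (L z c * L z e)) * V e i z * (d0 psi z * (L z i * L z b)) =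
    d0 psi z * L z c * d0 psi z * L z b * (L z e * K z e).
  transitivity (d0 psi z * (L z c * L z e) * d0 psi z * L z b *
     (\sum_i invmx (g z) e i * L z i - psi z * K z e * (\sum_i L z i * K z i))).
    rewrite mulrBr !mulr_sumr -sumrB; apply: eq_bigr => i _.
    by rewrite /V; move: (d0 psi z) (invmx _ e i) => *; ring.
  rewrite (raise_L ug K e Dz) (LK Dz); move: (d0 psi z) => *; ring.
by rewrite (eq_bigr _ (fun e _ => termE e)) -mulr_sumr (LK Dz) mulr0.
Qed.

(** All the terms that come from the wave itself are multiples of L L. The new coefficient
    enters through -x G''/2 and (n - 1) G'/2, which add up to the indicial factor
    m (n - m) / 2, and through the trace term. *)
Lemma einstein_exp : exists2 al, S al & forall c b,
  eqv p.+2 (fun z => einstein_op G z c b)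
    (fun z => al z * (L z c * L z b)
      + x_ z ^+ p.+1 * (2^-1 * m * (n%:R - m) * H c b z + 2^-1 * m * trH z * g z c b)).
Proof.
have [sg Ssg Hsg] := hric_pmet_multiple Uop Sg symg ug SK dK LK Spsi Kpsi.
pose al z := x_ z * (rho z + sg z) - 2^-1 * (x_ z * d0 (d0 psi) z)
  + (n%:R - 1) / 2 * d0 psi z.
have Sx : S x_ := smooth_coord_x Uop.
have Sal : S al.
  apply: (smoothD Dop); last exact: (smoothZ Dop _ (smooth_d0 Spsi)).
  apply: (smoothB Dop); first exact: (smoothM Dop Sx (smoothD Dop Srho Ssg)).
  exact: (smoothZ Dop _ (smoothM Dop Sx (smooth_d0 (smooth_d0 Spsi)))).
exists al => // c b.
have E1 : eqv p.+2 (fun z => x_ z * hric (hchr G) z c b)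
    (fun z => x_ z * ((rho z + sg z) * (L z c * L z b))).
  have E0 := eqv_hric Uop r_gt0 (eqv_hchr Uop r_gt0 Gm uG uGt) c b.
  apply: (eqv_trans (eqvM Uop (eqv_refl _ Sx) E0)).
  apply: (eqv_eq_on Uop); first by apply: (smoothM Dop Sx); case: E0.
  by move=> z Dz; rewrite Hsg// ric_g//; move: (rho z) (sg z) => *; ring.
have E2 := eqvZ Uop 2^-1 (xddG_exp c b).
have E3 := eqvZ Uop ((n%:R - 1) / 2) (dG_exp c b).
have E4 := eqvZ Uop 2^-1 (tauG_exp c b).
have E5 := eqvZ Uop 4^-1 (xtaudG_exp c b).
have E6 := eqvZ Uop 2^-1 (xquad_exp c b).
have E := eqvD Uop (eqvB Uop (eqvD Uop (eqvD Uop (eqvB Uop E1 E2) E3) E4) E5) E6.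
apply: (eqv_trans E); apply: (eqv_eq_on Uop); first by case: E.
move=> z Dz; rewrite /al /T.
move: (rho z) (sg z) (d0 (d0 psi) z) (d0 psi z) (H c b z) (trH z) (g z c b) (x_ z ^+ p.+1)
  (x_ z) (n%:R : R) (p.+2%:R : R) (L z c) (L z b) => *.
by field.
Qed.

Lemma ginv_trace z (Y : 'I_n -> 'I_n -> R) (al be ga : R) :
  D z -> \sum_a \sum_d invmx (g z) a d * (al * (L z d * L z a) + (be * Y d a + ga * g z d a)) =
  be * (\sum_a \sum_d invmx (g z) a d * Y d a) + ga * n%:R.
Proof.
move=> Dz.
have termE a : \sum_d invmx (g z) a d * (al * (L z d * L z a) + (be * Y d a + ga * g z d a)) =
    al * (L z a * K z a) + be * (\sum_d invmx (g z) a d * Y d a) + ga * 1.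
  transitivity (al * L z a * (\sum_d invmx (g z) a d * L z d)
      + be * (\sum_d invmx (g z) a d * Y d a) + ga * (\sum_d invmx (g z) a d * g z d a)).
    rewrite !mulr_sumr -!big_split; apply: eq_bigr => d _ /=.
    by move: (invmx _ a d) => t; ring.
  by rewrite (raise_L ug K a Dz) (sum_GinvG ug a a Dz) eqxx -mulrA.
rewrite (eq_bigr _ (fun a _ => termE a)) !big_split /= -mulr_sumr (LK Dz) mulr0 add0r.
by rewrite -mulr_sumr -mulr_sumr sumr_const card_ord.
Qed.

Lemma jet_einstein : exists2 al, S al & static al /\ forall c b z, D z ->
  jet p.+1 (fun w => einstein_op G w c b) z =
  al z * (L z c * L z b)
  + (2^-1 * m * (n%:R - m) * H c b z + 2^-1 * m * trH z * g z c b).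
Proof.
have [al Sal Eal] := einstein_exp.
exists (jet p.+1 al); first exact: (smooth_jet Uop r_gt0).
split=> [|c b z Dz]; first exact: static_jet.
rewrite (jet_eqv r_gt0 (Eal c b) (ltnSn _) Dz).
have SW : S (fun z => 2^-1 * m * (n%:R - m) * H c b z + 2^-1 * m * trH z * g z c b).
  apply: (smoothD Dop); first exact: (smoothZ Dop _ (SH c b)).
  exact: (smoothM Dop (smoothZ Dop _ StrH) (Sg c b)).
rewrite (jetD Uop r_gt0 p.+1 (smoothM Dop Sal (SLL c b)) (smooth_xk p.+1 SW) Dz).
rewrite (jetM_static Uop r_gt0 p.+1 Sal (SLL c b) (stLL c b) Dz).
rewrite (jet_xn_static Uop r_gt0 p.+1 SW _ Dz)// => w.
by rewrite (stH c b) sttrH (stg c b).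
Qed.

Lemma m_neq0 : m != 0. Proof. by rewrite pnatr_eq0. Qed.

(** Below the critical order neither the indicial factor n - m nor the factor 2 n - m of
    the trace vanishes. *)
Lemma lead_multiple : (p.+2 < n)%N ->
  (forall c b, eqv n.-1 (fun z => einstein_op G z c b) (fun=> 0)) ->
  exists2 phi, S phi & static phi /\ forall c b z, D z ->
    H c b z = phi z * (L z c * L z b).
Proof.
move=> pn Ein; have [al Sal [stal Eal]] := jet_einstein.
have nm : (n%:R - m : R) != 0.
  by rewrite subr_eq0 eqr_nat gtn_eqF.
have n1 : (p.+1 < n.-1)%N by case: (n) pn.
have Z c b z : D z -> al z * (L z c * L z b)
    + (2^-1 * m * (n%:R - m) * H c b z + 2^-1 * m * trH z * g z c b) = 0.
  move=> Dz; rewrite -Eal// (jet_eqv r_gt0 (Ein c b) n1 Dz).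
  by rewrite /jet iter_cst /= mulr0.
have tr0 z : D z -> trH z = 0.
  move=> Dz.
  have := @ginv_trace z (fun d a => H d a z) (al z)
    (2^-1 * m * (n%:R - m)) (2^-1 * m * trH z) Dz.
  rewrite big1; last first.
    by move=> a _; rewrite big1// => d _; rewrite Z// mulr0.
  rewrite -/(trH z) => /esym tE.
  have : 2^-1 * m * (2 * n%:R - m) * trH z = 0 by rewrite -[RHS]tE; ring.
  move/eqP; rewrite !mulf_eq0 invr_eq0 pnatr_eq0 /= (negPf m_neq0) /=.
  rewrite subr_eq0 -natrM eqr_nat gtn_eqF/=; first by move/eqP.
  by rewrite mul2n -addnn; apply: ltn_addr.
exists (fun z => - (2^-1 * m * (n%:R - m))^-1 * al z); first exact: (smoothZ Dop).
split=> [z|c b z Dz]; first by rewrite stal.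
have := Z c b z Dz; rewrite tr0// mulr0 mul0r addr0 => /eqP.
rewrite addrC addr_eq0 => /eqP E1.
have c0 : 2^-1 * m * (n%:R - m) != 0.
  by rewrite !mulf_neq0 ?m_neq0// invr_eq0 pnatr_eq0.
apply: (mulfI c0); rewrite E1; move: (2^-1 * m * _) c0 => q q0.
by move: (al z) => t; field.
Qed.

(** At the critical order the indicial factor vanishes, so that the trace of the equation
    only contains the trace of the new coefficient. *)
Lemma trH_critical : p.+2 = n ->
  (forall z, D z ->
     \sum_a \sum_d invmx (g z) a d * jet n.-1 (fun w => einstein_op G w d a) z = 0) ->
  forall z, D z -> trH z = 0.
Proof.
move=> pn trf z Dz; have [al Sal [stal Eal]] := jet_einstein.
have := @ginv_trace z (fun d a => H d a z) (al z)
    (2^-1 * m * (n%:R - m)) (2^-1 * m * trH z) Dz.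
have n1 : n.-1 = p.+1 by rewrite -pn.
have := trf z Dz; rewrite n1.
rewrite (eq_bigr (fun a => \sum_d invmx (g z) a d * (al z * (L z d * L z a) +
  (2^-1 * m * (n%:R - m) * H d a z + 2^-1 * m * trH z * g z d a)))); last first.
  by move=> a _; apply: eq_bigr => d _; rewrite Eal.
move=> -> /esym; rewrite -/(trH z) -pn subrr !(mulr0, mul0r) add0r => /eqP.
by rewrite !mulf_eq0 invr_eq0 (negPf m_neq0) !orbF pnatr_eq0 /= => /eqP.
Qed.

Variable phi : E -> R.
Hypothesis Sphi : S phi.
Hypothesis stphi : static phi.
Hypothesis Hphi : forall c b z, D z -> H c b z = phi z * (L z c * L z b).

(** By [shape_exp] the endomorphism g_x^-1 g_x' is theta K L modulo x^(p+2). *)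
Let theta z := d0 psi z + x_ z ^+ p.+1 * (m * phi z).

Let Stheta : S theta.
Proof.
apply: (smoothD Dop (smooth_d0 Spsi)); apply: smooth_xk.
exact: (smoothZ Dop).
Qed.

Lemma shape_exp a b :
  eqv p.+2 (fun z => shape G z a b) (fun z => theta z * (K z a * L z b)).
Proof.
have E1 : eqv p.+2 (fun z => shape G z a b) (fun z => \sum_d
    (invmx (g z) a d - psi z * K z a * K z d) * T d b z).
  rewrite shape.unlock; apply: (eqv_sum Uop) => d.
  exact: (eqvM Uop (Ginv_exp a d) (dG_exp d b)).
apply: (eqv_trans E1); apply: (eqv_eq_on Uop); first by case: E1.
move=> z Dz.
transitivity (theta z * L z b * (\sum_d invmx (g z) a d * L z d
    - psi z * K z a * (\sum_d L z d * K z d))).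
  rewrite mulrBr !mulr_sumr -sumrB; apply: eq_bigr => d _.
  rewrite /T /theta Hphi//; move: (invmx _ a d) (d0 psi z) (p.+2%:R : R) (x_ z ^+ p.+1) => *.
  by ring.
by rewrite (raise_L ug K a Dz) (LK Dz) mulr0 subr0; ring.
Qed.

(** K does not depend on x, so K psi = 0 may be differentiated in x. *)
Lemma K_dtheta z : D z ->
  \sum_a K z a * dh a theta z = x_ z ^+ p.+1 * (m * \sum_a K z a * dh a phi z).
Proof.
move=> Dz.
have K0 : \sum_a K z a * dh a (d0 psi) z = 0.
  have Zero : eq_on D (fun w => \sum_a K w a * dh a psi w) (fun=> 0) by exact: Kpsi.
  have := partial_eq_on Dop (lshift n ord0) Zero Dz; rewrite partial_cst.
  have dKp a : differentiable (fun w => dh a psi w * K w a) z.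
    exact: (smooth_diff (smoothM Dop (smooth_dh a Spsi) (SK a)) Dz).
  have -> : (fun w => \sum_a K w a * dh a psi w) = (fun w => \sum_a dh a psi w * K w a).
    by apply/funext => w; apply: eq_bigr => a _; rewrite mulrC.
  rewrite partial_sum// => H0; rewrite -[RHS]H0; apply: eq_bigr => a _.
  rewrite -/(d0 _ z) (d0M_static (smooth_dh a Spsi) (SK a) (stK a) Dz).
  have C : dh a (d0 psi) z = d0 (dh a psi) z.
    exact: (partialC Dop (rshift 1 a) (lshift n ord0) Spsi Dz).
  by rewrite C mulrC.
have dth a : dh a theta z = dh a (d0 psi) z + x_ z ^+ p.+1 * (m * dh a phi z).
  have d1 : differentiable (d0 psi) z by exact: (smooth_diff (smooth_d0 Spsi) Dz).
  have d2 : differentiable (fun w => x_ w ^+ p.+1) z.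
    exact: (smooth_diff (smooth_xn Uop p.+1) Dz).
  have d3 : differentiable (fun w => m * phi w) z.
    exact: (smooth_diff (smoothZ Dop m Sphi) Dz).
  have d4 : differentiable phi z by exact: (smooth_diff Sphi Dz).
  have d5 : differentiable (fun w => x_ w ^+ p.+1 * (m * phi w)) z.
    exact: (smooth_diff (smooth_xk p.+1 (smoothZ Dop m Sphi)) Dz).
  rewrite /dh /theta (partialD _ d1 d5) (partialM _ d2 d3) (partialZ _ _ d4).
  by rewrite -[partial _ (fun w => x_ w ^+ p.+1) z]/(dh a _ z) (dh_xn Uop a p.+1 Dz) mul0r add0r.
rewrite (eq_bigr (fun a => K z a * dh a (d0 psi) z
    + x_ z ^+ p.+1 * (m * (K z a * dh a phi z)))); last first.
  by move=> a _; rewrite dth; move: (dh a _ z) (dh a _ z) (p.+2%:R : R) => *; ring.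
by rewrite big_split /= K0 add0r !mulr_sumr.
Qed.

(** The divergence of theta K L for a parallel K is (K theta) L. *)
Lemma mixed_exp b : eqv p.+2 (fun z => mixed_op G z b)
  (fun z => x_ z ^+ p.+1 * (m * (\sum_a K z a * dh a phi z) * L z b)).
Proof.
have E1 : eqv p.+2 (fun z => mixed_op G z b) (fun z =>
   \sum_a (dh a (fun w => theta w * (K w a * L w b)) z
           - dh b (fun w => theta w * (K w a * L w a)) z
    + \sum_e (hchr Gt z a a e * (theta z * (K z e * L z b))
              - hchr Gt z a b e * (theta z * (K z e * L z a))))).
  have Eh := eqv_hchr Uop r_gt0 Gm uG uGt.
  apply: (eqv_sum Uop) => a; apply: (eqvD Uop).
    apply: (eqvB Uop); apply: (eqv_dh Uop r_gt0); exact: shape_exp.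
  apply: (eqv_sum Uop) => e; apply: (eqvB Uop).
    exact: (eqvM Uop (Eh a a e) (shape_exp e b)).
  exact: (eqvM Uop (Eh a b e) (shape_exp e a)).
apply: (eqv_trans E1); apply: (eqv_eq_on Uop); first by case: E1.
move=> z Dz.
have SKL a c : S (fun w => K w a * L w c) by exact: (smoothM Dop (SK a) (SL c)).
have dtKL a c : differentiable (fun w => theta w * (K w a * L w c)) z.
  exact: (smooth_diff (smoothM Dop Stheta (SKL a c)) Dz).
have dt : differentiable theta z by exact: (smooth_diff Stheta Dz).
have dKL a c : differentiable (fun w => K w a * L w c) z.
  exact: (smooth_diff (SKL a c) Dz).
have dK' a : differentiable (fun w => K w a) z by exact: (smooth_diff (SK a) Dz).
have dL c : differentiable (fun w => L w c) z by exact: (smooth_diff (SL c) Dz).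
have KL w : D w -> \sum_a K w a * L w a = 0.
  by move=> Dw; rewrite -[RHS](LK Dw); apply: eq_bigr => a _; rewrite mulrC.
have tr0 : \sum_a dh b (fun w => theta w * (K w a * L w a)) z = 0.
  have Zero : eq_on D (fun w => \sum_a theta w * (K w a * L w a)) (fun=> 0).
    by move=> w Dw; rewrite -mulr_sumr KL// mulr0.
  have := partial_eq_on Dop (rshift 1 b) Zero Dz.
  by rewrite partial_cst partial_sum.
pose k e := \sum_a hchr g z a a e.
have d1 a : dh a (fun w => theta w * (K w a * L w b)) z =
   (K z a * dh a theta z) * L z b - theta z * L z b * (\sum_e hchr g z a a e * K z e)
   + theta z * (K z a * dh b (fun w => L w a) z).
  rewrite /dh (partialM _ dt (dKL a b)) (partialM _ (dK' a) (dL b)).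
  rewrite (dK a a Dz : partial _ _ z = _).
  rewrite (dL_sym Uop Sg symg ug SK dK a b Dz : partial _ _ z = _) /dh.
  by move: (partial _ (fun w => L w a) z) (partial _ theta z) (theta z) (\sum_c _) => *; ring.
transitivity (\sum_a dh a (fun w => theta w * (K w a * L w b)) z
   - \sum_a dh b (fun w => theta w * (K w a * L w a)) z
   + (theta z * L z b * (\sum_e (\sum_a hchr Gt z a a e) * K z e)
      - theta z * (\sum_e K z e * (\sum_a L z a * hchr Gt z a b e)))).
  rewrite big_split sumrB /=; congr (_ + _).
  rewrite !mulr_sumr -sumrB exchange_big; apply: eq_bigr => e _.
  rewrite mulr_suml !mulr_sumr -sumrB; apply: eq_bigr => a _ /=.
  by move: (hchr _ _ _ _ _) (hchr _ _ _ _ _) (theta z) => *; ring.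
rewrite tr0 subr0 (eq_bigr _ (fun a _ => d1 a)).
have -> : \sum_e (\sum_a hchr Gt z a a e) * K z e = \sum_a \sum_e hchr g z a a e * K z e.
  rewrite exchange_big; apply: eq_bigr => e _; rewrite -mulr_suml.
  by rewrite (hchr_pmet_trace Uop Sg symg ug SK dK LK Spsi Kpsi e Dz).
have -> : \sum_e K z e * (\sum_a L z a * hchr Gt z a b e) =
    \sum_e K z e * dh b (fun w => L w e) z.
  apply: eq_bigr => e _; congr (_ * _).
  rewrite (hchr_pmet_low Uop Sg symg ug SK dK LK Spsi Kpsi b e Dz).
  rewrite (dKlow Uop Sg symg ug SK dK b e Dz).
  by apply: eq_bigr => a _; rewrite mulrC.
rewrite big_split sumrB /= -!mulr_sumr -mulr_suml K_dtheta//.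
move: (theta z) (\sum_a _) (\sum_a _) (\sum_a _) (p.+2%:R : R) => *.
by ring.
Qed.

(** The order p + 1 is within the range n - 2 in which the mixed equation holds. *)
Lemma K_phi : (p.+2 < n.-1)%N ->
  (forall z, D z -> exists a, L z a != 0) ->
  (forall b, eqv (n - 2) (fun z => mixed_op G z b) (fun=> 0)) ->
  forall z, D z -> \sum_a K z a * dh a phi z = 0.
Proof.
move=> pn L0 Mix z Dz; have [b Lb] := L0 z Dz.
have n1 : (p.+1 < n - 2)%N by lia.
have SKp : S (fun z => \sum_a K z a * dh a phi z).
  by apply: (smooth_sum Dop) => a _; exact: (smoothM Dop (SK a) (smooth_dh a Sphi)).
have Smk : S (fun z => m * (\sum_a K z a * dh a phi z) * L z b).
  exact: (smoothM Dop (smoothZ Dop m SKp) (SL b)).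
have := jet_eqv r_gt0 (mixed_exp b) (ltnSn _) Dz.
rewrite (jet_eqv r_gt0 (Mix b) n1 Dz) /jet iter_cst /= mulr0 -/(jet _ _ _).
rewrite (jet_xn_static Uop r_gt0 p.+1 Smk _ Dz).
  by move/esym/eqP; rewrite !mulf_eq0 (negPf m_neq0) (negPf Lb) orbF => /eqP.
move=> w; rewrite (stL b w); congr (_ * _ * _); apply: eq_bigr => a _.
by rewrite (stK a w) (static_dh a stphi w).
Qed.

Lemma G_exp_next a b : eqv p.+3 (fun z => G z a b)
  (fun z => pmet g K (fun w => psi w + x_ w ^+ p.+2 * phi w) z a b).
Proof.
apply: (eqv_trans (G_exp a b)); apply: (eqv_eq_on Uop); first by case: (G_exp a b).
move=> z Dz; rewrite Hphi// !mxE.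
by move: (psi z) (phi z) (x_ z ^+ _) => *; ring.
Qed.

End Expansion.

(** * Formal uniqueness *)

Section FormalUniqueness.
Context {R : realType} {n : nat}.
Local Notation E := 'rV[R]_(1 + n).
Implicit Types (z w : E) (a b c d e : 'I_n).
Variables (U : set 'rV[R]_n) (r : R).
Hypotheses (Uop : open U) (r_gt0 : 0 < r).
Local Notation D := (cyl U r).
Local Notation S := (smooth_on D).
Local Notation eqv := (eqv U r).
Local Notation x_ := (@coord_x R n).
Let Dop : open D := cyl_open Uop.

Variable G : E -> 'M[R]_n.
Hypothesis SG : forall a b, S (fun z => G z a b).
Hypothesis symG : forall z, D z -> (G z)^T = G z.
Hypothesis uG : forall z, D z -> G z \in unitmx.
Hypothesis evG : forall z, D z -> G (refl z) = G z.

Let g z := G (to0 z).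
Variable K : E -> 'I_n -> R.
Hypothesis SK : forall a, S (fun z => K z a).
Hypothesis stK : forall a, static (fun z => K z a).
Hypothesis dK : forall z a b, D z ->
  dh a (fun w => K w b) z = - \sum_c hchr g z b a c * K z c.
Local Notation L := (Klow g K).
Hypothesis LK : forall z, D z -> \sum_a L z a * K z a = 0.
Hypothesis L_neq0 : forall z, D z -> exists a, L z a != 0.
Variable rho : E -> R.
Hypothesis Srho : S rho.
Hypothesis ric_g : forall z c b, D z -> hric (hchr g) z c b = rho z * L z c * L z b.

Hypotheses (n_even : ~~ odd n) (n_gt1 : (1 < n)%N).
Hypothesis einstein_tangent : forall c b,
  eqv n.-1 (fun z => einstein_op G z c b) (fun=> 0).
Hypothesis einstein_mixed : forall b, eqv (n - 2) (fun z => mixed_op G z b) (fun=> 0).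
Hypothesis einstein_trace : forall z, D z ->
  \sum_a \sum_d invmx (g z) a d * jet n.-1 (fun w => einstein_op G w d a) z = 0.

Lemma to0_refl z : to0 (refl z) = to0 z.
Proof. by rewrite !to0E reflE rsub_pt. Qed.

Lemma static_even f z : static f -> f (refl z) = f z.
Proof. by move=> st; rewrite -st to0_refl st. Qed.

(** The condition on K psi is what makes the next step possible; evenness of psi
    lets the order advance by two. *)
Definition wave_modulo p := exists psi,
  [/\ S psi, forall z, D z -> psi (refl z) = psi z, eqv 1 psi (fun=> 0),
      forall z, D z -> \sum_a K z a * dh a psi z = 0 &
      forall a b, eqv p.+2 (fun z => G z a b) (fun z => pmet g K psi z a b)].

Lemma pmet_even psi z a b : psi (refl z) = psi z ->
  pmet g K psi (refl z) a b = pmet g K psi z a b.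
Proof.
move=> ev; rewrite !mxE ev (static_even z (stL G stK a)) (static_even z (stL G stK b)).
by rewrite (static_even z (stg G a b)).
Qed.

Lemma wave_modulo0 : wave_modulo 0.
Proof.
have S0 : S (fun=> 0) by exact: (smooth_cst Dop).
exists (fun=> 0); split=> //.
- by move=> z Dz; apply: big1 => a _; rewrite /dh partial_cst mulr0.
move=> a b; apply: (eqv_even_step Uop r_gt0) => //.
- by move=> z Dz; rewrite evG.
- by move=> z Dz; apply: pmet_even.
have E1 : eq_on D (fun z => g z a b) (fun z => pmet g K (fun=> 0) z a b).
  by move=> z _; rewrite [RHS]mxE !mul0r addr0.
apply: eqv_trans (eqv_eq_on Uop 1 (Sg Uop r_gt0 SG a b) E1).
split; [exact: SG|exact: (Sg Uop r_gt0 SG)|move=> j z].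
rewrite ltnS leqn0 => /eqP -> Dz z0.
exact: (congr1 (fun w => G w a b) (esym (to0_id z0))).
Qed.

Lemma wave_moduloS p : ~~ odd p -> (p.+2 < n)%N -> wave_modulo p -> wave_modulo p.+2.
Proof.
move=> ep pn [psi [Spsi epsi psi1 Kpsi Gm]].
have [phi Sphi [stphi Hphi]] := lead_multiple Uop r_gt0 SG symG uG SK stK dK LK
  Srho ric_g Spsi psi1 Kpsi Gm pn einstein_tangent.
have pn1 : (p.+2 < n.-1)%N.
  rewrite -ltnS prednK ?(ltnW n_gt1)// ltn_neqAle pn andbT.
  by apply: contraNneq n_even => <-; rewrite /= negbK.
have Kphi := K_phi Uop r_gt0 SG symG uG SK stK dK LK Spsi Kpsi Gm Sphi stphi Hphi
  pn1 L_neq0 einstein_mixed.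
have Gn := G_exp_next Uop r_gt0 SG SK Spsi Gm Hphi.
have Sxp : S (fun w => x_ w ^+ p.+2 * phi w).
  exact: (smoothM Dop (smooth_xn Uop p.+2) Sphi).
pose psi' w := psi w + x_ w ^+ p.+2 * phi w.
have epsi' z : D z -> psi' (refl z) = psi' z.
  move=> Dz; rewrite /psi' epsi// (static_even z stphi) reflE coord_pt.
  by rewrite exprNn -signr_odd /= negbK (negPf ep) mul1r.
exists psi'; split=> //.
- exact: (smoothD Dop Spsi Sxp).
- have E1 := eqvD Uop psi1 (eqv_le (ltn0Sn _) (eqv_xn0 Uop p.+2 Sphi Sphi)).
  apply: (eqv_trans E1); apply: (eqv_eq_on Uop); first by case: E1.
  by move=> z _; rewrite addr0.
- move=> z Dz.
  have d1 : differentiable psi z by exact: (smooth_diff Spsi Dz).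
  have d2 : differentiable (fun w => x_ w ^+ p.+2) z.
    exact: (smooth_diff (smooth_xn Uop p.+2) Dz).
  have d3 : differentiable phi z by exact: (smooth_diff Sphi Dz).
  have d4 : differentiable (fun w => x_ w ^+ p.+2 * phi w) z.
    exact: (smooth_diff Sxp Dz).
  have dpsi a : dh a psi' z = dh a psi z + x_ z ^+ p.+2 * dh a phi z.
    rewrite /dh /psi' (partialD _ d1 d4) (partialM _ d2 d3).
    by rewrite -[partial _ (fun w => x_ w ^+ p.+2) z]/(dh a _ z) (dh_xn Uop a p.+2 Dz) mul0r add0r.
  rewrite (eq_bigr (fun a => K z a * dh a psi z + x_ z ^+ p.+2 * (K z a * dh a phi z))).
    by rewrite big_split /= Kpsi// -mulr_sumr Kphi// mulr0 addr0.
  by move=> a _; rewrite dpsi; move: (dh a _ z) (dh a _ z) => *; ring.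
move=> a b; apply: (eqv_even_step Uop r_gt0) => //.
- by rewrite /= negbK.
- by move=> z Dz; rewrite evG.
- by move=> z Dz; apply: pmet_even; exact: epsi'.
Qed.

(** The induction stops at order n - 1, and the normalisation takes care of the trace of
    the coefficient of order n. *)
Lemma shape_trace_vanish : eqv n (fun z => \sum_a shape G z a a) (fun=> 0).
Proof.
have [psi [Spsi epsi psi1 Kpsi Gm]] : wave_modulo (n - 2).
  suff: forall q, ~~ odd q -> (q.+2 <= n)%N -> wave_modulo q.
    by apply; lia.
  elim/ltn_ind => -[_ _ _|[//|q] IH oq qn]; first exact: wave_modulo0.
  have oq' : ~~ odd q by move: oq; rewrite /= negbK.
  apply: wave_moduloS => //; first exact: ltnW.
  by apply: IH => //; exact: ltnW (ltnW qn).
have n2 : (n - 2).+2 = n by lia.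
have T := tau_exp Uop r_gt0 SG symG uG SK stK LK Spsi psi1 Gm.
have H0 := trH_critical Uop r_gt0 SG symG uG SK stK dK LK Srho ric_g Spsi psi1 Kpsi Gm
  n2 einstein_trace.
suff : eqv (n - 2).+2 (fun z => \sum_a shape G z a a) (fun=> 0) by rewrite n2.
apply: (eqv_trans T); apply: (eqv_eq_on Uop); first by case: T.
by move=> z Dz; rewrite H0// !mulr0.
Qed.

End FormalUniqueness.

(** * Jacobi's formula and the volume element *)

Section Jacobi.
Context {R : realType} {n : nat}.
Local Notation E := 'rV[R]_(1 + n).
Implicit Types (z w : E) (a b c d e : 'I_n).
Variables (U : set 'rV[R]_n) (r : R).
Hypotheses (Uop : open U) (r_gt0 : 0 < r).
Local Notation D := (cyl U r).
Local Notation S := (smooth_on D).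
Let Dop : open D := cyl_open Uop.

Lemma partial_prod (I : eqType) (k : 'I_(1 + n)) (s : seq I) (F : I -> E -> R) z :
  uniq s -> (forall i, differentiable (F i) z) ->
  partial k (fun w => \prod_(i <- s) F i w) z =
  \sum_(i <- s) \prod_(j <- s) (if j == i then partial k (F i) z else F j z).
Proof.
move=> us dF; elim: s us => [_|i s IH] /=.
  rewrite big_nil (_ : (fun _ => _) = fun=> 1) ?partial_cst//.
  by apply/funext => w; rewrite big_nil.
move=> /andP[is_ us].
have dP : differentiable (fun w => \prod_(j <- s) F j w) z.
  elim: (s) => [|j t IHt].
    rewrite (_ : (fun _ => _) = fun=> 1); first exact: differentiable_cst.
    by apply/funext => w; rewrite big_nil.
  rewrite (_ : (fun _ => _) = fun w => F j w * \prod_(j <- t) F j w).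
    exact: differentiableM (dF j) IHt.
  by apply/funext => w; rewrite big_cons.
have -> : (fun w => \prod_(j <- i :: s) F j w) = (fun w => F i w * \prod_(j <- s) F j w).
  by apply/funext => w; rewrite big_cons.
rewrite (partialM _ (dF i) dP) IH// big_cons big_cons eqxx; congr (_ * _ + _).
  apply: eq_big_seq => j js; case: eqP => // ji.
  by move: is_; rewrite -ji js.
rewrite mulr_sumr; apply: eq_big_seq => j js; rewrite big_cons.
by case: eqP => // ij; move: is_; rewrite ij js.
Qed.

Variable G : E -> 'M[R]_n.
Hypothesis SG : forall a b, S (fun z => G z a b).
Hypothesis uG : forall z, D z -> G z \in unitmx.

(** Jacobi's formula, by differentiating the determinant row by row. *)
Lemma d0_det z : D z ->
  d0 (fun w => \det (G w)) z = \det (G z) * \sum_a shape G z a a.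
Proof.
move=> Dz.
have dG a b : differentiable (fun w => G w a b) z := smooth_diff (SG a b) Dz.
pose M a : 'M[R]_n := \matrix_(i, j) if i == a then d0 (fun w => G w a j) z else G z i j.
have dprod (s : 'S_n) : differentiable (fun w => \prod_i G w i (s i)) z.
  apply: (smooth_diff (D := D)) => //; apply: smooth_prod => // i _; exact: SG.
transitivity (\sum_a \det (M a)).
  rewrite /d0 /determinant partial_sum => [|s _]; last first.
    by apply: differentiableM; [exact: differentiable_cst|exact: dprod].
  rewrite exchange_big; apply: eq_bigr => s _.
  rewrite partialZ// partial_prod ?index_enum_uniq//.
  rewrite -mulr_sumr; congr (_ * _); apply: eq_bigr => a _; apply: eq_bigr => j _.
  by rewrite mxE; case: eqP => // ->.
rewrite mulr_sumr.
transitivity (\sum_a \sum_b d0 (fun w => G w a b) z * cofactor (G z) a b).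
  apply: eq_bigr => a _; rewrite (expand_det_row _ a); apply: eq_bigr => b _.
  rewrite mxE eqxx; congr (_ * _); rewrite /cofactor; congr (_ * \det _).
  by apply/matrixP => i j; rewrite !mxE eq_sym (negPf (neq_lift _ _)).
rewrite exchange_big; apply: eq_bigr => b _; rewrite shape.unlock mulr_sumr.
apply: eq_bigr => a _.
have VE : invmx (G z) b a = (\det (G z))^-1 * cofactor (G z) a b.
  by rewrite /invmx (uG Dz) !mxE.
have d_neq0 : \det (G z) != 0 by rewrite -unitfE -unitmxE uG.
rewrite VE; move: (\det _) d_neq0 (cofactor _ _ _) (d0 _ z) => t t0 *; by field.
Qed.

Lemma derive1_slice (f : E -> R) y x :
  derive1 (fun t => f (collar_pt t y)) x = d0 f (collar_pt x y).
Proof.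
rewrite derive1E /d0 partialE (collar_pt_delta0 x y) -derive_line.
by congr ('D_1 _ x); apply/funext => t; rewrite -collar_pt_delta0.
Qed.

Lemma derivable_slice (f : E -> R) y x : S f -> `|x| < r -> U y ->
  derivable (fun t => f (collar_pt t y)) x 1.
Proof.
move=> Sf xr Uy.
have -> : (fun t => f (collar_pt t y)) =
    (fun t => f (t *: delta_mx 0 (lshift n ord0) + collar_pt 0 y)).
  by apply/funext => t; rewrite -collar_pt_delta0.
apply: derivable_line; rewrite -collar_pt_delta0; apply: diff_derivable.
by apply: (smooth_diff Sf); exact: cyl_pt.
Qed.

Local Notation tau := (fun z => \sum_a shape G z a a).

(** The volume element q satisfies q' = q tau / 2, so its derivative of order j + 1 is q u
    with u in the differential ideal of tau, of transversal order up to j. *)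
Lemma volume_derivatives (N : nat) y (s : R) : U y ->
  (forall x, `|x| < r -> 0 < \det (G (collar_pt x y)) / s) ->
  eqv U r N tau (fun=> 0) ->
  forall j, (0 < j <= N)%N ->
    derive1n j (fun x => Num.sqrt (\det (G (collar_pt x y)) / s)) 0 = 0.
Proof.
move=> Uy pos Et; pose q (x : R) : R := Num.sqrt (\det (G (collar_pt x y)) / s).
rewrite -/q.
have [Stau _ _] := Et.
have Shtau : S (fun z => 2^-1 * tau z) by exact: smoothZ.
have dq (x : R) : `|x| < r ->
    is_derive x 1 q (q x * (2^-1 * tau (collar_pt x y))).
  move=> xr.
  have Dx : D (collar_pt x y) by exact: cyl_pt.
  have Sdet : S (fun z => \det (G z)) by exact: smooth_det.
  pose f t := \det (G (collar_pt t y)) / s.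
  have df : is_derive x 1 f (s^-1 * (\det (G (collar_pt x y)) * tau (collar_pt x y))).
    have dd := derivable_slice Sdet xr Uy.
    have -> : f = s^-1 *: (fun t => \det (G (collar_pt t y))).
      by apply/funext => t; rewrite /f mulrC.
    apply: is_deriveZ; apply: DeriveDef; first exact: dd.
    by rewrite -derive1E (derive1_slice (fun z => \det (G z)) y x) d0_det.
  have [dv de] := @is_derive1_comp _ Num.sqrt f x _ _ (is_derive1_sqrt (pos x xr)) df.
  apply: DeriveDef => //; apply: etrans de _.
  have fpos := pos x xr; rewrite -/(f x) in fpos.
  have qpos : 0 < Num.sqrt (f x) by rewrite sqrtr_gt0.
  have qq : Num.sqrt (f x) * Num.sqrt (f x) = f x by rewrite -expr2 sqr_sqrtr// ltW.
  rewrite -[q x]/(Num.sqrt (f x)) -/(f x).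
  have -> : s^-1 * (\det (G (collar_pt x y)) * tau (collar_pt x y)) =
      f x * tau (collar_pt x y) by rewrite /f; ring.
  rewrite -{2}qq; move: (Num.sqrt (f x)) qpos (\sum_a _) => v v0 t.
  by field; rewrite gt_eqF.
have main j : exists u, [/\ S u, eqv U r (N - j) u (fun=> 0) &
    forall x, `|x| < r -> derive1n j.+1 q x = q x * u (collar_pt x y)].
  elim: j => [|j [u [Su Eu IH]]].
    exists (fun z => 2^-1 * tau z); split=> //.
      rewrite subn0; have E2 := eqvZ Uop 2^-1 Et; apply: (eqv_trans E2).
      by apply: (eqv_eq_on Uop); [case: E2|move=> z _; rewrite mulr0].
    by move=> x xr; rewrite derive1n1 derive1E; have [_ ->] := dq x xr.
  exists (fun z => 2^-1 * tau z * u z + d0 u z); split.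
  - by apply: smoothD => //; [exact: smoothM|exact: smooth_d0].
  - have E1 := eqvM Uop (eqv_refl (N - j.+1) Shtau) (eqv_le (leq_sub2l N (leqnSn j)) Eu).
    have E2 : eqv U r (N - j.+1) (d0 u) (fun=> 0).
      case: (ltnP j N) => jN; last first.
        have -> : (N - j.+1 = 0)%N by lia.
        by split=> //; [exact: smooth_d0|exact: smooth_cst].
      rewrite -(partial_cst (lshift n ord0) (0 : R)); apply: eqv_d0.
      by have -> : (N - j.+1).+1 = (N - j)%N by lia.
    have E3 := eqvD Uop E1 E2; apply: (eqv_trans E3).
    by apply: (eqv_eq_on Uop); [case: E3|move=> z _; rewrite mulr0 addr0].
  move=> x xr; rewrite derive1nS derive1E.
  have -> : 'D_1 (derive1n j.+1 q) x = 'D_1 (fun t => q t * u (collar_pt t y)) x.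
    apply: near_eq_derive.
    have xr' : 0 < r - `|x| by rewrite subr_gt0.
    apply/nbhs_normP; exists (r - `|x|) => // t /= tx; apply: IH.
    rewrite -(subKr x t); apply: (le_lt_trans (ler_normB _ _)).
    by rewrite -ltrBrDl.
  have du : is_derive x 1 (fun t => u (collar_pt t y)) (d0 u (collar_pt x y)).
    by apply: DeriveDef; [exact: derivable_slice|rewrite -derive1E (derive1_slice u y x)].
  have [_ ->] := is_deriveM (dq x xr) du.
  rewrite /GRing.scale/=; move: (q x) (u _) (d0 u _) (\sum_a _) => *; ring.
move=> [//|j] /andP[_ jN]; have [u [Su [_ _ Eu] Hu]] := main j.
rewrite (Hu 0) ?normr0//.
have -> : u (collar_pt 0 y) = 0; last by rewrite mulr0.
apply: (Eu 0%N); [lia|exact: cyl_pt0|exact: coord_pt].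
Qed.

End Jacobi.

(** * The initial metric as a static metric on the collar *)

Section StaticWave.
Context {R : realType} {n : nat}.
Local Notation E := 'rV[R]_(1 + n).
Implicit Types (z w : E) (a b c d e f : 'I_n).
Variables (U : set 'rV[R]_n) (r : R).
Hypotheses (Uop : open U) (r_gt0 : 0 < r).
Local Notation D := (cyl U r).
Local Notation S := (smooth_on D).
Let Dop : open D := cyl_open Uop.

Variables (g0 : 'rV[R]_n -> 'M[R]_n) (K0 : 'rV[R]_n -> 'rV[R]_n).
Hypothesis Sg0 : forall a b, smooth_on U (fun y => g0 y a b).
Hypothesis lor : forall y, U y -> lorentzian_form (g0 y).
Hypothesis SK0 : forall b, smooth_on U (fun y => K0 y 0 b).
Hypothesis K0_neq0 : forall y, U y -> K0 y != 0.
Hypothesis K0_null : forall y, U y -> K0 y *m g0 y *m (K0 y)^T = 0.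
Hypothesis K0_parallel : forall y, U y -> forall a b,
  partial a (fun v => K0 v 0 b) y + \sum_c christoffel g0 y b a c * K0 y 0 c = 0.
Hypothesis wave : forall y, U y -> forall a b c d,
  \sum_e \sum_f riemann_mixed g0 y a b e f * riemann_low g0 y e f c d = 0.

Variable gs : E -> 'M[R]_n.
Hypothesis gsE : forall z, D z -> gs z = g0 (rsubmx z).
Let K z a : R := K0 (rsubmx z) 0 a.
Local Notation L := (Klow gs K).

Lemma dh_static a (F : E -> R) (u : 'rV[R]_n -> R) z :
  (forall w, D w -> F w = u (rsubmx w)) -> D z -> dh a F z = partial a u (rsubmx z).
Proof.
move=> H Dz; rewrite -dh_rsub.
have E1 : eq_on D F (u \o rsubmx) by [].
exact: (partial_eq_on Dop _ E1).
Qed.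

Lemma smooth_static_metric a b : S (fun z => gs z a b).
Proof.
have E1 : eq_on D ((fun y => g0 y a b) \o rsubmx) (fun z => gs z a b).
  by move=> z Dz /=; rewrite gsE.
exact: (smooth_eq_on Dop E1 (smooth_rsub Uop (Sg0 a b))).
Qed.

Lemma hchr_static z c a b : D z -> hchr gs z c a b = christoffel g0 (rsubmx z) c a b.
Proof.
move=> Dz; rewrite hchr.unlock gsE//; congr (_ * _); apply: eq_bigr => d _.
have H a' i j : dh a' (fun w => gs w i j) z = partial a' (fun y => g0 y i j) (rsubmx z).
  by apply: (@dh_static a' _ (fun y => g0 y i j)) => // w Dw; rewrite gsE.
by rewrite !H.
Qed.

Lemma curv_static z d c a b : D z ->
  curv (hchr gs) z d c a b = riemann g0 (rsubmx z) d c a b.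
Proof.
move=> Dz; rewrite curv.unlock.
have H a' i j k : dh a' (fun w => hchr gs w i j k) z =
    partial a' (fun y => christoffel g0 y i j k) (rsubmx z).
  by apply: (@dh_static a' _ (fun y => christoffel g0 y i j k)) => // w; exact: hchr_static.
rewrite !H; congr (_ + _); apply: eq_bigr => e _.
by rewrite !(hchr_static _ _ _ Dz).
Qed.

Lemma rlow_static z a b c d : D z ->
  rlow gs z a b c d = riemann_low g0 (rsubmx z) a b c d.
Proof.
move=> Dz; apply: eq_bigr => e _; by rewrite (curv_static _ _ _ _ Dz) gsE.
Qed.

Lemma smooth_static_vector a : S (fun z => K z a).
Proof. exact: (smooth_rsub Uop (SK0 a)). Qed.

Lemma static_vector a : static (fun z => K z a).
Proof. by move=> z; rewrite /K to0E rsub_pt. Qed.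

Lemma static_parallel z a b : D z ->
  dh a (fun w => K w b) z = - \sum_c hchr gs z b a c * K z c.
Proof.
move=> Dz; have [_ Uz] := Dz.
rewrite (@dh_static a _ (fun y => K0 y 0 b))//.
have /eqP := K0_parallel Uz a b; rewrite addr_eq0 => /eqP ->.
by congr (- _); apply: eq_bigr => c _; rewrite (hchr_static _ _ _ Dz).
Qed.

Let lorz z : D z -> lorentzian_form (gs z).
Proof. by move=> Dz; rewrite gsE//; apply: lor; case: Dz. Qed.

Let symz z : D z -> (gs z)^T = gs z.
Proof. by move=> /lorz[]. Qed.

Let uz z : D z -> gs z \in unitmx.
Proof. by move=> /lorz/lorentzian_unit. Qed.

Lemma static_null z : D z -> \sum_a L z a * K z a = 0.
Proof.
move=> Dz; have [_ Uz] := Dz.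
have := K0_null Uz; rewrite -gsE// => /matrixP/(_ 0 0); rewrite [X in _ = X]mxE => N.
rewrite -[RHS]N [RHS]mxE; apply: eq_bigr => a _; rewrite [X in _ = _ * X]mxE; congr (_ * _).
rewrite -KlowE mxE; apply: eq_bigr => b _; rewrite mulrC; congr (_ * _).
exact: (G_sym symz a b Dz).
Qed.

Let K_neq0 z : D z -> exists a, K z a != 0.
Proof.
move=> [_ Uz]; apply/existsP; apply: contraT => /existsPn H.
have /eqP[] := K0_neq0 Uz; apply/rowP => a; rewrite [RHS]mxE.
by have := H a; rewrite negbK => /eqP.
Qed.

Lemma static_lowered_neq0 z : D z -> exists a, L z a != 0.
Proof.
move=> Dz; have [a La] := lowered_neq0 (lorz Dz) (K_neq0 Dz).
by exists a; rewrite -KlowE.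
Qed.

Lemma static_ricci : exists2 rho, S rho &
  forall z c b, D z -> hric (hchr gs) z c b = rho z * L z c * L z b.
Proof.
pose N z := dual_vector (L z).
have SL a : S (fun z => L z a).
  exact: (smooth_Klow Uop smooth_static_metric smooth_static_vector).
have SN a : S (fun z => N z a).
  apply: (smoothM Dop (SL a)); apply: (smoothV Dop).
    by apply: (smooth_sum Dop) => b _; apply: (smoothX Dop).
  by move=> z /static_lowered_neq0[b /sum_sqr_neq0].
have Sric c b := smooth_hric Uop smooth_static_metric uz c b.
exists (fun z => \sum_i \sum_j hric (hchr gs) z i j * N z i * N z j).
  apply: (smooth_sum Dop) => i _; apply: (smooth_sum Dop) => j _.
  by apply: (smoothM Dop) => //; apply: (smoothM Dop).
move=> z c b Dz.
have ricE i j : hric (hchr gs) z i j = wave_ricci (gs z) (rlow gs z) i j.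
  apply: eq_bigr => a _; rewrite -[LHS](sum_delta (fun e => curv (hchr gs) z e i a j)).
  under [RHS]eq_bigr => e _ do rewrite /rlow mulr_sumr.
  rewrite exchange_big; apply: eq_bigr => e _.
  rewrite -(sum_GinvG uz a e Dz) mulr_suml; apply: eq_bigr => k _.
  by rewrite mulrA.
have LE : (fun a => \sum_b0 gs z a b0 * K z b0) = L z.
  by apply/funext => a; rewrite KlowE.
have W := @wave_ricciE _ _ (gs z) (K z) (rlow gs z) (lorz Dz) (K_neq0 Dz).
cbv beta zeta in W; rewrite LE in W.
rewrite ricE {}W.
- rewrite !KlowE; congr (_ * _ * _); apply: eq_bigr => i _; apply: eq_bigr => j _.
  by rewrite ricE.
- by rewrite -[RHS](static_null Dz); apply: eq_bigr => a _; rewrite KlowE.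
- by move=> *; exact: (rlow_anti Uop smooth_static_metric symz uz).
- by move=> *; exact: (rlow_pair Uop smooth_static_metric symz uz).
- move=> *; exact: (rlow_K2 Uop smooth_static_metric uz smooth_static_vector static_parallel).
move=> a d; have [_ Uz] := Dz; rewrite -[RHS](wave Uz a d a d).
apply: eq_bigr => e _; apply: eq_bigr => f _; rewrite (rlow_static _ _ _ _ Dz); congr (_ * _).
by apply: eq_bigr => p _; apply: eq_bigr => q _; rewrite (rlow_static _ _ _ _ Dz) gsE.
Qed.

End StaticWave.

(** * The Einstein condition at the boundary *)

Lemma near_right (R : realType) (P : R -> Prop) :
  (\forall x \near 0^'+, P x) <-> exists2 d, 0 < d & forall x, 0 < x < d -> P x.
Proof.
split=> [/nbhs_right0P H|[d d0 H]].
  have /nbhs_normP[d /= d0 Hd] : \forall e \near 0, 0 < e -> P e.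
    by move: H; rewrite /at_right near_withinE; apply: filterS => e; rewrite add0r.
  exists d => // x /andP[x0 xd]; apply: Hd => //=.
  by rewrite sub0r normrN gtr0_norm.
apply/nbhs_right0P; rewrite /at_right near_withinE; apply/nbhs_normP; exists d => // x /= xd x0.
rewrite add0r; apply: H; rewrite x0/=.
by move: xd; rewrite sub0r normrN gtr0_norm.
Qed.

Lemma entry_norm (R : realType) (m k : nat) (A : 'M[R]_(m, k)) i j : `|A i j| <= `|A|.
Proof.
have -> : `|A| = mx_norm A by [].
rewrite mx_normrE.
exact: (le_bigmax _ (fun p => `|A p.1 p.2|) (i, j)).
Qed.

Section Boundary.
Context {R : realType} {n : nat}.
Local Notation E := 'rV[R]_(1 + n).
Implicit Types (z w : E) (a b c d e : 'I_n).
Variables (U : set 'rV[R]_n) (r : R).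
Hypotheses (Uop : open U) (r_gt0 : 0 < r).
Local Notation D := (cyl U r).
Local Notation S := (smooth_on D).
Local Notation eqv := (eqv U r).
Local Notation x_ := (@coord_x R n).
Local Notation o := (lshift n (ord0 : 'I_1)).
Local Notation h := (rshift 1).
Let Dop : open D := cyl_open Uop.

Variable G : E -> 'M[R]_n.
Hypothesis SG : forall a b, S (fun z => G z a b).
Hypothesis symG : forall z, D z -> (G z)^T = G z.
Hypothesis uG : forall z, D z -> G z \in unitmx.
Hypothesis n_gt1 : (1 < n)%N.

Definition cone_defect y x : 'M[R]_(1 + n) :=
  ricci (cone G) (collar_pt x y) + n%:R *: cone G (collar_pt x y).

Hypothesis einstein : forall y, U y ->
  cone_defect y =O_ (0^'+) (fun x : R => x ^+ (n - 2)).

Let Sx : S x_ := smooth_coord_x Uop.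
Let SB a b : S (fun z => shape G z a b) := smooth_shape Uop SG uG a b.

Lemma smooth_einstein_op c b : S (fun z => einstein_op G z c b).
Proof.
have SG' i j : S (d0 (fun w => G w i j)) by exact: smooth_d0.
have Stau : S (fun z => \sum_a shape G z a a) by apply: (smooth_sum Dop).
have Sc (t : R) : S (fun=> t) := smooth_cst Dop t.
rewrite /einstein_op; apply: (smoothD Dop); last first.
  apply: (smoothM Dop (Sc _)); apply: (smoothM Dop Sx); apply: (smooth_sum Dop) => e _.
  apply: (smooth_sum Dop) => i _.
  apply: (smoothM Dop (smoothM Dop (SG' _ _) _) (SG' _ _)).
  exact: (smooth_Ginv Uop SG uG).
apply: (smoothB Dop); last first.
  by apply: (smoothM Dop (Sc _)); apply: (smoothM Dop Sx); exact: (smoothM Dop Stau (SG' _ _)).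
apply: (smoothD Dop); last first.
  by apply: (smoothM Dop (Sc _)); exact: (smoothM Dop Stau (SG _ _)).
apply: (smoothD Dop); last exact: (smoothM Dop (Sc _) (SG' _ _)).
apply: (smoothB Dop); first exact: (smoothM Dop Sx (smooth_hric Uop SG uG _ _)).
apply: (smoothM Dop (Sc _)); apply: (smoothM Dop Sx); exact: (smooth_d0 (SG' _ _)).
Qed.

Lemma smooth_mixed_op b : S (fun z => mixed_op G z b).
Proof.
have Schr i j k : S (fun z => hchr G z i j k) by exact: (smooth_chr Uop SG uG).
rewrite /mixed_op; apply: (smooth_sum Dop) => a _; apply: (smoothD Dop).
  by apply: (smoothB Dop); apply: (smooth_dh _ (SB _ _)).
apply: (smooth_sum Dop) => e _.
by apply: (smoothB Dop); exact: (smoothM Dop (Schr _ _ _) (SB _ _)).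
Qed.

Lemma defect_bound y : U y -> exists C t, 0 < t /\
  forall x, 0 < x < t -> x < r /\ forall i j, `|cone_defect y x i j| <= C * x ^+ (n - 2).
Proof.
move=> /einstein/eqO_exP[C _ /near_right[d d0 H]]; exists C, (Num.min d r); split.
  by rewrite lt_min d0.
move=> x /andP[x0]; rewrite lt_min => /andP[xd xr]; split=> // i j.
apply: (le_trans (entry_norm _ i j)).
have := H x; rewrite x0 xd => /(_ isT).
by rewrite normrX (gtr0_norm x0).
Qed.

Lemma posD_pt x y : 0 < x -> x < r -> U y -> posD U r (collar_pt x y).
Proof.
move=> x0 xr Uy; split; last by rewrite coord_pt.
by apply: cyl_pt => //; rewrite gtr0_norm.
Qed.

Lemma defect_tangent x y c b : 0 < x -> x < r -> U y ->
  einstein_op G (collar_pt x y) c b = x * cone_defect y x (h c) (h b).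
Proof.
move=> x0 xr Uy; rewrite -(cone_ricci_tangent Uop SG symG uG c b (posD_pt x0 xr Uy)).
rewrite coord_pt /cone_defect.
have -> // (A B : 'M[R]_(1 + n)) i j : (A + n%:R *: B) i j = A i j + n%:R * B i j.
by rewrite mxE [X in _ + X]mxE.
Qed.

Lemma defect_mixed x y b : 0 < x -> x < r -> U y ->
  mixed_op G (collar_pt x y) b = 2 * cone_defect y x o (h b).
Proof.
move=> x0 xr Uy; rewrite /cone_defect.
have -> (A B : 'M[R]_(1 + n)) : (A + n%:R *: B) o (h b) = A o (h b) + n%:R * B o (h b).
  by rewrite mxE [X in _ + X]mxE.
rewrite (cone_ricci_mixed Uop SG symG uG b (posD_pt x0 xr Uy)).
have -> : cone G (collar_pt x y) o (h b) = 0 by rewrite mxE block_mxEur mxE mulr0.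
by rewrite mulr0 addr0 mulrA divff ?mul1r// pnatr_eq0.
Qed.

Lemma einstein_tangent0 c b : eqv n.-1 (fun z => einstein_op G z c b) (fun=> 0).
Proof.
apply: (eqv0_bigO Uop r_gt0 (smooth_einstein_op c b)) => y Uy.
have [C [d [d0 H]]] := defect_bound Uy; exists C, d; split=> // x xd.
have [xr B] := H x xd; have /andP[x0 _] := xd.
rewrite defect_tangent// normrM (gtr0_norm x0).
have -> : n.-1 = (n - 2).+1 by lia.
by rewrite exprS mulrCA; apply: ler_wpM2l; [exact: ltW|exact: B].
Qed.

Lemma einstein_mixed0 b : eqv (n - 2) (fun z => mixed_op G z b) (fun=> 0).
Proof.
apply: (eqv0_bigO Uop r_gt0 (smooth_mixed_op b)) => y Uy.
have [C [d [d0 H]]] := defect_bound Uy; exists (2 * C), d; split=> // x xd.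
have [xr B] := H x xd; have /andP[x0 _] := xd.
rewrite defect_mixed// normrM ger0_norm ?ler0n// -mulrA.
by apply: ler_wpM2l; [exact: ler0n|exact: B].
Qed.

(** Both sides are limits of the same quotients, by Taylor's formula and by the relation
    between the operator and the defect. *)
Lemma einstein_limit y (L : 'M[R]_(1 + n)) d a : U y ->
  (x ^+ (n - 2))^-1 *: cone_defect y x @[x --> 0^'+] --> L ->
  jet n.-1 (fun w => einstein_op G w d a) (collar_pt 0 y) = L (h d) (h a).
Proof.
move=> Uy cL; have cLe : ((x ^+ (n - 2))^-1 *: cone_defect y x) (h d) (h a) @[x --> 0^'+] -->
    L (h d) (h a).
  have cc := @coord_continuous R _ _ (h d) (h a) L.
  exact: (cvg_comp (fun x => (x ^+ (n - 2))^-1 *: cone_defect y x)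
    (fun A : 'M[R]_(1 + n) => A (h d) (h a)) cL cc).
suff cJ : ((x ^+ (n - 2))^-1 *: cone_defect y x) (h d) (h a) @[x --> 0^'+] -->
    jet n.-1 (fun w => einstein_op G w d a) (collar_pt 0 y).
  exact: (cvg_unique (@norm_hausdorff R R^o) cJ cLe).
apply/cvgrPdist_le => /= e e0; apply/near_right.
have [t t0 H] := eqv0_quotient Uop r_gt0 (einstein_tangent0 d a) Uy e0.
exists (Num.min t r); first by rewrite lt_min t0.
move=> x /andP[x0]; rewrite lt_min => /andP[xt xr].
have := H x; rewrite x0 xt => /(_ isT); rewrite defect_tangent//.
rewrite [in X in _ -> X]mxE.
have -> : n.-1 = (n - 2).+1 by lia.
by rewrite exprS invfM mulrACA mulVf ?mul1r// gt_eqF.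
Qed.

Hypothesis trace_free : forall y, U y -> exists2 L : 'M[R]_(1 + n),
  (x ^+ (n - 2))^-1 *: cone_defect y x @[x --> 0^'+] --> L &
  \tr (invmx (G (collar_pt 0 y)) *m drsubmx L) = 0.

Lemma einstein_trace0 z : D z -> \sum_a \sum_d
  invmx (G (to0 z)) a d * jet n.-1 (fun w => einstein_op G w d a) z = 0.
Proof.
move=> [_ Uz]; have [L cL trL] := trace_free Uz.
rewrite -[RHS]trL; apply: eq_bigr => a _; rewrite [RHS]mxE; apply: eq_bigr => d _.
rewrite to0E -jet_to0 to0E (einstein_limit d a Uz cL); congr (_ * _).
by rewrite mxE [RHS]mxE.
Qed.

End Boundary.

(** * Vanishing of the critical Q-curvature *)

Lemma lorentzian_det_lt0 (R : realType) (n : nat) (G : 'M[R]_n) : (0 < n)%N ->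
  lorentzian_form G -> \det G < 0.
Proof.
case: n G => // n G _ [_ [B uB /(congr1 determinant)]].
rewrite !det_mulmx det_tr det_diag big_ord_recl mxE/= big1 ?mulr1 => [|i _]; last by rewrite mxE.
rewrite mulrAC -expr2 => H; rewrite -(pmulr_rlt0 (x := \det B ^+ 2)) ?H ?ltrN10//.
by rewrite exprn_even_gt0//= -unitfE -unitmxE.
Qed.

Section Wave.
Context {R : realType} {n : nat} {M : manifold R n}.
Hypotheses (n_gt0 : (0 < n)%N) (n_even : ~~ odd n).
Variables (g : @tensor2 R n M) (g_pp : pp_wave g).

Let n_gt1 : (1 < n)%N.
Proof. by move: n_gt0 n_even; case: n => [|[|]]. Qed.

Lemma wave_volume (r : R) gx v k p : poincare_metric g r gx ->
  volume_coefficients g gx v -> (0 < k <= n)%N -> v k p = 0.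
Proof.
move=> [r_gt0 lorx SG at0 even ein tf] vol kn.
have [i di] := dom_cover p; rewrite -(chartK di); set y := chart i p.
have Uy : cod i y by exists p.
rewrite vol//; move: y Uy => {di} y Uy.
have [[[Sg0 _] lor0] [K [[SK _] K_neq0 K_null K_par]] sqr] := g_pp.
pose U := cod i; have Uop : open U := @cod_open _ _ M i.
pose G (z : 'rV[R]_(1 + n)) := gx (coord_x z) i (rsubmx z).
have lorG z : cyl U r z -> lorentzian_form (G z).
  by move=> [zr Uz]; have [_] := lorx _ zr; apply.
have symG z : cyl U r z -> (G z)^T = G z by move=> /lorG[].
have uG z : cyl U r z -> G z \in unitmx by move=> /lorG/lorentzian_unit.
have SG' a b : smooth_on (cyl U r) (fun z => G z a b) := SG i a b.
have evG z : cyl U r z -> G (refl z) = G z.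
  by move=> [zr Uz]; rewrite /G reflE coord_pt rsub_pt even.
have gE z : cyl U r z -> G (to0 z) = g i (rsubmx z).
  by move=> [_ Uz]; rewrite /G to0E coord_pt rsub_pt at0.
have Sg0' a b := Sg0 i a b.
have SK' b := SK i b.
have [rho Srho ric] := static_ricci Uop Sg0' (lor0 i) SK' (K_neq0 i) (K_null i)
  (K_par i) (sqr i) gE.
have E1 := einstein_tangent0 Uop r_gt0 SG' symG uG n_gt1 (ein i).
have E2 := einstein_mixed0 Uop r_gt0 SG' symG uG (ein i).
have tf' y' : U y' -> exists2 L : 'M[R]_(1 + n),
    (x ^+ (n - 2))^-1 *: cone_defect G y' x @[x --> 0^'+] --> L &
    \tr (invmx (G (collar_pt 0 y')) *m drsubmx L) = 0.
  move=> Uy'; have [L cL tL] := tf i y' Uy'; exists L => //.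
  by rewrite /G coord_pt rsub_pt at0.
have E3 := einstein_trace0 Uop r_gt0 SG' symG uG n_gt1 (ein i) tf'.
have T := shape_trace_vanish Uop r_gt0 SG' symG uG evG
  (smooth_static_vector Uop SK') (static_vector (K i))
  (static_parallel Uop (K_par i) gE) (static_null (lor0 i) (K_null i) gE)
  (static_lowered_neq0 (lor0 i) (K_neq0 i) gE) Srho ric n_even n_gt1 E1 E2 E3.
have detE x : \det (gx x i y) = \det (G (collar_pt x y)).
  by rewrite /G coord_pt rsub_pt.
have -> : (fun x => Num.sqrt (\det (gx x i y) / \det (g i y))) =
    (fun x => Num.sqrt (\det (G (collar_pt x y)) / \det (g i y))).
  by apply/funext => x; rewrite detE.
rewrite (volume_derivatives Uop r_gt0 SG' uG Uy _ T kn) ?mul0r// => x xr.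
have d0 := lorentzian_det_lt0 n_gt0 (lor0 i y Uy).
have dx : \det (G (collar_pt x y)) < 0.
  by apply: lorentzian_det_lt0 => //; apply: lorG; exact: cyl_pt.
by rewrite nmulr_rgt0// invr_lt0.
Qed.

End Wave.

Lemma linear_diff_operator0 (R : realType) (n : nat) (M : manifold R n)
    (P : @operator R n M) p : linear_diff_operator P -> P (fun=> 0) p = 0.
Proof.
move=> [N PN]; have [i di] := dom_cover p; have [coef [_ Pf]] := PN i.
have S0 : smooth_fun (fun _ : M => 0 : R).
  by move=> j; exact: (smooth_cst (@cod_open _ _ M j)).
rewrite -(chartK di) Pf//; last by exists p.
apply: big1 => k _; apply: big1 => l _.
have -> : (fun _ : M => 0 : R) \o param i = fun=> 0 by [].
have -> : partials l (fun _ : 'rV[R]_n => 0 : R) = fun=> 0.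
  by elim: (tval l) => //= a s ->; rewrite partial_cst.
by rewrite mulr0.
Qed.

Lemma c_const_neq0 (R : realType) k : c_const R k != 0.
Proof.
rewrite /c_const mulf_neq0 ?signr_eq0 ?invr_eq0 ?mulf_neq0 ?expf_neq0 ?pnatr_eq0//.
all: by rewrite -lt0n fact_gt0.
Qed.

Theorem theorem4 (R : realType) (n : nat) (n_gt0 : (0 < n)%N) (n_even : ~~ odd n)
    (M : manifold R n) (g : @tensor2 R n M) (g_pp : pp_wave g)
    (Q : M -> R) (Q_crit : critical_Q_curvature g Q) :
  forall p : M, Q p = 0.
Proof.
move=> p; have [a [gx [v [A [Astar [pgx vol _ adj holo]]]]]] := Q_crit.
have V k : (0 < k <= n)%N -> v k = fun=> 0.
  by move=> kn; apply/funext => q; exact: (wave_volume n_gt0 n_even g_pp q pgx vol kn).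
have := holo p; rewrite V ?n_gt0 ?leqnn// mulr0 add0r big_nat big1 => [Q0|k /andP[k0 kn]].
  have c0 : 2 * n%:R * c_const R n./2 != 0.
    apply: mulf_neq0; last exact: c_const_neq0.
    by apply: mulf_neq0; rewrite pnatr_eq0// -lt0n.
  by apply: (mulfI c0); rewrite Q0 mulr0.
rewrite V; last by lia.
by rewrite linear_diff_operator0 ?mulr0//; case: (adj k); rewrite ?k0.
Qed.
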